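(* In the setting described in the context, assume that an equal partition is performed at the bundling step: all samples are ordered according to some specific measurable sorting function of $X$ and are separated into almost-equal size bundles $\mathbb{B}=\{\mathcal{B}(1),\dots,\mathcal{B}(B)\}$ by this ordering. Further, let a compact set $\mathcal{A}\subset\mathbb{R}^q$ be given such that $C_{v,\mathcal{A}}<\infty$, and let $\iint v^2(y)\,\nu(dx,dy)<\infty$, i.e. the function $v$ is in $L^2$ with respect to the given probability measure. Put $L' := 2LQC_{p,\mathcal{A}}^2+2C_{v,\mathcal{A}}^2$. Then, for any such real function $v:\mathbb{R}^q\to\mathbb{R}$, $$ \begin{aligned} &\hat{\mathbb{E}}_S\Big[\iint |v(y)-\tilde v(x,y)|^2\,\nu(dx,dy)\Big]\\ \le\;& \frac{\vartheta(L')}{\hat{\mathbb{E}}[\mathbf{1}_S]}\,\hat{\mathbb{E}}\Big[\sum_{b=1}^B\int_{\mathcal{B}(b)}\!\int\nu(dx,dy)\,\frac{\big(\log(\sum_{m=1}^M\mathbf{1}_{\mathcal{B}(b)}(X^m)-1)+1\big)(Q+1)}{\sum_{m=1}^M\mathbf{1}_{\mathcal{B}(b)}(X^m)-1}\Big]\\ &+\hat{\mathbb{E}}_S\Big[\sum_{b=1}^{B-1}\int_{\mathcal{B}(b)}\!\int\nu(dx,dy)\,\frac{24L'}{\sum_{m=1}^M\mathbf{1}_{\mathcal{B}(b)}(X^m)}\Big]\\ &+\frac{12}{\hat{\mathbb{E}}[\mathbf{1}_S]}\,\hat{\mathbb{E}}\Big[\sum_{\mathcal{B}\in\mathbb{B}}\int_{\mathcal{B}}\!\int\nu(dx,dy)\,\Big(\inf_{\phi\in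 H}\sup_{x\in\mathcal{B}}\mathbb{E}\big[|v(Y)-\phi(Y)|^2\,\big|\,X=x\big]\wedge L'\Big)\Big]\\ &+\hat{\mathbb{E}}_S\Big[\iint |v(y)-\tilde v(x,y)|^2\,(1-\mathbf{1}_{\mathcal{A}}(y))\,\nu(dx,dy)\Big], \end{aligned} $$ where $\vartheta(L')$ is a function depending on $L'$ (only).
   Context: Setting. $(X,Y)$ is a random vector with $X,Y$ both $\mathbb{R}^q$-valued and joint law $\nu$; $\mathbb{E}$ denotes expectation under this law. On a separate probability space $(\hat\Omega,\hat{\mathcal{F}},\hat{\mathbb{P}})$, with expectation $\hat{\mathbb{E}}$, there are $M$ independent copies $(X^m,Y^m)_{1\le m\le M}$ of $(X,Y)$ (the simulation cloud). Function space. $H$ is the linear span of continuous functions $p_1,\dots,p_Q:\mathbb{R}^q\to\mathbb{R}$. Constants. For a function $\phi$ and a compact set $\mathcal{A}$, $C_{\phi,\mathcal{A}}:=\sup_{x\in\mathcal{A}}|\phi(x)|\in[0,\infty]$, and $C_{p,\mathcal{A}}:=\max_{l=1,\dots,Q}C_{p_l,\mathcal{A}}$. The set $\mathcal{A}$ is introduced only to avoid the restrictive assumption that $v$ is bounded; it plays no role in the construction of $\tilde v$. Equal partition. Let $\mathfrak{S}:\mathbb{R}^q\to\mathbb{R}$ be the measurable sorting function. Order the samples so that $\mathfrak{S}(X^{1^*})\le\mathfrak{S}(X^{2^*})\le\dots\le\mathfrak{S}(X^{M^*})$, split the ordered list into $B$ consecutive groups of almost equal size (of size $M/B$ each when $B$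 divides $M$), and for $b=1,\dots,B-1$ let $x_b$ be the last sample of the $b$-th group. The bundles are $\mathcal{B}(1)=\mathfrak{S}^{-1}((-\infty,\mathfrak{S}(x_1)])$, $\mathcal{B}(b)=\mathfrak{S}^{-1}((\mathfrak{S}(x_{b-1}),\mathfrak{S}(x_b)])$ for $2\le b\le B-1$, and $\mathcal{B}(B)=\mathfrak{S}^{-1}((\mathfrak{S}(x_{B-1}),\infty))$; they form a random partition $\mathbb{B}$ of $\mathbb{R}^q$ depending on $(X^m)_m$. It is assumed throughout that $X^i\ne X^j$ for $i\neq j$ and that the sorting function behaves nicely, in the sense that no bundle is empty or contains only a few samples. Regression estimate. For each $b$, $$\tilde v_b:=\arg\min_{\phi\in H}\frac{\sum_{m=1}^M\mathbf{1}_{\mathcal{B}(b)}(X^m)\,|v(Y^m)-\phi(Y^m)|^2}{\sum_{m=1}^M\mathbf{1}_{\mathcal{B}(b)}(X^m)},\qquad \tilde v_b=\sum_{k=1}^Q\alpha_k(b)\,p_k,$$ where $\alpha(b)=(\alpha_1(b),\dots,\alpha_Q(b))\in\mathbb{R}^Q$ is the vector of least-squares coefficients, satisfying the normal equations $\mathcal{I}^\top\mathcal{I}\alpha(b)=\mathcal{I}^\top v(Y^b)$, with $\mathcal{I}=(p_j(Y^{b,i}))_{i,j}$, $v(Y^b)=(v(Y^{b,i}))_i$, and $(X^{b,i},Y^{b,i})_i$ the samples with $X^{b,i}\in\mathcal{B}(b)$. Then $$\tilde v(x,y):=\sum_{b=1}^B\mathbf{1}_{\mathcal{B}(b)}(x)\,\tilde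 v_b(y).$$ The functions $\tilde v_b$ and $\tilde v$ are random through the simulation cloud. Selection event. For a given (user-chosen) constant $L$, $S$ is the event that the simulation cloud satisfies $|\alpha(b)|^2\le L$ for all $b=1,\dots,B$ ($|\cdot|$ the Euclidean norm). The modified expectation is $\hat{\mathbb{E}}_S[\,\cdot\,]:=\hat{\mathbb{E}}[\,\cdot\,\mathbf{1}_S]/\hat{\mathbb{E}}[\mathbf{1}_S]$, with the conventions $\frac00=0$ and $\frac{K}{0}=\infty$. Notation. $\int_{\mathcal{B}}\int g\,\nu(dx,dy)$ means integration over $x\in\mathcal{B}$, $y\in\mathbb{R}^q$; $a\wedge b=\min(a,b)$. *)

(* Defs.v *)
From HB Require Import structures.
From mathcomp Require Import all_boot all_order all_algebra.
From mathcomp Require Import all_classical all_reals all_analysis.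
Set Implicit Arguments.
Unset Strict Implicit.
Unset Printing Implicit Defensive.
Import Order.TTheory GRing.Theory Num.Theory.
Import numFieldNormedType.Exports.
Local Open Scope classical_set_scope.
Local Open Scope ring_scope.

(* R^q with its Borel sigma-algebra; the carrier is convertible to 'rV[R]_q,
   which carries the topology. *)
Definition borelRV (R : realType) (q : nat) :=
  g_sigma_algebraType (@open 'rV[R]_q).

Definition mutually_independent (R : realType) (d d' : measure_display)
    (Omega : measurableType d) (P : probability Omega R)
    (T : measurableType d') (I : finType) (Z : I -> Omega -> T) : Prop :=
  forall (J : {set I}) (A : I -> set T), (forall i, measurable (A i)) ->
    P (\bigcap_(i in [set i | i \in J]) (Z i @^-1` A i)) =
    (\prod_(i in J) P (Z i @^-1` A i))%E.

(* kappa x is the conditional law of Y given X = x when (X, Y) has law nu. *)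
Definition regular_conditional_law (R : realType) (d d' : measure_display)
    (T : measurableType d) (T' : measurableType d')
    (nu : probability (T * T')%type R) (kappa : R.-pker T ~> T') : Prop :=
  forall (A : set T) (A' : set T'), measurable A -> measurable A' ->
    nu (A `*` A') = (\int[nu]_(z in A `*` setT) kappa z.1 A')%E.

Section constants.
Context {R : realType} {q : nat}.

(* The maximum with 0 only matters for the empty set: suprema are taken
   in [0, +oo]. *)
Definition Csup (phi : 'rV[R]_q -> R) (A : set 'rV[R]_q) : \bar R :=
  maxe 0%E (ereal_sup [set `|phi x|%:E | x in A]).

Definition Csup_basis (Q : nat) (p : 'I_Q -> 'rV[R]_q -> R)
    (A : set 'rV[R]_q) : \bar R :=
  (\big[maxe/0%E]_(l < Q) Csup (p l) A)%E.

(* fine is harmless: both constants are finite for compact A, continuous p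
   and Csup v A < +oo. *)
Definition Lprime (Q : nat) (p : 'I_Q -> 'rV[R]_q -> R) (v : 'rV[R]_q -> R)
    (A : set 'rV[R]_q) (L : R) : R :=
  2 * L * Q%:R * fine (Csup_basis p A) ^+ 2 + 2 * fine (Csup v A) ^+ 2.

Definition lincomb (Q : nat) (p : 'I_Q -> 'rV[R]_q -> R) (a : 'I_Q -> R) :
    'rV[R]_q -> R :=
  fun y => \sum_(k < Q) a k * p k y.

Definition Hspan (Q : nat) (p : 'I_Q -> 'rV[R]_q -> R) :
    set ('rV[R]_q -> R) :=
  range (lincomb p).

End constants.

Section bundles.
Context {R : realType} {q M B : nat}.
Variables (sortf : 'rV[R]_q -> R) (gsize : 'I_B -> nat) (X : 'I_M -> 'rV[R]_q).

Definition almost_equal_sizes : Prop :=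
  (\sum_(b < B) gsize b)%N = M /\
  forall b c : 'I_B, (gsize b <= (gsize c).+1)%N.

Definition sorted_samples : seq 'rV[R]_q :=
  sort (fun x y => sortf x <= sortf y) [seq X m | m <- enum 'I_M].

(* Groups are numbered from 0; this is the last sample of group b. *)
Definition last_sample (b : nat) : 'rV[R]_q :=
  nth 0 sorted_samples (\sum_(c < B | (c <= b)%N) gsize c).-1.

(* For B = 1 the only bundle is the whole space. *)
Definition bundle (b : 'I_B) : set 'rV[R]_q :=
  [set x | ((0 < b)%N -> sortf (last_sample b.-1) < sortf x) /\
           ((b.+1 < B)%N -> sortf x <= sortf (last_sample b))].

Definition bundle_count (b : 'I_B) : R :=
  \sum_(m < M) \1_(bundle b) (X m).

Definition empirical_loss (v : 'rV[R]_q -> R) (Y : 'I_M -> 'rV[R]_q)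
    (b : 'I_B) (phi : 'rV[R]_q -> R) : R :=
  (\sum_(m < M) \1_(bundle b) (X m) * `|v (Y m) - phi (Y m)| ^+ 2)
  / bundle_count b.

Definition least_squares (Q : nat) (p : 'I_Q -> 'rV[R]_q -> R)
    (v : 'rV[R]_q -> R) (Y : 'I_M -> 'rV[R]_q)
    (alpha : 'I_B -> 'I_Q -> R) : Prop :=
  forall (b : 'I_B) (phi : 'rV[R]_q -> R), Hspan p phi ->
    empirical_loss v Y b (lincomb p (alpha b)) <= empirical_loss v Y b phi.

Definition vtilde (Q : nat) (p : 'I_Q -> 'rV[R]_q -> R)
    (alpha : 'I_B -> 'I_Q -> R) (x y : 'rV[R]_q) : R :=
  \sum_(b < B) \1_(bundle b) x * lincomb p (alpha b) y.

End bundles.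

Section modified_expectation.
Context {R : realType} {d : measure_display} {Omega : measurableType d}.
Variable P : probability Omega R.
Local Open Scope ereal_scope.

(* In \bar R, 0^-1 = +oo and 0 * +oo = 0, so that 0 / 0 = 0 and K / 0 = +oo
   for K > 0. *)
Definition expectation_on (S : set Omega) (f : Omega -> \bar R) : \bar R :=
  (\int[P]_w (f w * (\1_S w)%:E)) / 'E_P[\1_S].

End modified_expectation.

Definition selection_event (R : realType) (Omega : Type) (B Q : nat)
    (alpha : 'I_B -> 'I_Q -> Omega -> R) (L : R) : set Omega :=
  [set w | forall b : 'I_B, \sum_(k < Q) alpha b k w ^+ 2 <= L].

Section right_hand_side.
Context {R : realType} {q : nat}.
Local Open Scope ereal_scope.

Definition conditional_mse (kappa : R.-pker (borelRV R q) ~> (borelRV R q))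
    (v phi : 'rV[R]_q -> R) (x : 'rV[R]_q) : \bar R :=
  \int[kappa x]_y (`|v y - phi y| ^+ 2)%:E.

Definition bundle_bias (kappa : R.-pker (borelRV R q) ~> (borelRV R q))
    (Q : nat) (p : 'I_Q -> 'rV[R]_q -> R) (v : 'rV[R]_q -> R)
    (L' : R) (D : set 'rV[R]_q) : \bar R :=
  mine (ereal_inf [set ereal_sup [set conditional_mse kappa v phi x | x in D]
                  | phi in Hspan p]) L'%:E.

End right_hand_side.

(* Main.v *)
Require Import Defs.
From HB Require Import structures.
From mathcomp Require Import all_boot all_order all_algebra.
From mathcomp Require Import zify ring lra.
Import Order.TTheory GRing.Theory Num.Theory.
Local Open Scope ring_scope.

(** Over [A], on the selection event, the squared error of every fitted [lincomb p (alpha b)]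
    is at most [L'] ([square_loss_le_Lprime]). There it equals the clipped loss
    [min ((v - phi)^2, L') * 1_A], a bounded function; the complement of [A] is the last
    term of the bound. What has to be shown is that, bundle by bundle, the [nu]-integral
    of the clipped loss is at most the mass of the bundle times four times the mean of that
    loss over its samples, plus a deviation. The deviation is taken over the whole span at
    once, and its expectation is at most that of [18 * L'] times the mass of the bundle times
    [(ln (N - 1) + 1) * (Q + 1) / (N - 1)].

    The bundles are cut by order statistics, so they are not independent of the samples
    they contain. The remedy is an exchange property: a sample strictly between the two
    boundary order statistics of a bundle may be moved anywhere between them without
    changing the bundle ([interior_resampling]). Take a second, independent cloud of
    ghosts, on the event that the relevant ghosts fall between the boundaries, and weigh
    it with the inverse of the probability of that event, up to one factor. This weight
    is invariant under exchanges of interior samples with their ghosts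
    ([region_weight_swap]) and integrates to the mass of the region
    ([integral_region_weight_le]), so the integral of the largest excess of a ghost sum
    over twice the sample sum may be averaged over all exchanges ([symmetrization]).
    For fixed clouds this average is combinatorial. The layer-cake formula reduces a
    loss to its level sets ([layer_cake]). On the [2 * n] sample and ghost points the
    level sets of all clipped losses together form at most [(2 * n + 1)^(2 * (Q + 1))]
    patterns, because they are unions of two positivity sets of affine functions and
    those are counted by Pajor's lemma ([clipped_loss_patterns], [card_le_shattered]).
    Since the sample is counted twice, every pattern has a bounded exponential moment
    ([sum_expR_swap_gain]), so the maximum over the patterns is of the order of the
    logarithm of their number ([sum_max_swap_gain], [deviation_rate]).

    As [alpha b] minimizes the empirical loss, the mean of its clipped loss is at most
    the minimum of [L'] and of the least empirical loss over the span. Conditionally on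
    the first components of the cloud, the average of this minimum is at most
    [bundle_bias] ([resampled_bias_le_bundle_bias]); the conditional average is taken one
    coordinate at a time, replacing a second component by a draw from [kappa]
    ([resample_all_le]). The function [bundle_bias] of a random bundle is a supremum over
    uncountably many points and may fail to be measurable; the comparison goes through
    the description of its integral by simple functions from below
    ([le_lower_integral]).

    When there are boundaries at all, that is two bundles or more, the exchange argument
    wants the scores of the samples to be distinct and boundary scores to carry no mass.
    This follows from the assumption that no bundle is small: an atom of the law of the
    score would make a bundle empty with positive probability ([scores_atomless],
    [ae_injective_scores]). *)

Set Implicit Arguments.
Unset Strict Implicit.
Unset Printing Implicit Defensive.

(** * Sign patterns of affine functions *)

Section vc.
Local Open Scope nat_scope.
Variable J : finType.
Implicit Types (C : {set {set J}}) (S : {set J}).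

Definition shatters C S : bool :=
  [forall A : {set J}, (A \subset S) ==> [exists c in C, c :&: S == A]].

Lemma shattersP C S :
  reflect (forall A : {set J}, A \subset S -> exists2 c, c \in C & c :&: S = A)
          (shatters C S).
Proof.
apply: (iffP forallP) => [h A AS|h A].
  by have /implyP/(_ AS)/exists_inP[c cC /eqP cA] := h A; exists c.
by apply/implyP => /h[c cC cA]; apply/exists_inP; exists c => //; apply/eqP.
Qed.

Lemma shattersS C C' S : C \subset C' -> shatters C S -> shatters C' S.
Proof.
move=> CC' /shattersP h; apply/shattersP => A /h[c cC cA].
by exists c => //; move/subsetP: CC'; exact.
Qed.

(** Pajor's lemma, by induction on the family: split it along a point [x] on which
    two members disagree. A set shattered by both halves stays shattered after [x]
    is added to it, so the shattered sets of the two halves can be counted side by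
    side. *)
Lemma card_le_shattered C : #|C| <= #|[set S | shatters C S]|.
Proof.
have [m] := ubnP #|C|; elim: m => // m IH in C *; rewrite ltnS => Cm.
have [C1|] := leqP #|C| 1.
  have [->|[c cC]] := set_0Vmem C; first by rewrite cards0.
  apply: (leq_trans C1); rewrite card_gt0; apply/set0Pn.
  exists (set0 : {set J}).
  rewrite inE; apply/shattersP => A; rewrite subset0 => /eqP ->.
  by exists c => //; rewrite setI0.
move=> /card_gt1P[c1 [c2 [c1C c2C c12]]].
have [x xc] : exists x, (x \in c1) != (x \in c2).
  apply/existsP; apply: contraNT c12; rewrite negb_exists => /forallP h.
  by apply/eqP/setP => x; apply/eqP; have := h x; rewrite negbK.
wlog [x1 x2] : c1 c2 c1C c2C c12 xc / x \in c1 /\ x \notin c2.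
  move=> H; have := xc; case: (boolP (x \in c1)) => h1; case: (boolP (x \in c2)) => h2 // _.
    by apply: (H c1 c2).
  by apply: (H c2 c1) => //; rewrite eq_sym.
pose C1 := [set c in C | x \in c]; pose C0 := [set c in C | x \notin c].
have cardC : #|C| = #|C1| + #|C0|.
  rewrite -(cardsID [set c : {set J} | x \in c] C); congr (_ + _).
  - by apply: eq_card => c; rewrite !inE.
  - by apply: eq_card => c; rewrite !inE andbC.
have C1p : 0 < #|C1| by rewrite card_gt0; apply/set0Pn; exists c1; rewrite inE c1C.
have C0p : 0 < #|C0| by rewrite card_gt0; apply/set0Pn; exists c2; rewrite inE c2C.
pose sh C' := [set S | shatters C' S].
have IH1 : #|C1| <= #|sh C1| by apply: IH; rewrite cardC in Cm; lia.
have IH0 : #|C0| <= #|sh C0| by apply: IH; rewrite cardC in Cm; lia.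
have x1N S : shatters C1 S -> x \notin S.
  move=> /shattersP/(_ (S :\ x)) []; first exact: subD1set.
  move=> c; rewrite inE => /andP[_ xc'] /setP/(_ x); rewrite !inE xc' eqxx /=.
  by move=> ->.
have x0N S : shatters C0 S -> x \notin S.
  move=> /shattersP/(_ S (subxx _))[c]; rewrite inE => /andP[_ xc'] /setP/(_ x).
  by rewrite !inE (negbTE xc') /= => <-.
have xU S : x \notin S -> S = (x |: S) :\ x by move=> xS; rewrite setU1K.
rewrite cardC (leq_trans (leq_add IH1 IH0))//.
rewrite -cardsUI -[X in _ + X <= _](card_in_imset (f := fun S => x |: S)); last first.
  move=> S S'; rewrite !inE => /andP[/x1N xS _] /andP[/x1N xS' _] /(congr1 (fun S => S :\ x)).
  by rewrite -!xU.
rewrite -cardsUI [X in _ + X](_ : _ = 0) ?addn0; last first.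
  apply/eqP; rewrite cards_eq0; apply/eqP/setP => S; rewrite !inE.
  apply/negbTE/negP => /andP[h /imsetP[S' _ SE]].
  have xS : x \in S by rewrite SE !inE eqxx.
  by move: h => /orP[/x1N|/x0N]; rewrite xS.
apply: subset_leq_card; apply/subsetP => S; rewrite !inE.
move=> /orP[/orP[]|/imsetP[S']].
- by apply: shattersS; apply/subsetP => c; rewrite inE => /andP[].
- by apply: shattersS; apply/subsetP => c; rewrite inE => /andP[].
rewrite !inE => /andP[s1 s0] ->.
have xS' := x1N _ s1.
apply/shattersP => A AS; have AxS : A :\ x \subset S'.
  by rewrite (xU _ xS') setSD.
have key (c : {set J}) (b : bool) : (x \in c) = (x \in A) -> c :&: S' = A :\ x -> c \in (if b then C1 else C0) ->
    c \in C /\ c :&: (x |: S') = A.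
  move=> xcA cA cC; split; first by case: b cC; rewrite inE => /andP[].
  apply/setP => y; rewrite !inE.
  have [->|yx] /= := eqVneq y x; first by rewrite xcA andbT.
  by move/setP/(_ y): cA; rewrite !inE yx.
case: (boolP (x \in A)) => xA.
  have [c cC cA] := shattersP _ _ s1 _ AxS.
  by have [] := key c true _ cA cC; [move: cC; rewrite xA inE => /andP[] | exists c].
have [c cC cA] := shattersP _ _ s0 _ AxS.
have [] := key c false _ cA cC; last by exists c.
by move: cC; rewrite (negbTE xA) inE => /andP[_ /negbTE].
Qed.

(** A set of at most [D] points is the set of values of a function of [D] indices,
    [None] serving as padding. *)
Lemma card_small_subsets (W : {set J}) D :
  #|[set S : {set J} | (S \subset W) && (#|S| <= D)]| <= (#|W|.+1) ^ D.
Proof.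
pose W' : {set option J} := None |: [set Some x | x in W].
have cW : #|W'| = #|W|.+1.
  rewrite cardsU1 (card_imset _ Some_inj); case: imsetP => //.
  by case.
pose F (g : {ffun 'I_D -> option J}) := [set x | [exists i, g i == Some x]].
rewrite -cW -[X in _ ^ X](card_ord D) -card_ffun_on.
rewrite -[X in _ <= X]cardsE.
apply: leq_trans (leq_imset_card F _).
apply: subset_leq_card; apply/subsetP => S; rewrite inE => /andP[SW SD].
pose g := [ffun i : 'I_D => nth None [seq Some x | x <- enum S] i].
apply/imsetP; exists g.
  rewrite inE; apply/ffun_onP => i; rewrite ffunE.
  have [iS|iS] := ltnP i (size (enum S)); last first.
    by rewrite nth_default ?size_map// /W' setU11.
  have x0 : J by case: (enum S) iS.
  rewrite (nth_map x0)//; apply/setU1P; right; apply: imset_f.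
  by apply: (subsetP SW); rewrite -mem_enum mem_nth.
apply/setP => x; rewrite !inE; apply/idP/existsP => [xS|[i]].
  have ix : index x (enum S) < size (enum S) by rewrite index_mem mem_enum.
  have iD : index x (enum S) < D by rewrite (leq_trans ix)// -cardE.
  exists (Ordinal iD); rewrite ffunE /= (nth_map x)// nth_index// mem_enum//.
rewrite ffunE; have [iS|iS] := ltnP i (size (enum S)); last first.
  by rewrite nth_default ?size_map.
have x0 : J by case: (enum S) iS.
by rewrite (nth_map x0)// => /eqP[<-]; rewrite -mem_enum mem_nth.
Qed.

(** The Sauer-Shelah bound, with a cruder polynomial: Pajor's lemma leaves only the
    small subsets of [W] to be counted. *)
Lemma card_vc (W : {set J}) C D :
  (forall c, c \in C -> c \subset W) ->
  (forall S, shatters C S -> #|S| <= D) -> #|C| <= (#|W|.+1) ^ D.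
Proof.
move=> CW CD; apply: leq_trans (card_le_shattered _) _.
apply: leq_trans (card_small_subsets W D); apply: subset_leq_card.
apply/subsetP => S; rewrite !inE => hS; rewrite CD// andbT.
by have [c /CW + <-] := shattersP _ _ hS _ (subxx _); move/subsetP => cW; apply/subsetP => x; rewrite inE => /andP[/cW].
Qed.

End vc.

Section halfspaces.
Variables (R : realFieldType) (J : finType) (D : nat).
Variables (g : J -> R) (p : 'I_D -> J -> R).

Definition positivity_set (W : {set J}) (a : 'I_D -> R) : {set J} :=
  [set j in W | 0 < g j + \sum_k a k * p k j].

(** More than [D] points have linearly dependent values in dimension [D], and
    changing the sign of the dependency fixes the sign of its pairing with [g]. *)
Lemma linear_dependency (S : {set J}) : (D < #|S|)%N ->
  exists c : J -> R, [/\ (forall k, \sum_(j in S) c j * p k j = 0),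
     exists2 j, j \in S & c j != 0 & \sum_(j in S) c j * g j <= 0] .
Proof.
move=> DS.
pose A : 'M[R]_(#|S|, D) := \matrix_(i, k) p k (enum_val i).
have : kermx A != 0.
  rewrite kermx_eq0 /row_free neq_ltn (leq_ltn_trans (rank_leq_col _))//.
move=> /rowV0Pn[u uker u0].
have uA : u *m A = 0 by apply/eqP; rewrite -sub_kermx.
have [i ui] : exists i, u 0 i != 0.
  apply/existsP; apply: contraNT u0; rewrite negb_exists => /forallP h.
  by apply/eqP/rowP => i; rewrite mxE; apply/eqP; have := h i; rewrite negbK.
have jS : enum_val i \in S := enum_valP i.
pose c j := u 0 (enum_rank_in jS j).
have sumE (F : J -> R) : \sum_(j in S) c j * F j = \sum_i u 0 i * F (enum_val i).
  rewrite (reindex_onto (enum_val (A := S)) (enum_rank_in jS)); last first.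
    by move=> j jS'; rewrite enum_rankK_in.
  apply: eq_big => i'; first by rewrite enum_valP enum_valK_in eqxx.
  by rewrite /c enum_valK_in.
have c0 k : \sum_(j in S) c j * p k j = 0.
  have : (u *m A) 0 k = 0 by rewrite uA mxE.
  rewrite sumE mxE => {2}<-; apply: eq_bigr => i' _.
  by rewrite mxE.
have cn : c (enum_val i) != 0 by rewrite /c enum_valK_in.
have [hle|hlt] := lerP (\sum_(j in S) c j * g j) 0.
  by exists c; split => //; exists (enum_val i).
exists (fun j => - c j); split.
- move=> k; under eq_bigr do rewrite mulNr.
  by rewrite sumrN c0 oppr0.
- by exists (enum_val i) => //; rewrite oppr_eq0.
- under eq_bigr do rewrite mulNr.
  by rewrite sumrN oppr_le0 ltW.
Qed.

(** A dependency [c] among more than [D] points gives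
    [\sum_j c j * (g j + \sum_k a k * p k j)] the same nonpositive value for all
    [a]. If the points were shattered, the subset where [0 < c j] would be cut out
    by some [a], for which every term of that sum is nonnegative. Equality is ruled
    out by a positive [c j]; if there is none, by a negative sum or by passing to
    [- c]. *)
Lemma positivity_sets_shatter (C : {set {set J}}) (W S : {set J}) :
  (forall c, c \in C -> exists a, c = positivity_set W a) ->
  shatters C S -> (#|S| <= D)%N.
Proof.
move=> CE hS; rewrite leqNgt; apply/negP => DS.
have SW : S \subset W.
  have [c cC cS] := shattersP _ _ hS _ (subxx _).
  have [a ca] := CE _ cC; rewrite -cS ca; apply/subsetP => j; rewrite !inE.
  by move=> /andP[/andP[]].
have [c [cp [j0 j0S cj0] cg]] := linear_dependency DS.
have key (c' : J -> R) : (forall k, \sum_(j in S) c' j * p k j = 0) ->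
    \sum_(j in S) c' j * g j <= 0 ->
    (\sum_(j in S) c' j * g j < 0 \/ exists2 j, j \in S & 0 < c' j) -> False.
  move=> c'p c'g c'pos.
  have AS : [set j in S | 0 < c' j] \subset S.
    by apply/subsetP => j; rewrite inE => /andP[].
  have [d dC dS] := shattersP _ _ hS _ AS.
  have [a da] := CE _ dC.
  pose h j := g j + \sum_k a k * p k j.
  have hE : \sum_(j in S) c' j * h j = \sum_(j in S) c' j * g j.
    under eq_bigr do rewrite mulrDr mulr_sumr.
    rewrite big_split/= exchange_big/= [X in _ + X]big1 ?addr0// => k _.
    under eq_bigr do rewrite mulrCA.
    by rewrite -mulr_sumr c'p mulr0.
  have hpos j : j \in S -> (0 < h j) = (0 < c' j).
    by move=> jS; move/setP/(_ j): dS; rewrite da !inE jS andbT (subsetP SW _ jS) /= /h => ->.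
  have h0 j : j \in S -> 0 <= c' j * h j.
    move=> jS; have := hpos j jS.
    have [c'j|c'j] := ltrP 0 (c' j); have [hj|hj] := ltrP 0 (h j) => // _.
      by rewrite mulr_ge0 ?ltW.
    by rewrite mulr_le0.
  case: c'pos => [|[j1 j1S cj1]].
    by rewrite -hE ltNge sumr_ge0.
  suff : 0 < \sum_(j in S) c' j * h j by rewrite hE ltNge c'g.
  rewrite (bigD1 j1)//= ltr_pwDl ?mulr_gt0 ?hpos// sumr_ge0// => j /andP[jS _].
  exact: h0.
have [/existsP[j1 /andP[j1S cj1]]|] := boolP [exists j, (j \in S) && (0 < c j)].
  by apply: (key c) => //; right; exists j1.
rewrite negb_exists => /forallP cN.
have cneg j : j \in S -> c j <= 0.
  by move=> jS; have := cN j; rewrite jS /= -leNgt.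
have [cg0|cg0] := ltrP (\sum_(j in S) c j * g j) 0.
  by apply: (key c) => //; left.
apply: (key (fun j => - c j)).
- by move=> k; under eq_bigr do rewrite mulNr; rewrite sumrN cp oppr0.
- by under eq_bigr do rewrite mulNr; rewrite sumrN oppr_le0.
- by right; exists j0; rewrite // oppr_gt0 lt_neqAle cj0 cneg.
Qed.

Lemma card_positivity_sets (C : {set {set J}}) (W : {set J}) :
  (forall c, c \in C -> exists a, c = positivity_set W a) ->
  (#|C| <= (#|W|.+1) ^ D)%N.
Proof.
move=> CE; apply: (card_vc (W := W)); last first.
  by move=> S; exact: positivity_sets_shatter CE.
by move=> c /CE[a ->]; apply/subsetP => j; rewrite inE => /andP[].
Qed.

End halfspaces.

(** * Random swaps *)

From mathcomp Require Import all_classical all_reals all_analysis.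
From mathcomp Require Import measurable_realfun.
Import numFieldNormedType.Exports.
Local Open Scope classical_set_scope.
Local Open Scope ring_scope.

(** A function with values in [0, L] is the integral over the levels [t] of the
    indicators of [t < a j], so a bound on the weight of every level set passes to
    [a]. For finitely many values the integral becomes an induction that peels off
    the smallest positive value. *)
Lemma layer_cake (R : realDomainType) (J : finType) (W : {pred J}) (w a : J -> R) (L B : R) :
  (forall j, j \in W -> 0 <= a j <= L) -> 0 <= L -> 0 <= B ->
  (forall t, 0 <= t < L -> \sum_(j in W | t < a j) w j <= B) ->
  \sum_(j in W) w j * a j <= L * B.
Proof.
move=> + + B0; have [m] := ubnP (#|[pred j in W | 0 < a j]|).
elim: m => // m IH in a L *; rewrite ltnS => am aL L0 tB.
have [[j0 /andP[j0W j0a]]|none] := pselect (exists j, (j \in W) && (0 < a j)); last first.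
  rewrite big1 ?mulr_ge0// => j jW; have /andP[a0 _] := aL _ jW.
  have [aj|aj] := ltrP 0 (a j); first by case: none; exists j; rewrite jW.
  by rewrite (@le_anti _ _ (a j) 0) ?mulr0// a0 aj.
pose P := [pred j | (j \in W) && (0 < a j)].
have Pj0 : P j0 by rewrite /= j0W.
case: (arg_minP a Pj0) => j1 /andP[j1W a1] amin.
(* What remains of [a] once the layer between 0 and its smallest positive value is off. *)
pose b j := if 0 < a j then a j - a j1 else 0.
have a1L : a j1 <= L by have /andP[] := aL _ j1W.
have sumE : \sum_(j in W) w j * a j =
    a j1 * \sum_(j in W | 0 < a j) w j + \sum_(j in W) w j * b j.
  rewrite big_mkcondr /= mulr_sumr -big_split /=; apply: eq_bigr => j jW.
  rewrite /b; case: ifPn => aj; first by rewrite (mulrC (a j1)) -mulrDr addrC subrK.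
  rewrite !mulr0 addr0; have /andP[a0 _] := aL _ jW.
  by rewrite (@le_anti _ _ (a j) 0) ?mulr0// a0 leNgt aj.
rewrite sumE -[X in X * B](subrK (a j1)) [X in X * B]addrC mulrDl.
have Lp : 0 < L by exact: lt_le_trans a1 a1L.
apply: lerD; first by rewrite ler_wpM2l ?(ltW a1)// tB// lexx Lp.
apply: IH.
- apply: leq_trans am; apply: proper_card; apply/fintype.properP; split.
    apply/fintype.subsetP => j; rewrite !inE => /andP[-> ] /=.
    by rewrite /b; case: ifP => //; rewrite ltxx.
  by exists j1; rewrite !inE ?j1W ?a1//= /b a1 subrr ltxx.
- move=> j jW; have /andP[a0 ajL] := aL _ jW; rewrite /b.
  case: ifPn => aj; last by rewrite lexx subr_ge0.
  by rewrite subr_ge0 amin ?inE ?jW// lerB.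
- by rewrite subr_ge0.
move=> t /andP[t0 tL]; apply: le_trans (tB (t + a j1) _); last first.
  by rewrite addr_ge0 ?(ltW a1)// -ltrBrDr.
rewrite le_eqVlt; apply/orP; left; apply/eqP; apply: eq_bigl => j.
rewrite /b; case: ifPn => aj; first by rewrite ltrBrDr.
rewrite -leNgt in aj; congr andb.
rewrite [LHS]ltNge t0/=; symmetry; apply/negbTE; rewrite -leNgt.
by rewrite (le_trans aj)// addr_ge0// ltW.
Qed.

Section swap_average.
Variables (R : realType) (I : finType) (K : {set I}).

(** Index [(k, b)] stands for the sample ([b = false]) or the ghost ([b = true]) at
    coordinate [k], and [s] says which coordinates are swapped: after the swap,
    [(k, ~~ s k)] is the ghost and [(k, s k)] the sample. Counting the sample twice
    gives the gain a negative drift, which is what makes an exponential moment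
    bounded. *)
Definition swap_gain (c : {set I * bool}) (s : {ffun I -> bool}) : R :=
  \sum_(k in K) (((k, ~~ s k) \in c)%:R - 2 * ((k, s k) \in c)%:R).

Definition max_swap_gain (C : {set {set I * bool}}) (s : {ffun I -> bool}) : R :=
  \big[Num.max/0]_(c in C) swap_gain c s.

Lemma max_swap_gain_ge0 C s : 0 <= max_swap_gain C s.
Proof. by rewrite /max_swap_gain; elim/big_rec: _ => // c x _ x0; rewrite le_max x0 orbT. Qed.

Lemma swap_gain_le_max (C : {set {set I * bool}}) c s : c \in C -> swap_gain c s <= max_swap_gain C s.
Proof. by move=> cC; rewrite /max_swap_gain (bigD1 c)//= le_max lexx. Qed.

Let lam : R := ln (3 / 2).

Let expR_lam : expR lam = 3 / 2.
Proof. by rewrite /lam lnK// posrE; lra. Qed.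

Let lam_ge : 1 / 3 <= lam.
Proof.
have := expR_ge1Dx (- lam); rewrite expRN expR_lam invf_div; lra.
Qed.

(** The swaps of different coordinates are independent, so the sum is a product with
    one factor per coordinate. The base [3 / 2] of the exponential keeps each factor
    at most 2; the case of a coordinate with exactly one of its two points in [c]
    reads [3 / 2 + (3 / 2) ^- 2 <= 2]. *)
Lemma sum_expR_swap_gain (c : {set I * bool}) :
  \sum_s expR (lam * swap_gain c s) <= 2 ^+ #|I|.
Proof.
pose F k (b : bool) : R := if k \in K then
  expR (lam * (((k, ~~ b) \in c)%:R - 2 * ((k, b) \in c)%:R)) else 1.
have -> : \sum_s expR (lam * swap_gain c s) = \sum_(s : {ffun I -> bool}) \prod_k F k (s k).
  apply: eq_bigr => s _; rewrite /swap_gain mulr_sumr expR_sum /F.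
  by rewrite -big_mkcond.
rewrite -bigA_distr_bigA /= -[X in _ <= X ^+ _]/(2%:R).
have <- : \prod_(k : I) (2 : R) = 2 ^+ #|I| by rewrite prodr_const.
apply: ler_prod => k _; rewrite !big_bool /F /=.
have p2 : expR (lam * (0 - 2 * 1)) = (3 / 2) ^- 2 :> R.
  by rewrite sub0r mulr1 mulrN expRN expRM_natr expR_lam.
have p1 : expR (lam * (1 - 2 * 1)) = (3 / 2)^-1 :> R.
  by rewrite mulr1 (_ : 1 - 2 = -1 :> R) ?mulrN1 ?expRN ?expR_lam//; lra.
have p0 : expR (lam * (1 - 2 * 0)) = 3 / 2 :> R.
  by rewrite mulr0 subr0 mulr1 expR_lam.
have p00 : expR (lam * (0 - 2 * 0)) = 1 :> R.
  by rewrite mulr0 subr0 mulr0 expR0.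
case: (k \in K); last by rewrite addr_ge0//=; lra.
rewrite addr_ge0 ?expR_ge0//=.
case: ((k, true) \in c); case: ((k, false) \in c) => /=;
  rewrite ?p0 ?p1 ?p2 ?p00; lra.
Qed.

(** The exponential of the maximum is at most the sum of the exponentials. Jensen's
    inequality then trades the number of patterns for its logarithm; concavity
    enters through the tangent of the exponential at [ln N]. *)
Lemma sum_max_swap_gain (C : {set {set I * bool}}) :
  \sum_s max_swap_gain C s <= 2 ^+ #|I| * (3 * ln (1 + #|C|%:R)).
Proof.
set N : R := 1 + #|C|%:R.
have N0 : 0 < N by rewrite ltr_pwDl.
have lnN0 : 0 <= ln N by rewrite ln_ge0// lerDl.
have bound s : expR (lam * max_swap_gain C s) <= 1 + \sum_(c in C) expR (lam * swap_gain c s).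
  rewrite /max_swap_gain; elim/big_rec2: _ => [|c x y cC].
    by rewrite mulr0 expR0 addr0.
  move=> IH; rewrite maxEle; case: ifPn => _.
    by rewrite (le_trans IH)// lerD2l lerDr expR_ge0.
  rewrite addrCA lerDl; apply: le_trans IH; exact: expR_ge0.
have : \sum_s (lam * max_swap_gain C s) <= 2 ^+ #|I| * ln N.
  apply: (@le_trans _ _ (\sum_(s : {ffun I -> bool}) (ln N - 1 + N^-1 * expR (lam * max_swap_gain C s)))).
    apply: ler_sum => s _.
    have := expR_ge1Dx (lam * max_swap_gain C s - ln N).
    rewrite expRD expRN lnK ?posrE//; lra.
  rewrite big_split /= sumr_const card_ffun card_bool -mulr_sumr.
  apply: (@le_trans _ _ ((ln N - 1) *+ 2 ^ #|I| + 2 ^+ #|I|)); last first.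
    by rewrite -[X in X + _]mulr_natl natrX; lra.
  rewrite lerD2l mulrC ler_pdivrMr//.
  apply: (@le_trans _ _ (\sum_(s : {ffun I -> bool}) (1 + \sum_(c in C) expR (lam * swap_gain c s)))).
    exact: ler_sum.
  rewrite big_split/= sumr_const card_ffun card_bool exchange_big/=.
  rewrite mulrDr mulr1 natrX lerD2l mulr_natr -sumr_const.
  by apply: ler_sum => c _; exact: sum_expR_swap_gain.
rewrite -mulr_sumr => h.
have S0 : 0 <= \sum_s max_swap_gain C s by apply: sumr_ge0 => s _; exact: max_swap_gain_ge0.
have : (1 / 3) * \sum_s max_swap_gain C s <= lam * \sum_s max_swap_gain C s.
  exact: ler_wpM2r.
lra.
Qed.

(** The layer-cake bound with weight 1 on the ghosts and -2 on the samples: the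
    level sets of [a] are members of [C], whose gains are at most the maximal
    one. *)
Lemma swap_gain_bound (C : {set {set I * bool}}) (a : I * bool -> R) (L : R) (s : {ffun I -> bool}) :
  (forall j, 0 <= a j <= L) -> 0 <= L ->
  (forall t, 0 <= t < L -> finset (fun j : I * bool => (j.1 \in K) && (t < a j)) \in C) ->
  \sum_(k in K) (a (k, ~~ s k) - 2 * a (k, s k)) <= L * max_swap_gain C s.
Proof.
move=> aL L0 aC.
pose w (j : I * bool) : R := if j.2 == s j.1 then - 2 else 1.
have sumE (F : I * bool -> R) : \sum_(j | j.1 \in K) w j * F j =
    \sum_(k in K) (F (k, ~~ s k) - 2 * F (k, s k)).
  transitivity (\sum_(j | (j.1 \in K) && true) w (j.1, j.2) * F (j.1, j.2)).
    by apply: eq_big => -[k b]; rewrite ?andbT.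
  rewrite -(pair_big_dep (mem K) (fun _ _ => true) (fun k b => w (k, b) * F (k, b)))/=.
  apply: eq_bigr => k _; rewrite big_bool /w /=.
  by case: (s k) => /=; rewrite mulNr mul1r // addrC.
rewrite -sumE; apply: (@layer_cake _ _ [pred j | j.1 \in K]) => //.
  exact: max_swap_gain_ge0.
move=> t tL; apply: le_trans (swap_gain_le_max s (aC t tL)).
pose F (j : I * bool) : R :=
  (j \in finset (fun j : I * bool => (j.1 \in K) && (t < a j)))%:R.
rewrite [leRHS](_ : _ = \sum_(k in K) (F (k, ~~ s k) - 2 * F (k, s k)))//.
rewrite -sumE big_mkcondr/= le_eqVlt; apply/orP; left; apply/eqP.
apply: eq_bigr => j; rewrite inE => jK; rewrite /F inE jK /=.
by case: (t < a j); rewrite ?mulr1 ?mulr0.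
Qed.

End swap_average.

Lemma ln_le2 (R : realType) (k : nat) : (0 < k)%N -> ln (5 * k%:R : R) <= 2 * (ln k%:R + 1).
Proof.
move=> k0; have kR : 0 < k%:R :> R by rewrite ltr0n.
have lnk : 0 <= ln (k%:R : R) by rewrite ln_ge0// ler1n.
have e2 : (5 : R) <= expR 2.
  have -> : (2 : R) = 4%:R * (1 / 2) by lra.
  rewrite expRM_natl; have h := expR_ge1Dx (1 / 2 : R).
  apply: (@le_trans _ _ ((1 + 1 / 2) ^+ 4)); first by lra.
  by rewrite lerXn2r// nnegrE; lra.
rewrite lnM ?posrE ?ltr0n//.
suff : ln (5 : R) <= 2 by lra.
by rewrite -[leRHS]expRK ler_ln ?posrE ?expR_gt0//; lra.
Qed.

(** In a bundle of [k + 1] samples, [n] of them interior, the patterns number at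
    most a power [2 * (Q + 1)] of [2 * n + 1 <= 5 * k]. The constant collects the
    factor 3, the factor 2 of [ln_le2] and an exponent [2 * Q + 3], in
    [3 * 2 * (2 * Q + 3) <= 18 * (Q + 1)]. *)
Lemma deviation_rate (R : realType) (Q k n N : nat) : (0 < k)%N -> (k <= n <= k.+1)%N ->
  (N <= (2 * n).+1 ^ (2 * Q.+1))%N ->
  3 * ln (1 + N%:R) / n%:R <= 18 * ((ln (k%:R : R) + 1) * (Q%:R + 1) / k%:R).
Proof.
move=> k0 /andP[kn nk] NN.
have kR : 0 < k%:R :> R by rewrite ltr0n.
have lnk : 0 <= ln (k%:R : R) by rewrite ln_ge0// ler1n.
set x : nat := (2 * n).+1.
have x2 : (2 <= x)%N by rewrite /x; lia.
have x1 : (x <= 5 * k)%N by rewrite /x; lia.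
have Nx : (1 + N <= x ^ (2 * Q.+1).+1)%N.
  rewrite expnS; have : (0 < x ^ (2 * Q.+1))%N by rewrite expn_gt0.
  by move: NN; rewrite -/x; nia.
have lnN : ln (1 + N%:R : R) <= (2 * Q.+1).+1%:R * (2 * (ln k%:R + 1)).
  apply: (@le_trans _ _ (ln ((x ^ (2 * Q.+1).+1)%:R : R))).
    by rewrite ler_ln ?posrE ?ltr0n ?expn_gt0// -?natr1 -?(natrD _ 1) ?ler_nat// ltr_pwDl.
  rewrite natrX lnXn ?ltr0n// -[leLHS]mulr_natl ler_wpM2l//.
  by rewrite (le_trans _ (ln_le2 _ k0))// -natrM ler_ln ?posrE ?ltr0n ?ler_nat//; lia.
have -> : 18 * ((ln (k%:R : R) + 1) * (Q%:R + 1) / k%:R) = 18 * ((ln (k%:R : R) + 1) * (Q%:R + 1)) / k%:R.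
  by rewrite mulrA.
apply: ler_pM.
- by rewrite mulr_ge0// ln_ge0// lerDl.
- by rewrite invr_ge0.
- apply: (@le_trans _ _ (3 * ((2 * Q.+1).+1%:R * (2 * (ln k%:R + 1))))); first by rewrite ler_wpM2l.
  have -> : (2 * Q.+1).+1%:R = 2 * Q%:R + 3 :> R.
    by rewrite -(addn1 (2 * _)) natrD natrM -(addn1 Q) natrD; lra.
  have : 0 <= Q%:R :> R by [].
  nra.
- by rewrite lef_pV2 ?posrE ?ltr0n ?ler_nat//; lia.
Qed.

(** For [t < L] the clipped loss exceeds [t] where [sqrt t < v - phi] or
    [sqrt t < phi - v]. Both conditions are positivity sets of affine functions,
    with [sqrt t] as the coefficient of one more, constant, basis function; a level
    set is the union of two such sets. *)
Lemma clipped_loss_patterns (R : realType) (Q : nat) (I : finType) (K : {set I})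
    (v : I * bool -> R) (p : 'I_Q -> I * bool -> R) (m : I * bool -> bool) (L : R) :
  exists C : {set {set I * bool}},
    (#|C| <= (2 * #|K|).+1 ^ (2 * Q.+1))%N /\
    forall (a : 'I_Q -> R) t, 0 <= t < L ->
      finset (fun j => (j.1 \in K) &&
        (t < Num.min ((v j - \sum_k a k * p k j) ^+ 2) L * (m j)%:R)) \in C.
Proof.
pose W := finset (fun j : I * bool => j.1 \in K).
pose W' := finset (fun j : I * bool => (j \in W) && m j).
pose p' (k : 'I_Q.+1) (j : I * bool) : R := if unlift ord0 k is Some k' then p k' j else 1.
pose CC (g : I * bool -> R) : {set {set I * bool}} :=
  finset (fun c => `[< exists a, c = positivity_set g p' W' a >]).
have cardW : #|W| = (2 * #|K|)%N.
  rewrite mulnC -card_bool -cardsT -[RHS]cardsX; apply: eq_card => -[k b].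
  by rewrite !inE andbT.
have cardCC g : (#|CC g| <= (2 * #|K|).+1 ^ Q.+1)%N.
  apply: (@leq_trans (#|W'|.+1 ^ Q.+1)%N).
    by apply: (@card_positivity_sets _ _ _ g p') => c; rewrite inE => /asboolP.
  rewrite leq_exp2r// ltnS -cardW; apply: subset_leq_card.
  by apply/fintype.subsetP => j; rewrite !inE => /andP[].
exists (finset.imset2 (fun c1 c2 => finset.setU c1 c2) (mem (CC v)) (fun=> mem (CC (fun j => - v j)))).
split.
  rewrite curry_imset2X; apply: leq_trans (leq_imset_card _ _) _.
  by rewrite cardsX (mul2n Q.+1) -addnn expnD leq_mul.
move=> a t /andP[t0 tL].
pose a1 (k : 'I_Q.+1) : R := if unlift ord0 k is Some k' then - a k' else - Num.sqrt t.
pose a2 (k : 'I_Q.+1) : R := if unlift ord0 k is Some k' then a k' else - Num.sqrt t.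
have c1C : positivity_set v p' W' a1 \in CC v by rewrite inE; apply/asboolP; exists a1.
have c2C : positivity_set (fun j => - v j) p' W' a2 \in CC (fun j => - v j).
  by rewrite inE; apply/asboolP; exists a2.
apply/imset2P; exists (positivity_set v p' W' a1) (positivity_set (fun j => - v j) p' W' a2) => //.
apply/setP => j; rewrite !inE; case: (j.1 \in K) => //=.
case: (m j) => /=; last by rewrite mulr0 ltNge t0.
rewrite mulr1 lt_min tL andbT !big_ord_recl /a1 /a2 /p' !unlift_none.
under [in X in _ || X]eq_bigr do rewrite !liftK.
under [in X in X || _]eq_bigr do rewrite !liftK mulNr.
rewrite sumrN !mulr1; set f := \sum_k _.
have -> : (t < (v j - f) ^+ 2) = (Num.sqrt t < `|v j - f|).
  rewrite -{1}(sqr_sqrtr t0) -(real_normK (num_real (v j - f))).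
  by rewrite ltr_pXn2r// ?nnegrE ?sqrtr_ge0.
rewrite ltr_normr; congr orb; apply/idP/idP; lra.
Qed.

(** * Clouds of independent samples *)

Lemma ge0_integral_image (d1 d2 : measure_display) (X : measurableType d1)
    (Y : measurableType d2) (R : realType) (phi : X -> Y) (m : {measure set X -> \bar R})
    (m' : {measure set Y -> \bar R}) (f : Y -> \bar R) :
  measurable_fun setT phi -> (forall A, measurable A -> m (phi @^-1` A) = m' A) ->
  measurable_fun setT f -> (forall y, 0 <= f y)%E ->
  (\int[m]_x f (phi x) = \int[m']_y f y)%E.
Proof.
move=> mphi mm' mf f0.
have := @ge0_integral_pushforward _ _ _ _ _ _ mphi m setT f measurableT mf (fun y _ => f0 y).
rewrite preimage_setT => <-; apply: eq_measure_integral => A mA _.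
exact: mm'.
Qed.

Lemma ge0_integral_mrestr (d1 : measure_display) (X : measurableType d1) (R : realType)
    (m : {measure set X -> \bar R}) (E : set X) (mE : measurable E) (f : X -> \bar R) :
  measurable_fun setT f -> (forall y, 0 <= f y)%E ->
  (\int[mrestr m mE]_x f x = \int[m]_(x in E) f x)%E.
Proof.
move=> mf f0.
rewrite -(setUv E) ge0_integral_setU//=; first last.
- by apply/disj_set2P; exact: setICr.
- by rewrite setUv.
- exact: measurableC.
rewrite [X in (_ + X)%E](_ : _ = 0)%E ?adde0.
  apply: eq_measure_integral => A mA AE.
  by transitivity (m (A `&` E)); [|rewrite setIidl].
rewrite -(integral_measure_zero (~` E) f); apply: eq_measure_integral => A mA AE.
transitivity (m (A `&` E)); first by [].
by rewrite (_ : A `&` E = set0) ?measure0//; apply/disjoints_subset.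
Qed.

Section cloud_law.
Context {d : measure_display} {T : measurableType d} {R : realType} {M : nat}.
Local Open Scope ereal_scope.

Definition box (A : 'I_M -> set T) : set (M.-tuple T) :=
  [set z | forall i, A i (tnth z i)].

Definition iid_cloud (nu : probability T R) (mu : probability (M.-tuple T) R) : Prop :=
  forall A, (forall i, measurable (A i)) -> mu (box A) = \prod_(i < M) nu (A i).

Lemma measurable_box A : (forall i, measurable (A i)) -> measurable (box A).
Proof.
move=> mA; rewrite (_ : box A = \bigcap_(i in [set: 'I_M]) ((fun z => tnth z i) @^-1` A i)).
  apply: fin_bigcap_measurable => // i _.
  by rewrite -[X in measurable X]setTI; exact: measurable_tnth.
by apply/seteqP; split => [z zA i _|z zA i]; [exact: zA|exact: (zA i)].
Qed.

Definition box_pairs : set (set (M.-tuple T * M.-tuple T)) :=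
  [set X | exists A B, [/\ forall i, measurable (A i), forall i, measurable (B i)
     & X = box A `*` box B]].

Lemma box_pairs_setI : setI_closed box_pairs.
Proof.
move=> _ _ [A [B [mA mB ->]]] [A' [B' [mA' mB' ->]]].
exists (fun i => A i `&` A' i), (fun i => B i `&` B' i); split.
- by move=> i; exact: measurableI.
- by move=> i; exact: measurableI.
apply/seteqP; split => -[z z'] /=.
  by move=> [[h1 h2] [h3 h4]]; split => i; split; auto.
by move=> [h1 h2]; do 2 split; move=> i; [case: (h1 i)|case: (h2 i)|case: (h1 i)|case: (h2 i)].
Qed.

Lemma measurable_box_pairs : @measurable _ (M.-tuple T * M.-tuple T)%type = <<s box_pairs >>.
Proof.
apply/seteqP; split; last first.
  apply: smallest_sub; first exact: sigma_algebra_measurable.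
  by move=> _ [A [B [mA mB ->]]]; apply: measurableX; exact: measurable_box.
move=> X mX.
pose S := g_sigma_algebraType box_pairs.
suff mid : measurable_fun [set: S] (fun z : S => (z.1, z.2) : (M.-tuple T * M.-tuple T)%type).
  have := mid measurableT X mX; rewrite setTI.
  by rewrite (_ : _ @^-1` X = X)//; apply/seteqP; split => -[].
apply/measurable_fun_pair; apply/measurable_fun_tnthP => i _ Y mY; rewrite setTI.
- apply: sub_sigma_algebra; exists (fun j => if j == i then Y else setT), (fun=> setT).
  split => // [j|]; first by case: ifP.
  apply/seteqP; split => [[z z'] /= zY|[z z'] /= [zY _]].
    by split => // j /=; case: eqP => // ->.
  by have := zY i; rewrite /= eqxx.
- apply: sub_sigma_algebra; exists (fun=> setT), (fun j => if j == i then Y else setT).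
  split => // [j|]; first by case: ifP.
  apply/seteqP; split => [[z z'] /= zY|[z z'] /= [_ zY]].
    by split => // j /=; case: eqP => // ->.
  by have := zY i; rewrite /= eqxx.
Qed.

Definition swapc (s : 'I_M -> bool) (u : M.-tuple T * M.-tuple T) :
    (M.-tuple T * M.-tuple T)%type :=
  ([tuple if s i then tnth u.2 i else tnth u.1 i | i < M],
   [tuple if s i then tnth u.1 i else tnth u.2 i | i < M]).

Lemma swapcK s u : swapc s (swapc s u) = u :> (M.-tuple T * M.-tuple T)%type.
Proof.
case: u => z z'; congr pair; apply: eq_from_tnth => i; rewrite !tnth_mktuple /=;
  by case: (s i); rewrite ?tnth_mktuple; case: (s i).
Qed.

Lemma measurable_swapc s : measurable_fun setT (swapc s).
Proof.
have m1 i : measurable_fun setT (fun u : M.-tuple T * M.-tuple T => tnth u.1 i).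
  by apply: (measurableT_comp (measurable_tnth i)); exact: measurable_fst.
have m2 i : measurable_fun setT (fun u : M.-tuple T * M.-tuple T => tnth u.2 i).
  by apply: (measurableT_comp (measurable_tnth i)); exact: measurable_snd.
apply/measurable_fun_pair; apply/measurable_fun_tnthP => i.
- rewrite (_ : _ \o _ = if s i then (fun u => tnth u.2 i) else (fun u => tnth u.1 i)).
    by case: (s i).
  by apply/funext => u /=; rewrite tnth_mktuple; case: (s i).
- rewrite (_ : _ \o _ = if s i then (fun u => tnth u.1 i) else (fun u => tnth u.2 i)).
    by case: (s i).
  by apply/funext => u /=; rewrite tnth_mktuple; case: (s i).
Qed.

Variables (nu : probability T R) (mu : probability (M.-tuple T) R).
Hypothesis iid : iid_cloud nu mu.

(** A swap permutes the factors of the probability of a product of boxes, and the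
    products of boxes form a pi-system that generates the sigma-algebra. *)
Lemma swap_law s (X : set (M.-tuple T * M.-tuple T)) : measurable X ->
  pushforward (mu \x mu) (swapc s) X = (mu \x mu) X.
Proof.
apply: (measure_unique box_pairs (fun=> setT)).
- exact: measurable_box_pairs.
- exact: box_pairs_setI.
- move=> _; exists (fun=> setT), (fun=> setT); split => //.
  by apply/seteqP; split => // -[z z'] _; split => i.
- by rewrite bigcup_const.
- exact: measurable_swapc.
- move=> mf _ [A [B [mA mB ->]]]; rewrite /pushforward.
  pose A' i := if s i then B i else A i; pose B' i := if s i then A i else B i.
  have mA' i : measurable (A' i) by rewrite /A'; case: ifP.
  have mB' i : measurable (B' i) by rewrite /B'; case: ifP.
  have E : swapc s @^-1` (box A `*` box B) = box A' `*` box B'.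
    apply/seteqP; split => -[z z'] /= [h1 h2]; split => i; have := h1 i; have := h2 i;
    by rewrite /A' /B' !tnth_mktuple /=; case: (s i).
  transitivity ((mu \x mu) (box A' `*` box B')); first by rewrite -E.
  have prodE C D : (forall i, measurable (C i)) -> (forall i, measurable (D i)) ->
      (mu \x mu) (box C `*` box D) = (\prod_(i < M) nu (C i)) * (\prod_(i < M) nu (D i)).
    move=> mC mD; transitivity (mu (box C) * mu (box D)); last by rewrite !iid.
    by apply: product_measure1E; exact: measurable_box.
  rewrite prodE//; transitivity ((\prod_(i < M) nu (A i)) * (\prod_(i < M) nu (B i))).
    2: by symmetry; exact: prodE.
  rewrite -!big_split/=; apply: eq_bigr => i _.
  by rewrite /A' /B'; case: (s i) => //; rewrite muleC.
- move=> mf _; apply: (@le_lt_trans _ _ 1); last exact: ltry.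
  change ((mu \x mu) setT <= 1).
  exact: probability_le1.
Qed.

Lemma integral_swapc (s : 'I_M -> bool) (F : (M.-tuple T * M.-tuple T)%type -> \bar R) :
  measurable_fun [set: M.-tuple T * M.-tuple T] F -> (forall u, 0 <= F u) ->
  \int[mu \x mu]_u F (swapc s u) = \int[mu \x mu]_u F u.
Proof.
move=> mF F0.
by apply: ge0_integral_image => //; [exact: measurable_swapc|exact: swap_law].
Qed.

Lemma tnth_law i (A : set T) : measurable A -> mu [set z | A (tnth z i)] = nu A.
Proof.
move=> mA.
have -> : [set z : M.-tuple T | A (tnth z i)] = box (fun j => if j == i then A else setT).
  apply/seteqP; split => [z /= zA j|z /(_ i) /=]; last by rewrite eqxx.
  by case: eqP => // ->.
rewrite iid; last by move=> j; case: ifP.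
rewrite (bigD1 i)//= eqxx big1 ?mule1// => j /negbTE ->.
exact: probability_setT.
Qed.

Lemma integral_tnth i (f : T -> \bar R) : measurable_fun setT f -> (forall x, 0 <= f x) ->
  \int[mu]_z f (tnth z i) = \int[nu]_x f x.
Proof.
move=> mf f0.
by apply: (ge0_integral_image (phi := fun z => tnth z i)) => //; [exact: measurable_tnth|exact: tnth_law].
Qed.

(** Coordinate [j] carries [f]; each of the other coordinates of [K] contributes a
    factor [nu D]. *)
Lemma integral_tnth_in (K : {set 'I_M}) j (D : set T) (f : T -> \bar R) : j \in K ->
  measurable D -> measurable_fun setT f -> (forall x, 0 <= f x) ->
  \int[mu]_z (([forall k in K, tnth z k \in D])%:R%:E * f (tnth z j)) =
  (fine (nu D) ^+ #|K|.-1)%:E * \int[nu]_(x in D) f x.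
Proof.
move=> jK mD mf f0.
pose E : set (M.-tuple T) := box (fun i => if i \in K then D else setT).
have mDK i : measurable (if i \in K then D else setT) by case: ifP.
have mE : measurable E by exact: measurable_box.
have EE z : [forall k in K, tnth z k \in D] = (z \in E).
  apply/forall_inP/idP => [h|].
    by rewrite inE => i /=; case: ifPn => // /h; rewrite inE.
  by rewrite inE => h k kK; have := h k; rewrite kK inE.
have -> : \int[mu]_z (([forall k in K, tnth z k \in D])%:R%:E * f (tnth z j)) =
    \int[mu]_(z in E) f (tnth z j).
  rewrite [RHS]integral_mkcond; apply: eq_integral => z _; rewrite EE patchE.
  by case: ifPn => _; rewrite ?mul1e ?mul0e.
transitivity (\int[mrestr mu mE]_z f (tnth z j)).
  rewrite ge0_integral_mrestr //; apply: (measurableT_comp mf); exact: measurable_tnth.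
have c0 : (0 <= fine (nu D) ^+ #|K|.-1)%R by rewrite exprn_ge0// fine_ge0.
transitivity (\int[mscale (NngNum c0) (mrestr nu mD)]_x f x); last first.
  by rewrite ge0_integral_mscale//= ge0_integral_mrestr.
apply: (ge0_integral_image (phi := fun z => tnth z j)) => // [|A mA].
  exact: measurable_tnth.
transitivity (mu ((fun z => tnth z j) @^-1` A `&` E)); first by [].
transitivity ((fine (nu D) ^+ #|K|.-1)%:E * nu (A `&` D)); last by [].
have -> : (fun z => tnth z j) @^-1` A `&` E =
    box (fun i => (if i \in K then D else setT) `&` (if i == j then A else setT)).
  apply/seteqP; split => z /=.
    by move=> [zA zE] i /=; split; [exact: zE|case: eqP => // ->].
  move=> h; split; first by have := (h j).2; rewrite /= eqxx.
  by move=> i; exact: (h i).1.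
have mDA i : measurable ((if i \in K then D else setT) `&` (if i == j then A else setT)).
  by have := mDK i; case: ifP => _ ?; case: ifP => _; rewrite ?setIT ?setTI//; exact: measurableI.
rewrite iid//.
rewrite (bigD1 j)//= jK eqxx setIC muleC; congr (_ * _).
rewrite (eq_bigr (fun i => if i \in K then nu D else 1)); last first.
  move=> i /negbTE ->; rewrite setIT; case: ifP => // _; exact: probability_setT.
rewrite -big_mkcondr/= (eq_bigl (mem [predD1 K & j])); last first.
  by move=> i; rewrite !inE.
rewrite (eq_bigr (fun=> (fine (nu D))%:E)); last first.
  by move=> i _; rewrite fineK// fin_num_measure.
by rewrite prodEFin prodr_const (cardD1 j K) jK.
Qed.

End cloud_law.

(** * Symmetrization *)

Lemma measurable_sum_cond (d : measure_display) (T : measurableType d) (R : realType)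
    (D : set T) (I : Type) (s : seq I) (P : pred I) (h : I -> T -> R) :
  (forall i, measurable_fun D (h i)) ->
  measurable_fun D (fun x => \sum_(i <- s | P i) h i x).
Proof.
move=> mh; rewrite (_ : (fun x => _) = (fun x => \sum_(i <- [seq j <- s | P j]) h i x)).
  exact: measurable_sum.
by apply/funext => x; rewrite big_filter.
Qed.

Section symmetrization.
Context {d : measure_display} {T : measurableType d} {R : realType} {M : nat}.
Local Open Scope ereal_scope.
Variables (nu : probability T R) (mu : probability (M.-tuple T) R).
Hypothesis iid : iid_cloud nu mu.
Variables (K : {set 'I_M}) (f : nat -> T -> R) (L c : R).
Hypotheses (mf : forall r, measurable_fun setT (f r)) (L0 : (0 <= L)%R) (c_ge0 : (0 <= c)%R)
  (fL : forall r x, (0 <= f r x <= L)%R).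

(** Sample and ghost points as one family, indexed as in [swap_gain]. *)
Definition coord (u : M.-tuple T * M.-tuple T) (j : 'I_M * bool) : T :=
  if j.2 then tnth u.2 j.1 else tnth u.1 j.1.

Hypothesis patterns : forall u, exists C : {set {set 'I_M * bool}},
  (3 * ln (1 + #|C|%:R) <= c)%R /\
  forall r t, (0 <= t < L)%R ->
    finset (fun j : 'I_M * bool => (j.1 \in K) && (t < f r (coord u j))%R) \in C.

Definition excess (u : M.-tuple T * M.-tuple T) (r : nat) : \bar R :=
  (Num.max 0 (\sum_(k in K) f r (tnth u.2 k) - 2 * \sum_(k in K) f r (tnth u.1 k)))%:E.

Definition sup_excess (u : M.-tuple T * M.-tuple T) : \bar R := esups (excess u) 0%N.

Lemma excess_le_sup u r : excess u r <= sup_excess u.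
Proof. by apply: ereal_sup_ubound; exists r. Qed.

Lemma sup_excess_le u b : (forall r, excess u r <= b) -> sup_excess u <= b.
Proof. by move=> h; apply: ge_ereal_sup => _ [r _ <-]. Qed.

Lemma sup_excess_ge0 u : 0 <= sup_excess u.
Proof. by apply: le_trans (excess_le_sup u 0); rewrite lee_fin le_max lexx. Qed.

Lemma measurable_tnth1 i : measurable_fun [set: M.-tuple T * M.-tuple T] (fun u => tnth u.1 i).
Proof. by apply: (measurableT_comp (measurable_tnth i)); exact: measurable_fst. Qed.

Lemma measurable_tnth2 i : measurable_fun [set: M.-tuple T * M.-tuple T] (fun u => tnth u.2 i).
Proof. by apply: (measurableT_comp (measurable_tnth i)); exact: measurable_snd. Qed.

Lemma measurable_sup_excess : measurable_fun setT sup_excess.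
Proof.
apply: measurable_fun_esups => r; apply/measurable_EFinP.
apply: measurable_maxr; first exact: measurable_cst.
apply: measurable_funB.
  apply: measurable_sum_cond => k; apply: (measurableT_comp (mf r)); exact: measurable_tnth2.
apply: measurable_funM; first exact: measurable_cst.
apply: measurable_sum_cond => k; apply: (measurableT_comp (mf r)); exact: measurable_tnth1.
Qed.

Lemma sum_sup_excess_swapc u :
  \sum_(s : {ffun 'I_M -> bool}) sup_excess (swapc (fun i => s i && (i \in K)) u) <=
  (2 ^+ M * (L * c))%:E.
Proof.
have [C [Cc CP]] := patterns u.
apply: (@le_trans _ _ (\sum_(s : {ffun 'I_M -> bool}) (L * max_swap_gain R K C s)%:E)).
  apply: lee_sum => s _; apply: sup_excess_le => r; rewrite lee_fin ge_max.
  rewrite mulr_ge0 ?max_swap_gain_ge0//=.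
  apply: le_trans (swap_gain_bound (K := K) (C := C) (a := fun j => f r (coord u j)) s _ L0 (CP r)) => //.
  rewrite sumrB -mulr_sumr lerB// ?ler_wpM2l//; rewrite le_eqVlt; apply/orP; left; apply/eqP;
    by apply: eq_bigr => k kK; rewrite tnth_mktuple kK andbT /coord /=; case: (s k).
rewrite sumEFin lee_fin -mulr_sumr mulrCA ler_wpM2l//.
apply: le_trans (sum_max_swap_gain _ _ _) _.
by rewrite card_ord ler_wpM2l// exprn_ge0.
Qed.

(** Swapping coordinates of [K] preserves the product law and the weight, so the
    integral is the average over all these swaps. For a fixed pair of clouds that
    average is a finite sum, controlled by the number of patterns on the sample and
    ghost points. *)
Lemma symmetrization (w : (M.-tuple T * M.-tuple T)%type -> \bar R) :
  measurable_fun [set: M.-tuple T * M.-tuple T] w -> (forall u, 0 <= w u) ->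
  (forall (s : 'I_M -> bool) u, (forall i, s i -> i \in K) -> w (swapc s u) = w u) ->
  \int[mu \x mu]_u (w u * sup_excess u) <= (L * c)%:E * \int[mu \x mu]_u w u.
Proof.
move=> mw w0 ws.
have mws : measurable_fun [set: M.-tuple T * M.-tuple T] (fun u => w u * sup_excess u).
  by apply: emeasurable_funM => //; exact: measurable_sup_excess.
have ms (s : 'I_M -> bool) : measurable_fun [set: M.-tuple T * M.-tuple T] (fun u => sup_excess (swapc s u)).
  by apply: (measurableT_comp measurable_sup_excess); exact: measurable_swapc.
have c0 : (0 <= L * c)%R.
  exact: mulr_ge0.
rewrite -(@lee_pmul2l _ (2 ^+ M)%:E)// ?lte_fin ?exprn_gt0//.
have -> : (2 ^+ M)%:E * \int[mu \x mu]_u (w u * sup_excess u) =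
    \sum_(s : {ffun 'I_M -> bool}) \int[mu \x mu]_u (w u * sup_excess u).
  rewrite [RHS](eq_bigr (fun=> 1%:E * \int[mu \x mu]_u (w u * sup_excess u))); last first.
    by move=> s _; rewrite mul1e.
  rewrite -ge0_sume_distrl// sumEFin sumr_const card_ffun card_bool card_ord.
  by rewrite natrX.
rewrite (eq_bigr (fun s : {ffun 'I_M -> bool} =>
    \int[mu \x mu]_u (w u * sup_excess (swapc (fun i => s i && (i \in K)) u)))); last first.
  move=> s _; rewrite -(integral_swapc iid (fun i => s i && (i \in K)) (F := fun u => w u * sup_excess u))//.
    by apply: eq_integral => u _; rewrite ws// => i /andP[].
  by move=> u; rewrite mule_ge0// sup_excess_ge0.
rewrite -ge0_integral_sum//; last 2 first.
- by move=> s; apply: emeasurable_funM.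
- by move=> s u _; rewrite mule_ge0// sup_excess_ge0.
rewrite muleA -EFinM -ge0_integralZl//; last by rewrite lee_fin mulr_ge0// exprn_ge0.
apply: ge0_le_integral => //.
- by move=> u _; apply: sume_ge0 => s _; rewrite mule_ge0// sup_excess_ge0.
- by apply: emeasurable_sum => s; apply: emeasurable_funM.
- by apply: emeasurable_funM => //; exact: measurable_cst.
move=> u _; rewrite -ge0_sume_distrr; last by move=> s _; exact: sup_excess_ge0.
rewrite muleC lee_wpmul2r//.
exact: sum_sup_excess_swapc.
Qed.

End symmetrization.

(** * Regions determined by the cloud *)

Lemma measurable_forall_in (d : measure_display) (T : measurableType d) (I : finType)
    (K : {pred I}) (h : I -> T -> bool) :
  (forall i, measurable_fun setT (h i)) ->
  measurable_fun setT (fun x => [forall i in K, h i x]).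
Proof.
move=> mh; rewrite (_ : (fun x => _) = (fun x => \big[andb/true]_(i in K) h i x)).
  rewrite (_ : (fun x => _) = (fun x => \big[andb/true]_(i <- [seq i <- index_enum I | i \in K]) h i x)).
    elim: [seq _ <- _ | _] => [|i s IH]; first by under eq_fun do rewrite big_nil; exact: measurable_cst.
    by under eq_fun do rewrite big_cons; exact: measurable_and.
  by apply/funext => x; rewrite big_filter.
by apply/funext => x; rewrite big_andE.
Qed.

Lemma measurable_natr (d : measure_display) (T : measurableType d) (R : realType)
    (h : T -> bool) : measurable_fun setT h ->
  measurable_fun setT (fun x => (h x)%:R : R).
Proof.
move=> mh; rewrite (_ : (fun x => _) = (fun x => if h x then 1 else 0)).
  apply: measurable_fun_ifT => //; exact: measurable_cst.
by apply/funext => x; case: (h x).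
Qed.

Lemma measurable_funV (d : measure_display) (T : measurableType d) (R : realType)
    (D : set T) (h : T -> R) : measurable_fun D h -> measurable_fun D (fun x => (h x)^-1).
Proof.
move=> mh.
rewrite (_ : (fun x => _) = (fun x => h x * ((h x ^+ 2) `^ (-1)))); last first.
  apply/funext => x; rewrite powR_inv1 ?sqr_ge0// expr2.
  have [->|h0] := eqVneq (h x) 0; first by rewrite invr0 mul0r.
  by rewrite invfM mulrA divff// mul1r.
apply: measurable_funM => //.
exact: (measurableT_comp (measurable_powR (-1)) (measurable_funX 2 mh)).
Qed.

Lemma ge0_integral_sum_cond (d : measure_display) (T : measurableType d) (R : realType)
    (m : {measure set T -> \bar R}) (I : Type) (s : seq I) (P : pred I) (h : I -> T -> \bar R) :
  (forall i, measurable_fun setT (h i)) -> (forall i x, 0 <= h i x)%E ->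
  (\int[m]_x (\sum_(i <- s | P i) h i x) = \sum_(i <- s | P i) \int[m]_x h i x)%E.
Proof.
move=> mh h0; rewrite -big_filter -ge0_integral_sum//.
by apply: eq_integral => x _; rewrite big_filter.
Qed.

(** A region [D z] that is read off the cloud [z] is not independent of the samples
    that fall into it. The hypotheses [D_self] and [stable] replace independence:
    while [G z] holds, the coordinates in [K] lie in [D z], and moving them inside
    [D z] changes neither [D z] nor the validity of [G]. *)
Section random_region.
Context {d : measure_display} {T : measurableType d} {R : realType} {M : nat}.
Local Open Scope ereal_scope.
Variables (nu : probability T R) (mu : probability (M.-tuple T) R).
Hypothesis iid : iid_cloud nu mu.
Variables (K : {set 'I_M}) (G : M.-tuple T -> bool) (D : M.-tuple T -> T -> bool).
Hypotheses (K0 : (0 < #|K|)%N) (mG : measurable_fun setT G)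
  (mD : measurable_fun setT (fun u : M.-tuple T * T => D u.1 u.2)).
Hypothesis D_self : forall z k, G z -> k \in K -> D z (tnth z k).
Hypothesis stable : forall z z', G z -> (forall i, i \notin K -> tnth z' i = tnth z i) ->
  (forall k, k \in K -> D z (tnth z' k)) -> G z' /\ D z' =1 D z.

Definition region_mass (z : M.-tuple T) : R := fine (nu [set x | D z x]).

Lemma measurable_region z : measurable [set x | D z x].
Proof.
have := measurable_fun_pair2 z mD; move=> /(_ measurableT [set true]).
by rewrite setTI => h; apply: h.
Qed.

Lemma region_massE z : nu [set x | D z x] = (region_mass z)%:E.
Proof. by rewrite fineK// fin_num_measure//; exact: measurable_region. Qed.

Lemma region_mass_ge0 z : (0 <= region_mass z)%R.
Proof. exact: fine_ge0. Qed.

Lemma measurable_region_mass : measurable_fun setT region_mass.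
Proof.
apply: measurableT_comp => //.
pose E := [set u : M.-tuple T * T | D u.1 u.2].
have mE : measurable E by have := mD; move=> /(_ measurableT [set true]); rewrite setTI; apply.
rewrite (_ : (fun z => _) = (fun z => (nu \o xsection E) z)).
  exact: measurable_fun_xsection.
apply/funext => z /=; congr (nu _); apply/seteqP; split => x; rewrite /xsection /= ?inE//.
Qed.

(** On [G z], [region_mass z] times the density that turns [#|K|] ghosts into
    independent draws from the normalized restriction of [nu] to [D z]. The extra
    factor [region_mass z] weighs the deviation by the mass of the region. *)
Definition region_weight (u : M.-tuple T * M.-tuple T) : R :=
  (G u.1 && [forall k in K, D u.1 (tnth u.2 k)])%:R * (region_mass u.1)^-1 ^+ #|K|.-1.

Lemma region_weight_ge0 u : (0 <= region_weight u)%R.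
Proof. by rewrite mulr_ge0// exprn_ge0// invr_ge0 region_mass_ge0. Qed.

Lemma measurable_region_weight : measurable_fun setT (EFin \o region_weight).
Proof.
apply/measurable_EFinP; apply: measurable_funM.
  apply: measurable_natr; apply: measurable_and.
    by apply: (measurableT_comp mG); exact: measurable_fst.
  apply: measurable_forall_in => k.
  apply: (measurableT_comp mD (g := fun u : M.-tuple T * M.-tuple T => (u.1, tnth u.2 k))).
  by apply/measurable_fun_pair => //=; exact: measurable_tnth2.
apply: measurable_funX; apply: measurable_funV.
by apply: (measurableT_comp measurable_region_mass); exact: measurable_fst.
Qed.

(** Both points of a swapped pair lie in the region, which therefore does not notice
    the swap. *)
Lemma region_weight_swap (s : 'I_M -> bool) u :
  (forall i, s i -> i \in K) -> region_weight (swapc s u) = region_weight u.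
Proof.
move=> sK.
have half v : G v.1 && [forall k in K, D v.1 (tnth v.2 k)] ->
    [/\ G (swapc s v).1, [forall k in K, D (swapc s v).1 (tnth (swapc s v).2 k)] &
      D (swapc s v).1 =1 D v.1].
  move=> /andP[Gv /forall_inP Dv].
  have [G' D'] : G (swapc s v).1 /\ D (swapc s v).1 =1 D v.1.
    apply: stable => // [i iK|k kK]; rewrite tnth_mktuple.
      by case: ifP => // /sK; rewrite (negbTE iK).
    by case: ifP => _; [exact: Dv|exact: D_self].
  split => //; apply/forall_inP => k kK; rewrite D' tnth_mktuple.
  by case: ifP => _; [exact: D_self|exact: Dv].
rewrite /region_weight.
have [/half[G' D' DE]|N] := boolP (G u.1 && _).
  rewrite G' D' mul1r /region_mass (_ : [set x | D (swapc s u).1 x] = [set x | D u.1 x])//.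
    by rewrite mul1r.
  by apply/seteqP; split => x /=; rewrite DE.
have [/half|_] := boolP (G (swapc s u).1 && _); last by rewrite !mul0r.
by rewrite swapcK => -[G' D' _]; rewrite G' D' in N.
Qed.

Lemma integral_all_in_region z :
  \int[mu]_z' ([forall k in K, D z (tnth z' k)])%:R%:E = (region_mass z ^+ #|K|)%:E.
Proof.
have [j jK] : exists j, j \in K by apply/existsP; rewrite -[[exists _, _]]/(~~ pred0b _) -lt0n.
have E := integral_tnth_in iid jK (measurable_region z) (f := cst 1)
  (measurable_cst _) (fun=> lee01).
transitivity ((region_mass z ^+ #|K|.-1)%:E * \int[nu]_(x in [set x | D z x]) 1); last first.
  transitivity ((region_mass z ^+ #|K|.-1)%:E * (region_mass z)%:E).
    congr (_ * _); rewrite -region_massE -[RHS]mul1e.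
    exact: (integral_cst nu (measurable_region z)).
  by rewrite -EFinM -exprSr prednK.
rewrite -[RHS]E; apply: eq_integral => z' _; rewrite mule1; congr ((nat_of_bool _)%:R%:E).
by apply: eq_forallb => k; congr (_ ==> _); apply/idP/idP; rewrite ?inE.
Qed.

Lemma integral_region_weight z : G z ->
  \int[mu]_z' (region_weight (z, z'))%:E =
    (region_mass z ^+ #|K| * (region_mass z)^-1 ^+ #|K|.-1)%:E.
Proof.
move=> Gz; rewrite EFinM -integral_all_in_region -ge0_integralZr//.
- by apply: eq_integral => z' _; rewrite /region_weight /= Gz EFinM.
- apply/measurable_EFinP; apply: measurable_natr; apply: measurable_forall_in => k.
  apply: (measurableT_comp mD (g := fun z' : M.-tuple T => (z, tnth z' k))).
  by apply/measurable_fun_pair => //=; exact: measurable_tnth.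
- by rewrite lee_fin exprn_ge0// invr_ge0 region_mass_ge0.
Qed.

Lemma expr_cancel (m : R) : (m ^+ #|K| * m^-1 ^+ #|K|.-1 = m)%R.
Proof.
have [->|m0] := eqVneq m 0%R; first by rewrite expr0n eqn0Ngt K0 mul0r.
by rewrite -{1}(prednK K0) exprS -mulrA -exprMn divff// expr1n mulr1.
Qed.

Lemma integral_region_weight_le :
  \int[mu \x mu]_u (region_weight u)%:E <= \int[mu]_z ((G z)%:R * region_mass z)%:E.
Proof.
rewrite fubini_tonelli1//; last 2 first.
- exact: measurable_region_weight.
- by move=> u; rewrite lee_fin region_weight_ge0.
rewrite le_eqVlt; apply/orP; left; apply/eqP; apply: eq_integral => z _.
rewrite /fubini_F; case: (boolP (G z)) => Gz.
  by rewrite /= integral_region_weight// expr_cancel mul1r.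
by rewrite mul0r integral0_eq// => z' _; rewrite /region_weight /= (negbTE Gz) mul0r.
Qed.

Section deviation.
Variables (f : nat -> T -> R) (L c : R).
Hypotheses (mf : forall r, measurable_fun setT (f r)) (L0 : (0 <= L)%R) (c_ge0 : (0 <= c)%R)
  (fL : forall r x, (0 <= f r x <= L)%R).
Hypothesis patterns : forall u, exists C : {set {set 'I_M * bool}},
  (3 * ln (1 + #|C|%:R) <= c)%R /\
  forall r t, (0 <= t < L)%R ->
    finset (fun j : 'I_M * bool => (j.1 \in K) && (t < f r (coord u j))%R) \in C.

Definition deviation (z : M.-tuple T) : \bar R :=
  \int[mu]_z' ((region_weight (z, z'))%:E * sup_excess K f (z, z')).

Lemma measurable_deviation_integrand : measurable_fun setT
  (fun u : M.-tuple T * M.-tuple T => (region_weight u)%:E * sup_excess K f u).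
Proof.
apply: emeasurable_funM; first exact: measurable_region_weight.
exact: measurable_sup_excess.
Qed.

Lemma deviation_integrand_ge0 u : 0 <= (region_weight u)%:E * sup_excess K f u.
Proof. by rewrite mule_ge0 ?lee_fin ?region_weight_ge0// sup_excess_ge0. Qed.

Lemma deviation_ge0 z : 0 <= deviation z.
Proof. by apply: integral_ge0 => z' _; exact: deviation_integrand_ge0. Qed.

Lemma measurable_deviation : measurable_fun setT deviation.
Proof.
apply: (measurable_fun_fubini_tonelli_F
  (fun u => (region_weight u)%:E * sup_excess K f u)) => //.
  exact: measurable_deviation_integrand.
exact: deviation_integrand_ge0.
Qed.

Lemma integral_deviation :
  \int[mu]_z deviation z <= (L * c)%:E * \int[mu]_z ((G z)%:R * region_mass z)%:E.
Proof.
rewrite -(fubini_tonelli1 (fun u => (region_weight u)%:E * sup_excess K f u)); last 2 first.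
- exact: measurable_deviation_integrand.
- exact: deviation_integrand_ge0.
apply: (le_trans (symmetrization iid mf L0 c_ge0 fL patterns _ _ _)).
- exact: measurable_region_weight.
- by move=> u; rewrite lee_fin region_weight_ge0.
- by move=> s u sK; rewrite region_weight_swap.
rewrite lee_wpmul2l ?lee_fin ?mulr_ge0//.
exact: integral_region_weight_le.
Qed.

(** Integrating out a ghost that is weighted into the region gives the integral of
    [g] over the region, so the ghost sum becomes [#|K|] times that integral. *)
Lemma le_deviation z (g : T -> R) : G z -> measurable_fun setT g -> (forall x, (0 <= g x)%R) ->
  (forall z', (\sum_(k in K) g (tnth z' k) - 2 * \sum_(k in K) g (tnth z k))%:E <=
    sup_excess K f (z, z')) ->
  #|K|%:R%:E * \int[nu]_(x in [set x | D z x]) (g x)%:E <=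
    deviation z + (2 * region_mass z * \sum_(k in K) g (tnth z k))%:E.
Proof.
move=> Gz mg g0 gP.
(* For mass zero the weight is a power of [0^-1 = 0], but the region integral vanishes. *)
have [m0|m0] := eqVneq (region_mass z) 0%R.
  rewrite (_ : integral _ _ _ = 0) ?mule0; last first.
    rewrite -(integral_measure_zero [set x | D z x] (fun x => (g x)%:E)).
    apply: eq_measure_integral => A mA AD; apply: subset_measure0 AD _ => //.
      exact: measurable_region.
    by have := region_massE z; rewrite m0.
  by rewrite m0 mulr0 mul0r adde0 deviation_ge0.
set m := region_mass z in m0 *.
set I := integral _ _ _.
set s := (\sum_(k in K) g (tnth z k))%R.
have s0 : (0 <= s)%R by apply: sumr_ge0.
have mz' k : measurable_fun setT (fun z' : M.-tuple T => g (tnth z' k)).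
  by apply: (measurableT_comp mg); exact: measurable_tnth.
have mw : measurable_fun setT (fun z' : M.-tuple T => (region_weight (z, z'))%:E).
  exact: (measurable_fun_pair2 z measurable_region_weight).
have mdev : measurable_fun setT (fun z' : M.-tuple T =>
    (region_weight (z, z'))%:E * sup_excess K f (z, z')).
  exact: (measurable_fun_pair2 z measurable_deviation_integrand).
have w0 z' : 0 <= (region_weight (z, z'))%:E by rewrite lee_fin region_weight_ge0.
have IE k : k \in K -> \int[mu]_z' ((region_weight (z, z'))%:E * (g (tnth z' k))%:E) = I.
  move=> kK.
  have mg' : measurable_fun setT (EFin \o g) by exact/measurable_EFinP.
  have E := integral_tnth_in iid kK (measurable_region z) mg' (fun x => g0 x).
  transitivity (((region_mass z)^-1 ^+ #|K|.-1)%:E * ((region_mass z ^+ #|K|.-1)%:E * I)); last first.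
    by rewrite muleA -EFinM -exprMn mulVf// expr1n mul1e.
  rewrite -[X in _ * X]E -ge0_integralZl//.
  - apply: eq_integral => z' _; rewrite /region_weight /= Gz /= -!EFinM mulrA; congr (_%:E); rewrite [X in _ = (X * _)%R]mulrC.
    congr ((nat_of_bool _)%:R * _ * _)%R; apply: eq_forallb => i; congr (_ ==> _).
    by apply/idP/idP; rewrite ?inE.
  - apply: emeasurable_funM; last by apply: (measurableT_comp mg'); exact: measurable_tnth.
    apply/measurable_EFinP; apply: measurable_natr.
    apply: measurable_forall_in => i.
    rewrite (_ : (fun _ => _) = (fun z' => D z (tnth z' i))); last first.
      by apply/funext => z'; apply/idP/idP; rewrite ?inE.
    apply: (measurableT_comp mD (g := fun z' : M.-tuple T => (z, tnth z' i))).
    by apply/measurable_fun_pair => //=; exact: measurable_tnth.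
  - by move=> z' _; rewrite mule_ge0// lee_fin.
  - by rewrite lee_fin exprn_ge0// invr_ge0 region_mass_ge0.
have -> : #|K|%:R%:E * I = \int[mu]_z' ((region_weight (z, z'))%:E * (\sum_(k in K) g (tnth z' k))%:E).
  rewrite (eq_integral (fun z' => \sum_(k in K) (region_weight (z, z'))%:E * (g (tnth z' k))%:E)); last first.
    by move=> z' _; rewrite -sumEFin ge0_sume_distrr// => k _; rewrite lee_fin.
  rewrite ge0_integral_sum_cond//.
  - rewrite (eq_bigr (fun=> I))//.
    rewrite (eq_bigr (fun=> 1%:E * I)); last by move=> k _; rewrite mul1e.
    by rewrite -ge0_sume_distrl// sumEFin sumr_const.
  - by move=> k; apply: emeasurable_funM => //; exact/measurable_EFinP.
  - by move=> k z'; rewrite mule_ge0// lee_fin.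
have -> : (2 * m * s)%:E = \int[mu]_z' ((region_weight (z, z'))%:E * (2 * s)%:E).
  rewrite ge0_integralZr// ?lee_fin ?mulr_ge0// integral_region_weight// expr_cancel -EFinM.
  by congr (_%:E); rewrite mulrCA mulrA.
have d0 z' := deviation_integrand_ge0 (z, z').
have q0 z' : 0 <= (region_weight (z, z'))%:E * (2 * s)%:E.
  by rewrite mule_ge0// lee_fin mulr_ge0.
have mq : measurable_fun setT (fun z' => (region_weight (z, z'))%:E * (2 * s)%:E).
  by apply: emeasurable_funM => //; exact: measurable_cst.
rewrite /deviation -ge0_integralD//.
apply: ge0_le_integral => //.
- by move=> z' _; rewrite mule_ge0// lee_fin sumr_ge0.
- apply: emeasurable_funM => //; apply/measurable_EFinP; exact: measurable_sum_cond.
- exact: emeasurable_funD.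
move=> z' _; rewrite -ge0_muleDr ?lee_fin ?mulr_ge0//; last exact: sup_excess_ge0.
rewrite lee_wpmul2l// -leeBlDr//.
exact: gP.
Qed.

End deviation.
End random_region.

(** * Order statistics and interior samples *)

Lemma sorted_nth_count (disp : Order.disp_t) (T : orderType disp) (P : pred T) (x0 : T) (l : seq T) (c : nat) :
  (forall x y, (x <= y)%O -> P y -> P x) -> sorted <=%O l -> (c < size l)%N ->
  P (nth x0 l c) = (c < count P l)%N.
Proof.
move=> Pdown; elim: l c => // x l IH c /= xl cl.
have tailN : ~~ P x -> count P l = 0%N.
  move=> Px; apply/eqP; rewrite eqn0Ngt -has_count; apply/hasPn => y yl.
  apply: contra Px; apply: Pdown.
  by move: xl; rewrite (path_sortedE le_trans) => /andP[/allP/(_ _ yl)].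
case: c cl => [|c] cl /=.
  by case: (boolP (P x)) => // /tailN ->.
rewrite IH//; last by move: xl => /path_sorted.
by case: (boolP (P x)) => [_|/tailN ->]; rewrite ?add1n ?ltn0.
Qed.

Section order_statistics.
Context {R : realType} {M : nat}.
Implicit Types (a : 'I_M -> R) (t : R).

Definition order_stat a (c : nat) : R := nth 0 (sort <=%R [seq a m | m <- enum 'I_M]) c.
Definition count_le a t : nat := #|[pred m | a m <= t]|.
Definition count_lt a t : nat := #|[pred m | a m < t]|.

Let countE a (P : pred R) : count P (sort <=%R [seq a m | m <- enum 'I_M]) = #|[pred m | P (a m)]|.
Proof.
rewrite (permP (permEl (perm_sort _ _))) count_map cardE size_filter.
by rewrite enumT.
Qed.

Let sizeE a : size (sort <=%R [seq a m | m <- enum 'I_M]) = M.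
Proof. by rewrite size_sort size_map size_enum_ord. Qed.

Lemma order_stat_le a c t : (c < M)%N -> (order_stat a c <= t) = (c < count_le a t)%N.
Proof.
move=> cM; rewrite /order_stat (@sorted_nth_count _ _ (fun x => x <= t)).
- by rewrite countE.
- by move=> x y xy; exact: le_trans.
- by apply: sort_sorted; exact: le_total.
- by rewrite sizeE.
Qed.

Lemma order_stat_lt a c t : (c < M)%N -> (order_stat a c < t) = (c < count_lt a t)%N.
Proof.
move=> cM; rewrite /order_stat (@sorted_nth_count _ _ (fun x => x < t)).
- by rewrite countE.
- by move=> x y xy; exact: le_lt_trans.
- by apply: sort_sorted; exact: le_total.
- by rewrite sizeE.
Qed.

Lemma order_statP a c : (c < M)%N ->
  (count_lt a (order_stat a c) <= c < count_le a (order_stat a c))%N.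
Proof. by move=> cM; rewrite leqNgt -order_stat_lt// ltxx -order_stat_le//=. Qed.

Lemma order_stat_eq a c t : (c < M)%N -> (count_lt a t <= c < count_le a t)%N ->
  order_stat a c = t.
Proof.
move=> cM; rewrite leqNgt -order_stat_lt// -order_stat_le// -leNgt andbC => h.
exact: le_anti.
Qed.

Lemma order_stat_mono a c c' : (c <= c')%N -> (c' < M)%N -> order_stat a c <= order_stat a c'.
Proof.
move=> cc' c'M; rewrite order_stat_le; last exact: leq_ltn_trans c'M.
by rewrite (leq_ltn_trans cc')//; have /andP[] := order_statP a c'M.
Qed.

Lemma card_eq_le1 a t : injective a -> (#|[pred m | a m == t]| <= 1)%N.
Proof.
move=> ia; apply/card_le1_eqP => m m'; rewrite !inE => /eqP am /eqP am'.
by apply: ia; rewrite am am'.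
Qed.

Variables lo hi : option nat.
Hypotheses (lo_lt : if lo is Some i then (i < M)%N else true)
  (hi_lt : if hi is Some j then (j < M)%N else true).

Definition above a t : bool := if lo is Some i then order_stat a i < t else true.
Definition strictly_below a t : bool := if hi is Some j then t < order_stat a j else true.
Definition below a t : bool := if hi is Some j then t <= order_stat a j else true.

Definition inside a t : bool := above a t && strictly_below a t.
Definition interior_sample a : {set 'I_M} := finset (fun m => inside a (a m)).

(** An order statistic depends only on the numbers of values below and not above it.
    Values that move strictly between the two boundary order statistics change
    neither number at either boundary. *)
Lemma interior_resampling a a' :
  (forall m, m \notin interior_sample a -> a' m = a m) ->
  (forall m, m \in interior_sample a -> inside a (a' m)) ->
  inside a' =1 inside a /\ interior_sample a' = interior_sample a.
Proof.
move=> out inn.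
have self m : m \in interior_sample a -> inside a (a m) by rewrite inE.
have lo_same i : lo = Some i -> forall m,
    (a' m <= order_stat a i) = (a m <= order_stat a i) /\
    (a' m < order_stat a i) = (a m < order_stat a i).
  move=> E m; case: (boolP (m \in interior_sample a)) => [mi|/out ->//].
  have := inn _ mi; have := self _ mi; rewrite /inside /above E => /andP[h1 _] /andP[h2 _].
  by rewrite !leNgt h1 h2 !ltNge (ltW h1) (ltW h2).
have hi_same j : hi = Some j -> forall m,
    (a' m <= order_stat a j) = (a m <= order_stat a j) /\
    (a' m < order_stat a j) = (a m < order_stat a j).
  move=> E m; case: (boolP (m \in interior_sample a)) => [mi|/out ->//].
  have := inn _ mi; have := self _ mi.
  by rewrite /inside /strictly_below E => /andP[_ h1] /andP[_ h2]; rewrite h1 h2 !ltW.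
have same i : (i < M)%N -> (forall m, (a' m <= order_stat a i) = (a m <= order_stat a i) /\
    (a' m < order_stat a i) = (a m < order_stat a i)) -> order_stat a' i = order_stat a i.
  move=> iM h.
  have le' : count_le a' (order_stat a i) = count_le a (order_stat a i).
    by apply: eq_card => m; rewrite !inE (h m).1.
  have lt' : count_lt a' (order_stat a i) = count_lt a (order_stat a i).
    by apply: eq_card => m; rewrite !inE (h m).2.
  by apply: order_stat_eq => //; rewrite le' lt'; exact: order_statP.
have losame i : lo = Some i -> order_stat a' i = order_stat a i.
  by move=> E; apply: same; [move: lo_lt; rewrite E|exact: lo_same].
have hisame j : hi = Some j -> order_stat a' j = order_stat a j.
  by move=> E; apply: same; [move: hi_lt; rewrite E|exact: hi_same].
have insE : inside a' =1 inside a.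
  move=> t; rewrite /inside /above /strictly_below.
  case E: lo losame => [i|] => [/(_ _ erefl) ->|_];
    by case E': hi hisame => [j|] => [/(_ _ erefl) ->|_].
split => //.
apply/setP => m; rewrite !inE insE.
case: (boolP (m \in interior_sample a)) => [mi|mi]; last by rewrite out.
by rewrite (inn _ mi) (self _ mi).
Qed.

Definition closed_sample a : {set 'I_M} := finset (fun m => above a (a m) && below a (a m)).

(** The bundle is closed at its upper boundary order statistic, which a single
    sample attains when the values are distinct. *)
Lemma card_interior_sample a : (lo || hi -> injective a) ->
  (#|interior_sample a| <= #|closed_sample a| <= #|interior_sample a|.+1)%N.
Proof.
move=> ia; apply/andP; split.
  apply: subset_leq_card; apply/fintype.subsetP => m; rewrite !inE => /andP[-> ].
  by rewrite /strictly_below /below; case: hi => // j /ltW.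
rewrite -addn1 -(cardID (mem (interior_sample a))) leq_add//.
  by apply: subset_leq_card; apply/fintype.subsetP => m; rewrite inE => /andP[].
case E: hi hi_lt ia => [j|] jM ia; last first.
  rewrite eq_card0// => m; rewrite !inE /inside /strictly_below /below E !andbT.
  by rewrite andNb.
rewrite orbT in ia.
apply: leq_trans (card_eq_le1 (order_stat a j) (ia isT)).
apply: subset_leq_card; apply/fintype.subsetP => m; rewrite !inE /inside /strictly_below /below E.
case: (above a (a m)) => //=; rewrite -leNgt => /andP[h1 h2].
by rewrite eq_le h1 h2.
Qed.

End order_statistics.

(** * Order statistics of a random cloud *)

Section sampled_order_statistics.
Context {d : measure_display} {T : measurableType d} {R : realType} {M : nat}.
Variables (s : T -> R).
Hypothesis ms : measurable_fun setT s.

Definition scores (z : M.-tuple T) (m : 'I_M) : R := s (tnth z m).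

Lemma measurable_scores m : measurable_fun setT (fun z => scores z m).
Proof. by apply: (measurableT_comp ms); exact: measurable_tnth. Qed.

Lemma measurable_count_le (t : M.-tuple T -> R) : measurable_fun setT t ->
  measurable_fun setT (fun z => (count_le (scores z) (t z))%:R : R).
Proof.
move=> mt; rewrite (_ : (fun z => _) = (fun z => \sum_(m < M) (scores z m <= t z)%R%:R)).
  by apply: measurable_sum => m; apply: measurable_natr; apply: measurable_fun_ler => //; exact: measurable_scores.
by apply/funext => z; rewrite /count_le -sum1_card natr_sum big_mkcond; apply: eq_bigr => m _; rewrite inE; case: ifP.
Qed.

Lemma measurable_order_stat c : (c < M)%N ->
  measurable_fun setT (fun z => order_stat (scores z) c).
Proof.
move=> cM _; apply: (measurability _ (RGenOInfty.measurableE R)) => // _ [_ [x ->] <-].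
rewrite setTI.
have : measurable_fun setT (fun z => (count_le (scores z) x)%:R <= (c%:R : R)).
  apply: measurable_fun_ler => //; exact: (measurable_count_le (measurable_cst x)).
move=> /(_ measurableT [set true]); rewrite setTI => /(_ I).
rewrite (_ : _ @^-1` [set true] = (fun z => order_stat (scores z) c) @^-1` [set` `]x, +oo[])//.
apply/seteqP; split => z /=; rewrite in_itv/= andbT ltNge order_stat_le// -leqNgt ler_nat//.
Qed.

Variables lo hi : option nat.
Hypotheses (lo_lt : if lo is Some i then (i < M)%N else true)
  (hi_lt : if hi is Some j then (j < M)%N else true).

Definition in_region (z : M.-tuple T) (x : T) : bool := inside lo hi (scores z) (s x).

Let measurable_os1 c : (c < M)%N ->
  measurable_fun setT (fun u : M.-tuple T * T => order_stat (scores u.1) c).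
Proof. by move=> cM; apply: (measurableT_comp (measurable_order_stat cM)); exact: measurable_fst. Qed.

Let measurable_s2 : measurable_fun setT (fun u : M.-tuple T * T => s u.2).
Proof. by apply: (measurableT_comp ms); exact: measurable_snd. Qed.

Lemma measurable_above : measurable_fun setT (fun u : M.-tuple T * T => above lo (scores u.1) (s u.2)).
Proof.
rewrite /above; case: lo lo_lt => [i iM|_]; last exact: measurable_cst.
by apply: measurable_fun_ltr => //; exact: measurable_os1.
Qed.

Lemma measurable_below : measurable_fun setT (fun u : M.-tuple T * T => below hi (scores u.1) (s u.2)).
Proof.
rewrite /below; case: hi hi_lt => [i iM|_]; last exact: measurable_cst.
by apply: measurable_fun_ler => //; exact: measurable_os1.
Qed.

Lemma measurable_in_region : measurable_fun setT (fun u : M.-tuple T * T => in_region u.1 u.2).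
Proof.
apply: measurable_and; first exact: measurable_above.
rewrite /strictly_below; case: hi hi_lt => [i iM|_]; last exact: measurable_cst.
by apply: measurable_fun_ltr => //; exact: measurable_os1.
Qed.

Definition interior_is (K : {set 'I_M}) (z : M.-tuple T) : bool :=
  interior_sample lo hi (scores z) == K.

Lemma measurable_interior_is K : measurable_fun setT (interior_is K).
Proof.
rewrite (_ : interior_is K = (fun z => [forall m in predT, in_region z (tnth z m) == (m \in K)])).
  apply: measurable_forall_in => m.
  have mi : measurable_fun setT (fun z : M.-tuple T => in_region z (tnth z m)).
    apply: (measurableT_comp measurable_in_region (g := fun z : M.-tuple T => (z, tnth z m))).
    by apply/measurable_fun_pair => //=; exact: measurable_tnth.
  case: (m \in K).
    by under eq_fun do rewrite eqb_id.
  by under eq_fun do rewrite eqbF_neg; exact: measurable_neg.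
apply/funext => z; rewrite /interior_is; apply/eqP/forall_inP => [<- m _|h].
  by rewrite !inE eqxx.
by apply/setP => m; have /eqP <- := h m isT; rewrite inE.
Qed.

Lemma interior_is_self K z k : interior_is K z -> k \in K -> in_region z (tnth z k).
Proof. by move=> /eqP <-; rewrite inE. Qed.

Lemma interior_is_stable K z z' : interior_is K z ->
  (forall i, i \notin K -> tnth z' i = tnth z i) ->
  (forall k, k \in K -> in_region z (tnth z' k)) ->
  interior_is K z' /\ in_region z' =1 in_region z.
Proof.
move=> /eqP KE out inn.
have [] := interior_resampling lo_lt hi_lt (a := scores z) (a' := scores z').
- by move=> m; rewrite KE => /out; rewrite /scores => ->.
- by move=> m; rewrite KE => /inn.
move=> ins' int'; split; first by rewrite /interior_is int' KE eqxx.
by move=> x; rewrite /in_region ins'.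
Qed.

Variables (nu : probability T R) (mu : probability (M.-tuple T) R).
Hypothesis iid : iid_cloud nu mu.

Let mclosure z : measurable [set x | above lo (scores z) (s x) && below hi (scores z) (s x)].
Proof.
have := measurable_and (measurable_fun_pair2 z measurable_above) (measurable_fun_pair2 z measurable_below).
by move=> /(_ measurableT [set true]); rewrite setTI => h; apply: h.
Qed.

Lemma region_closure_le z :
  (nu [set x | in_region z x] <= nu [set x | above lo (scores z) (s x) && below hi (scores z) (s x)])%E.
Proof.
apply: le_measure; rewrite ?inE//.
  by apply: measurable_region; exact: measurable_in_region.
move=> x /= /andP[ab]; rewrite /= ab /strictly_below /below.
by case: hi => // j /ltW.
Qed.

(** A bundle and its interior region differ by the level set of the upper boundary
    score, which an atomless law does not charge. *)
Lemma integral_region_closure z (g : T -> \bar R) :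
  (hi -> forall t, nu [set x | s x = t] = 0%E) ->
  measurable_fun setT g -> (forall x, 0 <= g x)%E ->
  (\int[nu]_(x in [set x | above lo (scores z) (s x) && below hi (scores z) (s x)]) g x =
   \int[nu]_(x in [set x | in_region z x]) g x)%E.
Proof.
move=> atomless mg g0.
have mreg : measurable [set x | in_region z x] by apply: measurable_region; exact: measurable_in_region.
pose E := [set x : T | if hi is Some j then s x = order_stat (scores z) j else False].
have mE : measurable E.
  rewrite /E; case: hi => [j|]; last exact: measurable0.
  by rewrite -[X in measurable X]setTI; exact: (ms measurableT (measurable_set1 _)).
have E0 : nu E = 0%E.
  by rewrite /E; case: hi atomless => [j|] h; [exact: h|rewrite measure0].
rewrite integral_mkcond [RHS]integral_mkcond; apply: ge0_ae_eq_integral => //.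
- exact/(measurable_restrictT _ (mclosure z)).1/measurable_funTS.
- exact/(measurable_restrictT _ mreg).1/measurable_funTS.
- by move=> x _; apply: erestrict_ge0.
- by move=> x _; apply: erestrict_ge0.
exists E; split => // x /= h; apply: contrapT => Ex; apply: h => _.
rewrite !patchE; congr (if _ then _ else _).
apply/idP/idP; rewrite !inE /= /in_region /inside /strictly_below /below.
  move=> /andP[-> ] /=; move: Ex; rewrite /E /=; case: hi => // j Ex.
  by rewrite le_eqVlt => /orP[/eqP|].
by move=> /andP[->] /=; case: hi => // j /ltW.
Qed.

(** Swapping one coordinate with its ghost replaces it by a draw that is independent
    of the other coordinate, whose score then is a fixed number that an atomless law
    does not charge. *)
Lemma ae_injective_scores : (forall t, nu [set x | s x = t] = 0%E) ->
  {ae mu, forall z, injective (scores z)}.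
Proof.
move=> atomless; pose N (k l : 'I_M) : set (M.-tuple T) := [set z | (k != l) && (scores z k == scores z l)].
have mN k l : measurable (N k l).
  have : measurable_fun setT (fun z => (k != l) && (scores z k == scores z l)).
    apply: measurable_and; first exact: measurable_cst.
    by apply: measurable_fun_eqr; exact: measurable_scores.
  by move=> /(_ measurableT [set true]); rewrite setTI => h; apply: h.
have N0 k l : mu (N k l) = 0%E.
  have [->|kl] := eqVneq k l.
    by rewrite (_ : N l l = set0) ?measure0//; apply/seteqP; split => z //=; rewrite /N /= eqxx.
  pose F (u : (M.-tuple T * M.-tuple T)%type) : \bar R := (scores u.1 k == scores u.1 l)%:R%:E.
  have mF : measurable_fun [set: M.-tuple T * M.-tuple T] F.
    apply/measurable_EFinP; apply: measurable_natr; apply: measurable_fun_eqr;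
    by apply: (measurableT_comp ms); exact: measurable_tnth1.
  have F0 u : (0 <= F u)%E by rewrite lee_fin.
  have := integral_swapc iid (fun i => i == l) mF F0.
  rewrite (fubini_tonelli1 F)// [X in _ = X -> _](_ : _ = mu (N k l)); last first.
    rewrite -[RHS]mul1e -integral_cst//=.
    rewrite [RHS](_ : _ = \int[mu]_z (\1_(N k l) z)%:E)%E; last first.
      rewrite integral_indic// setIT; by rewrite integral_cst// mul1e.
    apply: eq_integral => z _; rewrite /fubini_F /F /= integral_cst//=.
    rewrite probability_setT mule1 indicE; congr ((nat_of_bool _)%:R%:E).
    by apply/idP/idP; rewrite inE /N /= kl.
  move=> <-.
  have mFs : measurable_fun [set: M.-tuple T * M.-tuple T] (fun u => F (swapc (fun i => i == l) u)).
    by apply: (measurableT_comp mF); exact: measurable_swapc.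
  rewrite (fubini_tonelli1 (fun u => F (swapc (fun i => i == l) u)))//.
  apply: integral0_eq => z _; rewrite /fubini_F /F.
  under eq_integral do rewrite /scores !tnth_mktuple /= (negbTE kl) eqxx.
  rewrite (integral_tnth iid l (f := fun x => (s (tnth z k) == s x)%:R%:E)).
  - have mE : measurable [set x | s x = s (tnth z k)].
      by rewrite -[X in measurable X]setTI; exact: (ms measurableT (measurable_set1 _)).
    transitivity (\int[nu]_x (\1_[set x | s x = s (tnth z k)] x)%:E)%E; last first.
      rewrite (integral_indic nu measurableT mE) setIT.
      exact: atomless.
    apply: eq_integral => x _; rewrite indicE; congr ((nat_of_bool _)%:R%:E).
    by apply/eqP/idP; rewrite inE.
  - apply/measurable_EFinP; apply: measurable_natr; apply: measurable_fun_eqr => //.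
  - by move=> x; rewrite lee_fin.
have aeN k l : {ae mu, forall z, ~ N k l z}.
  by exists (N k l); split => // z /= /contrapT.
have : {ae mu, forall z, forall k l, ~ N k l z}.
  by apply: filter_forall => k; apply: filter_forall => l; exact: aeN.
apply: filterS => z h k l /eqP kl; apply/eqP; apply: contra_notT (h k l) => nkl.
by rewrite /N /= nkl kl.
Qed.

End sampled_order_statistics.

(** * Deviation inside one bundle *)

Section bundle_deviation.
Context {d : measure_display} {T : measurableType d} {R : realType} {M : nat}.
Variables (s : T -> R).
Hypothesis ms : measurable_fun setT s.
Variables (nu : probability T R) (mu : probability (M.-tuple T) R).
Hypothesis iid : iid_cloud nu mu.
Variables lo hi : option nat.
Hypotheses (lo_lt : if lo is Some i then (i < M)%N else true)
  (hi_lt : if hi is Some j then (j < M)%N else true).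
Variables (Q : nat) (f : nat -> T -> R) (L : R).
Hypotheses (mf : forall r, measurable_fun setT (f r)) (L0 : 0 <= L)
  (fL : forall r x, 0 <= f r x <= L).
Hypothesis patterns : forall (K : {set 'I_M}) u, exists C : {set {set 'I_M * bool}},
  (#|C| <= (2 * #|K|).+1 ^ (2 * Q.+1))%N /\
  forall r t, 0 <= t < L ->
    finset (fun j : 'I_M * bool => (j.1 \in K) && (t < f r (coord u j))) \in C.

Let pattern_bound (K : {set 'I_M}) : nat := ((2 * #|K|).+1 ^ (2 * Q.+1))%N.
Let rate (K : {set 'I_M}) : R := 3 * ln (1 + (pattern_bound K)%:R).

Let rate_ge0 K : 0 <= rate K.
Proof. by rewrite mulr_ge0// ln_ge0// lerDl. Qed.

Let pattern_rate K u : exists C : {set {set 'I_M * bool}},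
  3 * ln (1 + #|C|%:R) <= rate K /\
  forall r t, 0 <= t < L ->
    finset (fun j : 'I_M * bool => (j.1 \in K) && (t < f r (coord u j))) \in C.
Proof.
have [C [CK CP]] := patterns K u; exists C; split => //.
by rewrite ler_wpM2l// ler_ln ?posrE ?ltr_pwDl// lerD2l ler_nat.
Qed.

Local Notation region := (in_region s lo hi).
Local Notation mass := (region_mass nu region).

(** At most one term is nonzero at each cloud, that of the set of its interior
    samples; summing over all [K] makes the set deterministic in each term. *)
Definition bundle_deviation (z : M.-tuple T) : \bar R :=
  (\sum_(K : {set 'I_M} | (0 < #|K|)%N)
     (#|K|%:R^-1)%:E * deviation nu mu K (interior_is s lo hi K) region f z)%E.

Let mdev K : measurable_fun setT (deviation nu mu K (interior_is s lo hi K) region f).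
Proof.
apply: measurable_deviation => //.
- exact: measurable_interior_is.
- exact: measurable_in_region.
Qed.

Lemma bundle_deviation_ge0 z : (0 <= bundle_deviation z)%E.
Proof.
apply: sume_ge0 => K _; apply: mule_ge0; first by rewrite lee_fin invr_ge0.
exact: deviation_ge0.
Qed.

Lemma measurable_bundle_deviation : measurable_fun setT bundle_deviation.
Proof.
rewrite /bundle_deviation; under eq_fun do rewrite -big_filter.
apply: emeasurable_sum => K; apply: emeasurable_funM => //.
Qed.

Definition interior_rate (z : M.-tuple T) : R :=
  \sum_(K : {set 'I_M} | (0 < #|K|)%N)
     (L * rate K / #|K|%:R) * ((interior_is s lo hi K z)%:R * mass z).

Lemma integral_bundle_deviation :
  (\int[mu]_z bundle_deviation z <= \int[mu]_z (interior_rate z)%:E)%E.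
Proof.
have mK (K : {set 'I_M}) : measurable_fun setT (fun z => ((interior_is s lo hi K z)%:R * mass z)%:E).
  apply/measurable_EFinP; apply: measurable_funM.
    by apply: measurable_natr; exact: measurable_interior_is.
  by apply: measurable_region_mass; exact: measurable_in_region.
have K0 (K : {set 'I_M}) z : (0 <= ((interior_is s lo hi K z)%:R * mass z)%:E)%E.
  by rewrite lee_fin mulr_ge0// region_mass_ge0.
rewrite ge0_integral_sum_cond; first last.
- by move=> K z; apply: mule_ge0; [rewrite lee_fin invr_ge0|exact: deviation_ge0].
- by move=> K; apply: emeasurable_funM.
rewrite [leRHS](_ : _ = \int[mu]_z (\sum_(K : {set 'I_M} | (0 < #|K|)%N)
     (L * rate K / #|K|%:R)%:E * ((interior_is s lo hi K z)%:R * mass z)%:E))%E; last first.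
  by apply: eq_integral => z _; rewrite /interior_rate -sumEFin.
have c0 (K : {set 'I_M}) : (0 <= (L * rate K / #|K|%:R)%:E)%E.
  by rewrite lee_fin; apply: divr_ge0 => //; apply: mulr_ge0 => //; exact: rate_ge0.
rewrite ge0_integral_sum_cond; first last.
- by move=> K z; exact: mule_ge0 (c0 K) (K0 K z).
- by move=> K; apply: emeasurable_funM.
have d0 (K : {set 'I_M}) z : (0 <= deviation nu mu K (interior_is s lo hi K) region f z)%E by exact: deviation_ge0.
have i0 (K : {set 'I_M}) : (0 <= (#|K|%:R^-1 : R)%:E)%E by rewrite lee_fin invr_ge0.
apply: lee_sum => K K0'; rewrite !ge0_integralZl//.
rewrite [X in (_ <= X%:E * _)%E]mulrC EFinM -[leRHS]muleA lee_wpmul2l//.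
apply: integral_deviation => //.
- exact: measurable_interior_is.
- exact: measurable_in_region.
- by move=> z k; exact: interior_is_self.
- by move=> z z'; exact: interior_is_stable.
Qed.

(** Distinct scores leave at least [#|closed_sample| - 1] interior samples, so
    [deviation_rate] applies with [k] equal to that number. *)
Lemma interior_rate_le (z : M.-tuple T) : (lo || hi -> injective (scores s z)) ->
  (2 <= #|closed_sample lo hi (scores s z)|)%N ->
  interior_rate z <= 18 * L *
    ((ln (#|closed_sample lo hi (scores s z)|%:R - 1) + 1) * (Q%:R + 1) /
      (#|closed_sample lo hi (scores s z)|%:R - 1)) * mass z.
Proof.
move=> inj N2; have /andP[KN NK] := card_interior_sample hi_lt inj.
rewrite -(natrB _ (ltnW N2)).
set K := interior_sample lo hi (scores s z) in KN NK.
rewrite /interior_rate (bigD1 K)/=; last by rewrite -ltnS (leq_trans N2).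
rewrite [X in _ + X]big1 ?addr0; last first.
  move=> K' /andP[_ K'K]; rewrite /interior_is -/K [K == K']eq_sym (negbTE K'K).
  by rewrite mul0r mulr0.
rewrite /interior_is -/K eqxx mul1r.
rewrite ler_wpM2r ?region_mass_ge0// -(mulrA L) [18 * L]mulrC -(mulrA L) ler_wpM2l//.
have arith (k c : nat) : (1 < c)%N -> (k <= c)%N -> (c <= k.+1)%N ->
  (0 < c - 1)%N /\ (c - 1 <= k <= (c - 1).+1)%N by lia.
have [k0 kn] := arith _ _ N2 KN NK; exact: (deviation_rate R k0 kn (leqnn _)).
Qed.

(** The factor 4 is 2 * 2: the sample sum is counted twice in the excess, and the
    interior samples are all those of the bundle but at most one, hence at least
    half of them. *)
Lemma le_bundle_deviation (z : M.-tuple T) (g : T -> R) :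
  (lo || hi -> injective (scores s z)) ->
  (2 <= #|closed_sample lo hi (scores s z)|)%N ->
  measurable_fun setT g -> (forall x, 0 <= g x) ->
  (forall (K : {set 'I_M}) z', ((\sum_(k in K) g (tnth z' k) - 2 * \sum_(k in K) g (tnth z k))%:E <=
    sup_excess K f (z, z'))%E) ->
  (\int[nu]_(x in [set x | region z x]) (g x)%:E <=
    bundle_deviation z + (4 * mass z *
      ((\sum_(m in closed_sample lo hi (scores s z)) g (tnth z m)) /
        #|closed_sample lo hi (scores s z)|%:R))%:E)%E.
Proof.
move=> inj N2 mg g0 gP; have /andP[KN NK] := card_interior_sample hi_lt inj.
set C := closed_sample lo hi (scores s z) in N2 KN NK *.
set K := interior_sample lo hi (scores s z) in KN NK.
have K0 : (0 < #|K|)%N by lia.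
have GK : interior_is s lo hi K z by rewrite /interior_is /K eqxx.
have h := le_deviation iid K0 (measurable_interior_is ms lo_lt hi_lt K)
  (measurable_in_region ms lo_lt hi_lt) mf GK mg g0 (gP K).
have KR : 0 < #|K|%:R :> R by rewrite ltr0n.
rewrite -(@lee_pmul2l _ #|K|%:R%:E)// ?lte_fin//.
apply: le_trans h _.
rewrite ge0_muleDr; [|exact: bundle_deviation_ge0|]; last first.
  rewrite lee_fin !mulr_ge0 ?region_mass_ge0 ?invr_ge0//; exact: sumr_ge0.
apply: leeD.
  rewrite /bundle_deviation (bigD1 K)//= ge0_muleDr; first last.
  - by apply: sume_ge0 => K' _; apply: mule_ge0; [rewrite lee_fin invr_ge0|exact: deviation_ge0].
  - by apply: mule_ge0; [rewrite lee_fin invr_ge0|exact: deviation_ge0].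
  rewrite muleA -EFinM divff ?gt_eqF// mul1e leeDl//.
  apply: mule_ge0 => //; apply: sume_ge0 => K' _.
  by apply: mule_ge0; [rewrite lee_fin invr_ge0|exact: deviation_ge0].
have KC : \sum_(k in K) g (tnth z k) <= \sum_(m in C) g (tnth z m).
  rewrite [leRHS](bigID (mem K))/= [leLHS](eq_bigl (fun i => (i \in C) && (i \in K))); last first.
    move=> i; rewrite andbC; case: (boolP (i \in K)) => //=; rewrite !inE => /andP[-> /=].
    by rewrite /strictly_below /below; case: hi => // j /ltW.
  by rewrite lerDl; apply: sumr_ge0.
have S0 : 0 <= \sum_(m in C) g (tnth z m) by apply: sumr_ge0.
have CR : 0 < #|C|%:R :> R by rewrite ltr0n; lia.
have m0 := region_mass_ge0 nu region z.
rewrite -EFinM lee_fin.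
rewrite [leRHS](_ : _ = 2 * mass z * ((2 * #|K|%:R / #|C|%:R) * \sum_(m in C) g (tnth z m))); last by field; rewrite gt_eqF.
rewrite ler_wpM2l ?mulr_ge0//; apply: le_trans KC _; rewrite ler_peMl//.
by rewrite ler_pdivlMr// mul1r -natrM ler_nat; lia.
Qed.

End bundle_deviation.

(** * Disintegration along the conditional law *)

Section disintegration.
Context {d1 d2 : measure_display} {T1 : measurableType d1} {T2 : measurableType d2}
  {R : realType}.
Local Open Scope ereal_scope.
Variables (nu : probability (T1 * T2)%type R) (kappa : R.-pker T1 ~> T2).

(** The law of [(x, Y)] when [Y] has law [kappa x]. *)
Definition graph_law (x : T1) (U : set (T1 * T2)) : \bar R := kappa x (xsection U x).

Let graph_law0 x : graph_law x set0 = 0.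
Proof. by rewrite /graph_law xsection0 measure0. Qed.

Let graph_law_ge0 x U : 0 <= graph_law x U.
Proof. exact: measure_ge0. Qed.

Let graph_law_additive x : semi_sigma_additive (graph_law x).
Proof.
move=> F mF tF mUF; rewrite /graph_law xsection_bigcup.
apply: measure_semi_sigma_additive.
- by move=> n; exact: measurable_xsection.
- exact: trivIset_xsection.
- by rewrite -xsection_bigcup; exact: measurable_xsection.
Qed.

HB.instance Definition _ x := isMeasure.Build _ _ _ (graph_law x) (graph_law0 x)
  (graph_law_ge0 x) (@graph_law_additive x).

(** The [unit] component is there because [nu] enters the composition of kernels as
    a kernel with a one-point source. *)
Definition graph_kernel (u : unit * (T1 * T2)) : {measure set (T1 * T2) -> \bar R} :=
  graph_law u.2.1.

Let measurable_graph_kernel (U : set (T1 * T2)) : measurable U ->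
  measurable_fun [set: unit * (T1 * T2)] (graph_kernel ^~ U).
Proof.
move=> mU; rewrite (_ : (fun _ => _) = (fun x => kappa x (xsection U x)) \o (fst \o snd))//.
apply: measurableT_comp; last exact: measurableT_comp.
have [r kr] := measure_uub kappa.
by apply: measurable_fun_xsection_finite_kernel => //; rewrite ?inE.
Qed.

HB.instance Definition _ := @isKernel.Build _ _ _ _ R graph_kernel measurable_graph_kernel.

Let graph_kernel_setT u : graph_kernel u setT = 1.
Proof.
transitivity (kappa u.2.1 setT); last exact: prob_kernel.
congr (kappa _ _); apply/seteqP; split => y //= _; rewrite /xsection /=.
by rewrite inE.
Qed.

HB.instance Definition _ := @Kernel_isProbability.Build _ _ _ _ R graph_kernel graph_kernel_setT.

Lemma integral_graph_law x (H : T1 * T2 -> \bar R) : measurable_fun setT H ->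
  (forall z, 0 <= H z) -> \int[graph_law x]_z H z = \int[kappa x]_y H (x, y).
Proof.
move=> mH H0; symmetry; apply: (ge0_integral_image (phi := fun y => (x, y))) => //.
  by apply/measurable_fun_pair => //; exact: measurable_cst.
by move=> A mA; rewrite -[RHS]/(kappa x (xsection A x)) xsectionE.
Qed.

Hypothesis hkappa : regular_conditional_law nu kappa.

Let cnu : unit -> pprobability (T1 * T2)%type R := fun=> nu.
Let mcnu : measurable_fun setT cnu := measurable_cst _.

Let graph_kernel_law A : measurable A -> kcomp (kprobability mcnu) graph_kernel tt A = nu A.
Proof.
apply: (measure_unique [set A `*` B | A in measurable & B in measurable] (fun=> setT)).
- exact: measurable_prod_measurableType.
- move=> _ _ [X mX [Y mY <-]] [X' mX' [Y' mY' <-]].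
  exists (X `&` X'); first exact: measurableI.
  by exists (Y `&` Y'); [exact: measurableI|rewrite setXI].
- by move=> _; exists setT => //; exists setT => //; rewrite setXTT.
- by rewrite bigcup_const.
- move=> _ [X mX [Y mY <-]]; transitivity (\int[nu]_(z in X `*` setT) kappa z.1 Y); last by symmetry; exact: hkappa.
  rewrite [RHS]integral_mkcond; apply: eq_integral => z _.
  rewrite patchE; case: ifPn => [/set_mem zX|/negP zX].
    transitivity (kappa z.1 (xsection (X `*` Y) z.1)); first by [].
    by rewrite in_xsectionX//; apply/mem_set; exact: zX.1.
  rewrite -[LHS]/(kappa z.1 (xsection (X `*` Y) z.1)) notin_xsectionX ?measure0//.
  by apply/negP => /set_mem zX'; apply: zX; apply/mem_set.
- move=> _; apply: (@le_lt_trans _ _ 1); last exact: ltry.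
  rewrite -[leLHS]/(\int[nu]_z kappa z.1 (xsection setT z.1)).
  rewrite (eq_integral (cst 1)); last by move=> z _; rewrite -(graph_kernel_setT (tt, z)).
  by rewrite integral_cst// mul1e probability_le1.
Qed.

(** The composition of [nu] with the graph kernel is a measure that agrees with [nu]
    on rectangles, which is what [regular_conditional_law] says. *)
Lemma disintegration (H : T1 * T2 -> \bar R) : measurable_fun setT H -> (forall z, 0 <= H z) ->
  \int[nu]_z H z = \int[nu]_z \int[kappa z.1]_y H (z.1, y).
Proof.
move=> mH H0.
transitivity (\int[kcomp (kprobability mcnu) graph_kernel tt]_z H z).
  by apply: eq_measure_integral => A mA _; symmetry; exact: graph_kernel_law.
rewrite integral_kcomp//; apply: eq_integral => z _.
exact: integral_graph_law.
Qed.

End disintegration.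

(** * Resampling the second components *)

Lemma integral_probability_cst (d : measure_display) (T : measurableType d) (R : realType)
  (P : probability T R) (c : \bar R) : (\int[P]_x c = c)%E.
Proof. by rewrite integral_cst//= probability_setT mule1. Qed.

Section resampling.
Context {d1 d2 : measure_display} {T1 : measurableType d1} {T2 : measurableType d2}
  {R : realType} {M : nat}.
Local Open Scope ereal_scope.
Variables (nu : probability (T1 * T2)%type R) (kappa : R.-pker T1 ~> T2).
Hypothesis hkappa : regular_conditional_law nu kappa.
Variable mu : probability (M.-tuple (T1 * T2)%type) R.
Hypothesis iid : iid_cloud nu mu.
Local Notation cloud := (M.-tuple (T1 * T2)%type).

Definition update (z : cloud) (m : 'I_M) (x : T1 * T2) : cloud :=
  [tuple if i == m then x else tnth z i | i < M].

Lemma measurable_update m : measurable_fun setT (fun u : cloud * (T1 * T2) => update u.1 m u.2).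
Proof.
apply/measurable_fun_tnthP => i.
rewrite (_ : _ \o _ = if i == m then snd else (fun u : cloud * (T1 * T2) => tnth u.1 i)); last first.
  by apply/funext => u /=; rewrite tnth_mktuple; case: ifP.
case: (i == m); first exact: measurable_snd.
by apply: (measurableT_comp (measurable_tnth i)); exact: measurable_fst.
Qed.

(** Swapping coordinate [m] with its ghost preserves the law of the two clouds, and
    the first cloud then holds an independent draw at [m]. *)
Lemma integral_update m (F : cloud -> \bar R) : measurable_fun setT F -> (forall z, 0 <= F z) ->
  \int[mu]_z F z = \int[mu]_z \int[nu]_x F (update z m x).
Proof.
move=> mF F0.
have mF1 : measurable_fun [set: cloud * cloud] (fun u => F u.1).
  by apply: (measurableT_comp mF); exact: measurable_fst.
have := integral_swapc iid (fun i => i == m) mF1 (fun u => F0 u.1).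
rewrite (fubini_tonelli1 (fun u : cloud * cloud => F u.1))//.
rewrite [X in _ = X -> _](_ : _ = \int[mu]_z F z); last first.
  by apply: eq_integral => z _; rewrite /fubini_F; exact: (integral_probability_cst mu (F z)).
move=> <-.
rewrite (fubini_tonelli1 (fun u : cloud * cloud => F (swapc (fun i => i == m) u).1))//; last first.
  by apply: (measurableT_comp mF1); exact: measurable_swapc.
apply: eq_integral => z _; rewrite /fubini_F.
rewrite -(integral_tnth iid m (f := fun x => F (update z m x)))//.
- apply: eq_integral => z' _; congr F; apply: eq_from_tnth => i.
  by rewrite !tnth_mktuple /=; case: eqP => // ->.
- apply: (measurableT_comp mF).
  exact: (measurable_fun_pair2 z (measurable_update m)).
Qed.

Definition coordinate_kernel (m : 'I_M) (z : cloud) : {measure set T2 -> \bar R} :=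
  kappa (tnth z m).1.

Let measurable_coordinate_kernel m (U : set T2) : measurable U ->
  measurable_fun setT (coordinate_kernel m ^~ U).
Proof.
move=> mU; apply: (measurableT_comp (measurable_kernel kappa U mU) (g := fun z : cloud => (tnth z m).1)).
by apply: (measurableT_comp measurable_fst); exact: measurable_tnth.
Qed.

HB.instance Definition _ m := @isKernel.Build _ _ _ _ R (coordinate_kernel m)
  (measurable_coordinate_kernel m).

Let coordinate_kernel_setT m z : coordinate_kernel m z setT = 1.
Proof. exact: prob_kernel. Qed.

HB.instance Definition _ m := @Kernel_isProbability.Build _ _ _ _ R (coordinate_kernel m)
  (coordinate_kernel_setT m).

Definition resample (m : 'I_M) (F : cloud -> \bar R) (z : cloud) : \bar R :=
  \int[kappa (tnth z m).1]_y F (update z m ((tnth z m).1, y)).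

Let measurable_update_y m :
  measurable_fun setT (fun u : cloud * T2 => update u.1 m ((tnth u.1 m).1, u.2)).
Proof.
apply: (measurableT_comp (measurable_update m)
  (g := fun u : cloud * T2 => (u.1, ((tnth u.1 m).1, u.2)))).
apply/measurable_fun_pair => //=; apply/measurable_fun_pair => //=.
apply: (measurableT_comp measurable_fst).
by apply: (measurableT_comp (measurable_tnth m)); exact: measurable_fst.
Qed.

Lemma measurable_resample m F : measurable_fun setT F -> (forall z, 0 <= F z) ->
  measurable_fun setT (resample m F).
Proof.
move=> mF F0.
apply: (measurable_fun_integral_finite_kernel
  (fun u : cloud * T2 => F (update u.1 m ((tnth u.1 m).1, u.2))) (coordinate_kernel m)) => //.
by apply: (measurableT_comp mF); exact: measurable_update_y.
Qed.

Lemma resample_ge0 m F z : (forall z, 0 <= F z) -> 0 <= resample m F z.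
Proof. by move=> F0; exact: integral_ge0. Qed.

(** An independent draw at [m] may be made in two steps, its first component and
    then its second one from [kappa]; resampling repeats the second step. *)
Lemma integral_resample m F : measurable_fun setT F -> (forall z, 0 <= F z) ->
  \int[mu]_z resample m F z = \int[mu]_z F z.
Proof.
move=> mF F0.
rewrite (integral_update m)//; last 2 first.
- exact: measurable_resample.
- by move=> z; exact: resample_ge0.
rewrite [RHS](integral_update m)//; apply: eq_integral => z _.
rewrite [RHS](disintegration hkappa)//; last first.
  by apply: (measurableT_comp mF); exact: (measurable_fun_pair2 z (measurable_update m)).
apply: eq_integral => x _; rewrite /resample tnth_mktuple eqxx.
apply: eq_integral => y _; congr F; apply: eq_from_tnth => i.
by rewrite !tnth_mktuple; case: (i == m).
Qed.

Lemma le_resample m F G z : measurable_fun setT F -> (forall z, 0 <= F z) ->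
  measurable_fun setT G -> (forall z, F z <= G z) -> resample m F z <= resample m G z.
Proof.
move=> mF F0 mG FG.
have mu_y : measurable_fun setT (fun y => update z m ((tnth z m).1, y)).
  exact: (measurable_fun_pair2 z (measurable_update_y m)).
have mFu := measurableT_comp mF mu_y; have mGu := measurableT_comp mG mu_y.
exact: ge0_le_integral.
Qed.

Definition resample_all (F : cloud -> \bar R) : cloud -> \bar R :=
  foldr resample F (enum 'I_M).

Let foldr_resample (F : cloud -> \bar R) (l : seq 'I_M) :
  measurable_fun setT F -> (forall z, 0 <= F z) ->
  measurable_fun setT (foldr resample F l) /\ (forall z, 0 <= foldr resample F l z).
Proof.
move=> mF F0; elim: l => // m l [mG G0] /=; split; first exact: measurable_resample.
by move=> z; exact: resample_ge0.
Qed.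

Lemma measurable_resample_all F : measurable_fun setT F -> (forall z, 0 <= F z) ->
  measurable_fun setT (resample_all F).
Proof. by move=> mF F0; have [] := foldr_resample (enum 'I_M) mF F0. Qed.

Lemma resample_all_ge0 F z : measurable_fun setT F -> (forall z, 0 <= F z) ->
  0 <= resample_all F z.
Proof. by move=> mF F0; have [_ ->] := foldr_resample (enum 'I_M) mF F0. Qed.

Lemma integral_resample_all F : measurable_fun setT F -> (forall z, 0 <= F z) ->
  \int[mu]_z resample_all F z = \int[mu]_z F z.
Proof.
move=> mF F0; rewrite /resample_all; elim: (enum 'I_M) => //= m l IH.
have [mG G0] := foldr_resample l mF F0.
by rewrite integral_resample.
Qed.

(** By induction on the coordinates already averaged. The weights depend on the
    first components only, so that averaging a coordinate acts on one value of [h]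
    and leaves the others alone. *)
Lemma resample_all_le F (w : 'I_M -> cloud -> R) (h : T2 -> R) z :
  measurable_fun setT F -> (forall z, 0 <= F z) ->
  (forall m, measurable_fun setT (w m)) -> (forall m z, (0 <= w m z)%R) ->
  (forall m z z', (forall i, (tnth z i).1 = (tnth z' i).1) -> w m z = w m z') ->
  measurable_fun setT h -> (forall y, (0 <= h y)%R) ->
  (forall z, F z <= (\sum_(m < M) w m z * h (tnth z m).2)%:E) ->
  resample_all F z <= \sum_(m < M) (w m z)%:E * \int[kappa (tnth z m).1]_y (h y)%:E.
Proof.
move=> mF F0 mw w0 wx mh h0 Fh.
pose g x := \int[kappa x]_y (h y)%:E.
have mh' : measurable_fun setT (EFin \o h) by exact/measurable_EFinP.
have g0 x : 0 <= g x by apply: integral_ge0 => y _; rewrite lee_fin.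
have mg : measurable_fun setT g.
  by apply: measurable_fun_integral_kernel => //; exact: measurable_kernel.
pose phi (l : seq 'I_M) m (z : cloud) := if m \in l then g (tnth z m).1 else (h (tnth z m).2)%:E.
have phi0 l m z' : 0 <= phi l m z' by rewrite /phi; case: ifP => _ //; rewrite lee_fin.
have mphi l m : measurable_fun setT (phi l m).
  rewrite /phi; case: (m \in l).
    apply: (measurableT_comp mg); apply: (measurableT_comp measurable_fst); exact: measurable_tnth.
  apply: (measurableT_comp mh'); apply: (measurableT_comp measurable_snd); exact: measurable_tnth.
have w0' m z' : 0 <= (w m z')%:E by rewrite lee_fin.
have mwphi l m : measurable_fun setT (fun z => (w m z)%:E * phi l m z).
  by apply: emeasurable_funM => //; exact/measurable_EFinP.
suff H l z' : foldr resample F l z' <= \sum_(m < M) (w m z')%:E * phi l m z'.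
  apply: (le_trans (H _ z)); apply: lee_sum => m _.
  by rewrite /phi mem_enum.
elim: l z' => [|m0 l IH] z' /=.
  apply: (le_trans (Fh z')); rewrite -sumEFin; apply: lee_sum => m _.
  by rewrite /phi EFinM.
have [mG G0] := foldr_resample l mF F0.
apply: (@le_trans _ _ (resample m0 (fun z => \sum_(m < M) (w m z)%:E * phi l m z) z')).
  apply: le_resample => //.
  exact: emeasurable_sum.
have mu_y : measurable_fun setT (fun y => update z' m0 ((tnth z' m0).1, y)).
  exact: (measurable_fun_pair2 z' (measurable_update_y m0)).
rewrite /resample (@ge0_integral_sum _ _ _ (kappa (tnth z' m0).1) _ measurableT _
  (fun m y => (w m (update z' m0 ((tnth z' m0).1, y)))%:E *
    phi l m (update z' m0 ((tnth z' m0).1, y)))); last 2 first.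
- by move=> m; exact: (measurableT_comp (mwphi l m)).
- by move=> m y _; apply: mule_ge0.
apply: lee_sum => m _.
have wE y : w m (update z' m0 ((tnth z' m0).1, y)) = w m z'.
  by apply: wx => i; rewrite tnth_mktuple; case: eqP => // ->.
under eq_integral do rewrite wE.
rewrite ge0_integralZl//; last exact: (measurableT_comp (mphi l m)).
apply: lee_wpmul2l => //.
have kcst x c : \int[kappa x]_y c = c by rewrite integral_cst//= prob_kernel mule1.
rewrite /phi inE; have [->|mm0] /= := eqVneq m m0.
  case: (m0 \in l).
    rewrite (eq_integral (fun=> g (tnth z' m0).1)) ?kcst// => y _.
    by rewrite tnth_mktuple eqxx.
  by under eq_integral do rewrite tnth_mktuple eqxx.
rewrite (eq_integral (fun=> if m \in l then g (tnth z' m).1 else (h (tnth z' m).2)%:E)) ?kcst// => y _.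
by rewrite tnth_mktuple (negbTE mm0).
Qed.

End resampling.

(** * Clipped least-squares losses *)

Section rational_combinations.
Context {R : realType} {Q : nat}.

(** An enumeration of the rational coefficient vectors: extrema over the whole span
    become extrema over a sequence, hence measurable. *)
Definition rational_coef (r : nat) (k : 'I_Q) : R :=
  if unpickle r is Some a then ratr ((a : {ffun 'I_Q -> rat}) k) else 0.

Lemma cvg_sum_ord (I : Type) (s : seq I) (u : I -> nat -> R) (a : I -> R) :
  (forall k, u k n @[n --> \oo] --> a k) ->
  (\sum_(k <- s) u k n @[n --> \oo] --> \sum_(k <- s) a k).
Proof.
move=> ua; elim: s => [|k s IH].
  by rewrite big_nil; under eq_fun do rewrite big_nil; exact: cvg_cst.
by rewrite big_cons; under eq_fun do rewrite big_cons; exact: cvgD.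
Qed.

Lemma rational_coef_dense (a : 'I_Q -> R) : exists r : nat -> nat,
  forall k, rational_coef (r n) k @[n --> \oo] --> a k.
Proof.
have ex n k : exists b : rat, `|a k - ratr b| < n.+1%:R^-1.
  have : a k - n.+1%:R^-1 < a k + n.+1%:R^-1.
    by rewrite ltrD2l gtrN ?invr_gt0.
  move=> /rat_in_itvoo[b]; rewrite inE => bI; have b1 : a k - n.+1%:R^-1 < ratr b by rewrite (itvP bI).
  have b2 : ratr b < a k + n.+1%:R^-1 by rewrite (itvP bI).
  exists b.
  by move: b1 b2; set e := _^-1 => b1 b2; rewrite ltr_norml; apply/andP; split; lra.
pose b n : {ffun 'I_Q -> rat} := [ffun k => projT1 (cid (ex n k))].
exists (fun n => pickle (b n)); move=> k.
rewrite /rational_coef; under eq_fun do rewrite pickleK ffunE.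
apply/cvgrPdist_lt => e e0.
near=> n; apply: lt_trans (projT2 (cid (ex n k))) _.
near: n.
have := @cvg_harmonic R.
move=> /cvgrPdist_lt/(_ e e0); apply: filterS => n.
by rewrite sub0r normrN ger0_norm// invr_ge0.
Unshelve. all: by end_near. Qed.

End rational_combinations.

Section clipped_loss.
Context {d : measure_display} {T : measurableType d} {R : realType} {Q : nat}.
Variables (v : T -> R) (p : 'I_Q -> T -> R) (A : T -> bool) (L : R).
Hypotheses (mv : measurable_fun setT v) (mp : forall k, measurable_fun setT (p k))
  (mA : measurable_fun setT A) (L0 : 0 <= L).

Definition square_loss (a : 'I_Q -> R) (x : T) : R := (v x - \sum_k a k * p k x) ^+ 2.
Definition clipped_loss (a : 'I_Q -> R) (x : T) : R :=
  Num.min (square_loss a x) L * (A x)%:R.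

Lemma square_loss_ge0 a x : 0 <= square_loss a x.
Proof. exact: sqr_ge0. Qed.

Lemma measurable_square_loss a : measurable_fun setT (square_loss a).
Proof.
apply: measurable_funX; apply: measurable_funB => //.
by apply: measurable_sum => k; apply: measurable_funM => //; exact: measurable_cst.
Qed.

Lemma clipped_loss_bounds a x : 0 <= clipped_loss a x <= L.
Proof.
rewrite /clipped_loss; case: (A x); last by rewrite mulr0 lexx.
by rewrite mulr1 le_min L0 square_loss_ge0 ge_min lexx orbT.
Qed.

Lemma measurable_clipped_loss a : measurable_fun setT (clipped_loss a).
Proof.
apply: measurable_funM; last exact: measurable_natr.
apply: measurable_minr; [exact: measurable_square_loss|exact: measurable_cst].
Qed.

Lemma square_loss_cvg (a : 'I_Q -> R) (b : nat -> 'I_Q -> R) :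
  (forall k, b n k @[n --> \oo] --> a k) -> forall x,
  square_loss (b n) x @[n --> \oo] --> square_loss a x.
Proof.
move=> ba x; rewrite /square_loss.
have h : v x - \sum_k b n k * p k x @[n --> \oo] --> v x - \sum_k a k * p k x.
  apply: cvgB; first exact: cvg_cst.
  apply: cvg_sum_ord => k; apply: cvgM; [exact: ba|exact: cvg_cst].
exact: (cvgM h h).
Qed.

Lemma clipped_loss_cvg (a : 'I_Q -> R) (b : nat -> 'I_Q -> R) :
  (forall k, b n k @[n --> \oo] --> a k) -> forall x,
  clipped_loss (b n) x @[n --> \oo] --> clipped_loss a x.
Proof.
move=> ba x; apply: cvgM; last exact: cvg_cst.
under eq_fun do rewrite minr_absE.
rewrite minr_absE; have h := square_loss_cvg ba (x := x).
apply: cvgM; last exact: cvg_cst.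
apply: cvgB; first by apply: cvgD => //; exact: cvg_cst.
by apply: cvg_norm; apply: cvgB => //; exact: cvg_cst.
Qed.

(** The excess is continuous in the coefficients, so its supremum over rational
    coefficients bounds it at real ones. This covers the fitted coefficients, which
    vary with the cloud. *)
Lemma clipped_excess_le (M : nat) (K : {set 'I_M}) (z z' : M.-tuple T) (a : 'I_Q -> R) :
  ((\sum_(k in K) clipped_loss a (tnth z' k) - 2 * \sum_(k in K) clipped_loss a (tnth z k))%:E
    <= sup_excess K (fun r => clipped_loss (rational_coef r)) (z, z'))%E.
Proof.
have [r ra] := rational_coef_dense a.
pose u n := \sum_(k in K) clipped_loss (rational_coef (r n)) (tnth z' k) -
  2 * \sum_(k in K) clipped_loss (rational_coef (r n)) (tnth z k).
have cu : u n @[n --> \oo] --> \sum_(k in K) clipped_loss a (tnth z' k)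
    - 2 * \sum_(k in K) clipped_loss a (tnth z k).
  apply: cvgB; [|apply: cvgM; first exact: cvg_cst];
    (under eq_fun do rewrite -big_filter); rewrite -big_filter;
    by apply: cvg_sum_ord => k; exact: clipped_loss_cvg.
have ub n : ((u n)%:E <= sup_excess K (fun r => clipped_loss (rational_coef r)) (z, z'))%E.
  apply: le_trans (excess_le_sup K _ _ (r n)).
  by rewrite lee_fin le_max lexx orbT.
have S0 := sup_excess_ge0 K (fun r => clipped_loss (rational_coef r)) (z, z').
move: ub S0; case: (sup_excess _ _ _) => [S| |] ub S0 //; last by rewrite leey.
rewrite lee_fin; apply: (cvgr_to_le cu); apply: nearW => n.
by have := ub n; rewrite lee_fin.
Qed.

Lemma clipped_patterns (M : nat) (K : {set 'I_M}) (u : (M.-tuple T * M.-tuple T)%type) :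
  exists C : {set {set 'I_M * bool}}, (#|C| <= (2 * #|K|).+1 ^ (2 * Q.+1))%N /\
  forall r t, 0 <= t < L ->
    finset (fun j : 'I_M * bool => (j.1 \in K) && (t < clipped_loss (rational_coef r) (coord u j))) \in C.
Proof.
have [C [CK CP]] := clipped_loss_patterns K (fun j => v (coord u j))
  (fun k j => p k (coord u j)) (fun j => A (coord u j)) L.
by exists C; split => // r t /(CP (rational_coef r)).
Qed.

End clipped_loss.

(** * Suprema over a compact set *)

Section borel.
Context {R : realType} {q : nat}.

Lemma continuous_measurable_borelRV (f : 'rV[R]_q -> R) : continuous f ->
  measurable_fun [set: borelRV R q] (f : borelRV R q -> R).
Proof.
move=> cf _; apply: (measurability _ (RGenOInfty.measurableE R)) => // _ [_ [x ->] <-].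
rewrite setTI; apply: sub_sigma_algebra.
apply: open_comp; first by move=> y _; exact: cf.
exact: interval_open.
Qed.

Lemma compact_measurable_borelRV (A : set 'rV[R]_q) : compact A -> measurable (A : set (borelRV R q)).
Proof.
move=> cA; rewrite -(setCK A); apply: measurableC; apply: sub_sigma_algebra.
by rewrite openC; apply: compact_closed => //; exact: norm_hausdorff.
Qed.

Variables (A : set 'rV[R]_q) (cA : compact A).

Lemma Csup_ge0 (f : 'rV[R]_q -> R) : (0 <= Csup f A)%E.
Proof. by rewrite /Csup le_max lexx. Qed.

Lemma le_Csup (f : 'rV[R]_q -> R) y : A y -> (`|f y|%:E <= Csup f A)%E.
Proof.
by move=> Ay; rewrite /Csup le_max; apply/orP; right; apply: ereal_sup_ubound; exists y.
Qed.

Lemma Csup_continuous (f : 'rV[R]_q -> R) : continuous f -> (Csup f A < +oo)%E.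
Proof.
move=> cf.
have : compact (f @` A).
  by apply: continuous_compact => //; exact: continuous_subspaceT.
move=> /compact_bounded fbd.
have /ex_strict_bound_gt0[b b0 /= fb] := fbd.
rewrite /Csup gt_max ltry/=; apply: (@le_lt_trans _ _ b%:E); last exact: ltry.
by apply: ge_ereal_sup => _ [y Ay <-]; rewrite lee_fin; apply/ltW/fb; exists y.
Qed.

Lemma le_fine_Csup (f : 'rV[R]_q -> R) y : (Csup f A < +oo)%E -> A y -> `|f y| <= fine (Csup f A).
Proof.
move=> fA Ay; rewrite -lee_fin fineK; first exact: le_Csup.
by rewrite ge0_fin_numE// Csup_ge0.
Qed.

Variables (Q : nat) (p : 'I_Q -> 'rV[R]_q -> R) (cp : forall k, continuous (p k)).

Lemma le_Csup_basis k : (Csup (p k) A <= Csup_basis p A)%E.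
Proof. by rewrite /Csup_basis (bigD1 k)//= le_max lexx. Qed.

Lemma Csup_basis_fin : Csup_basis p A \is a fin_num.
Proof.
rewrite ge0_fin_numE; rewrite /Csup_basis.
  by elim/big_ind: _ => //= [x y x1 y1|k _]; [rewrite gt_max x1 y1|exact: Csup_continuous].
by elim/big_ind: _ => //= [x y x1 y1|k _]; [rewrite le_max x1|exact: Csup_ge0].
Qed.

Lemma le_fine_Csup_basis k y : A y -> `|p k y| <= fine (Csup_basis p A).
Proof.
move=> Ay; rewrite -lee_fin fineK ?Csup_basis_fin//.
by apply: le_trans (le_Csup_basis k); exact: le_Csup.
Qed.

(** The Cauchy-Schwarz inequality against the constant vector, from
    [0 <= \sum_k \sum_l (x k - x l) ^+ 2]. *)
Lemma sqr_sum_le (x : 'I_Q -> R) : (\sum_k x k) ^+ 2 <= Q%:R * \sum_k x k ^+ 2.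
Proof.
have : 0 <= \sum_(k < Q) \sum_(l < Q) (x k - x l) ^+ 2.
  by apply: sumr_ge0 => k _; apply: sumr_ge0 => l _; exact: sqr_ge0.
rewrite (eq_bigr (fun k => Q%:R * x k ^+ 2 - 2 * (x k * \sum_l x l) + \sum_l x l ^+ 2)); last first.
  move=> k _; rewrite mulr_sumr mulr_sumr -sumrN.
  have -> : Q%:R * x k ^+ 2 = \sum_(l < Q) x k ^+ 2 by rewrite sumr_const card_ord mulr_natl.
  by rewrite -!big_split/=; apply: eq_bigr => l _; ring.
rewrite !big_split/= sumr_const card_ord sumrN -!mulr_sumr -mulr_suml -[X in _ + X]mulr_natl.
by rewrite -expr2; lra.
Qed.

(** [Lprime] is the bound that [(s - t) ^+ 2 <= 2 * s ^+ 2 + 2 * t ^+ 2] and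
    Cauchy-Schwarz give on the squared error when the coefficients have squared norm
    at most [L]. *)
Lemma square_loss_le_Lprime (v : 'rV[R]_q -> R) (L : R) (a : 'I_Q -> R) y :
  (Csup v A < +oo)%E -> A y -> \sum_k a k ^+ 2 <= L ->
  (v y - lincomb p a y) ^+ 2 <= Lprime p v A L.
Proof.
move=> vA Ay aL; set C := fine (Csup_basis p A).
have vy : v y ^+ 2 <= fine (Csup v A) ^+ 2.
  rewrite -(real_normK (num_real (v y))) lerXn2r// ?nnegrE ?fine_ge0 ?Csup_ge0//.
  exact: le_fine_Csup.
have C0 : 0 <= C ^+ 2 by exact: sqr_ge0.
have ly : lincomb p a y ^+ 2 <= L * Q%:R * C ^+ 2.
  apply: le_trans (sqr_sum_le _) _; rewrite [L * _]mulrC -mulrA ler_wpM2l//.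
  apply: (@le_trans _ _ (\sum_k a k ^+ 2 * C ^+ 2)); last by rewrite -mulr_suml ler_wpM2r.
  apply: ler_sum => k _; rewrite exprMn ler_wpM2l ?sqr_ge0//.
  rewrite -(real_normK (num_real (p k y))) lerXn2r// ?nnegrE//.
    exact: le_trans (normr_ge0 _) (le_fine_Csup_basis k Ay).
  exact: le_fine_Csup_basis.
rewrite /Lprime -/C; have := sqr_ge0 (v y + lincomb p a y); nra.
Qed.

Lemma Lprime_ge0 (v : 'rV[R]_q -> R) (L : R) : 0 <= L -> 0 <= Lprime p v A L.
Proof.
move=> L0; apply: addr_ge0; apply: mulr_ge0; rewrite ?sqr_ge0 //.
by apply: mulr_ge0 => //; exact: mulr_ge0.
Qed.

End borel.

(** * Bundles as intervals of order statistics *)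

(** A bundle is the set of points whose score lies between two order statistics of
    the sample scores. The first bundle has no lower bound and the last one no upper
    bound, which [None] expresses. *)
Section bundles_as_order_intervals.
Context {R : realType} {q M B : nat}.
Variables (sortf : 'rV[R]_q -> R) (gsize : 'I_B -> nat).
Hypotheses (M0 : (0 < M)%N) (hgsize : almost_equal_sizes (M := M) gsize).

Definition last_index (b : nat) : nat := (\sum_(c < B | (c <= b)%N) gsize c).-1.

Lemma last_index_lt b : (last_index b < M)%N.
Proof.
have sM : (\sum_(c < B | (c <= b)%N) gsize c <= M)%N.
  by rewrite -hgsize.1 [leqRHS](bigID (fun c : 'I_B => (c <= b)%N))/= leq_addr.
rewrite /last_index; case: (\sum_(_ < _ | _) _)%N sM => //=.
Qed.

Lemma last_index_mono b c : (b <= c)%N -> (last_index b <= last_index c)%N.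
Proof.
clear M0 hgsize; move=> bc; have : (\sum_(i < B | (i <= b)%N) gsize i <= \sum_(i < B | (i <= c)%N) gsize i)%N.
  rewrite [leqRHS](bigID (fun i : 'I_B => (i <= b)%N))/=.
  rewrite [X in (_ <= X + _)%N](eq_bigl (fun i : 'I_B => (i <= b)%N)) ?leq_addr// => i.
  by case: (leqP i b) => ib; rewrite ?andbF// (leq_trans ib bc).
by rewrite /last_index; lia.
Qed.

Definition lower_index (b : 'I_B) : option nat :=
  if (0 < b)%N then Some (last_index b.-1) else None.
Definition upper_index (b : 'I_B) : option nat :=
  if (b.+1 < B)%N then Some (last_index b) else None.

Lemma lower_index_lt b : if lower_index b is Some i then (i < M)%N else true.
Proof. by rewrite /lower_index; case: ifP => // _; exact: last_index_lt. Qed.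

Lemma upper_index_lt b : if upper_index b is Some i then (i < M)%N else true.
Proof. by rewrite /upper_index; case: ifP => // _; exact: last_index_lt. Qed.

Lemma one_bundle b : lower_index b || upper_index b -> (1 < B)%N.
Proof.
clear M0 hgsize; rewrite /lower_index /upper_index; have bB := ltn_ord b.
by case: ifP => [b0 _|_]; [lia|case: ifP => // b1 _; lia].
Qed.

Variable X : 'I_M -> 'rV[R]_q.

Lemma sortf_last_sample b : sortf (last_sample sortf gsize X b) = order_stat (sortf \o X) (last_index b).
Proof.
rewrite /last_sample /sorted_samples -/(last_index b) /order_stat.
rewrite -(nth_map _ 0) ?size_sort ?size_map ?(size_enum_ord M) -?enumT ?size_enum_ord ?last_index_lt//.
by rewrite [in RHS](map_comp sortf X) [in RHS]sort_map.
Qed.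

Lemma bundleE b x : bundle sortf gsize X b x <->
  above (lower_index b) (sortf \o X) (sortf x) && below (upper_index b) (sortf \o X) (sortf x).
Proof.
rewrite /bundle /= !sortf_last_sample /above /below /lower_index /upper_index.
split.
  by move=> [h1 h2]; apply/andP; split; case: ifP.
by move=> /andP[]; case: ifP => _ h1; case: ifP => _ h2; split => // _.
Qed.

Lemma bundle_countE b :
  bundle_count sortf gsize X b = #|closed_sample (lower_index b) (upper_index b) (sortf \o X)|%:R :> R.
Proof.
rewrite /bundle_count -sum1_card natr_sum [RHS]big_mkcond/=; apply: eq_bigr => m _.
rewrite indicE inE; case: ifP => h; first by rewrite mem_set//; apply/bundleE.
by rewrite memNset// => /bundleE; rewrite /= h.
Qed.

Lemma bundle_uniq b c x : bundle sortf gsize X b x -> bundle sortf gsize X c x -> b = c.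
Proof.
wlog bc : b c / (b <= c)%N.
  by move=> H hb hc; case: (leqP b c) => [/H|/ltnW/H]; [exact|move=> ->].
move=> hb hc; apply/val_inj/eqP; rewrite /= eqn_leq bc /= leqNgt; apply/negP => lt_bc.
have c0 : (0 < c)%N by lia.
have bB : (b.+1 < B)%N by have := ltn_ord c; lia.
have /= := hb.2 bB; have /= := hc.1 c0; rewrite !sortf_last_sample => h1 h2.
have : order_stat (sortf \o X) (last_index b) <= order_stat (sortf \o X) (last_index c.-1).
  by apply: order_stat_mono; [apply: last_index_mono; lia|exact: last_index_lt].
by rewrite leNgt (lt_le_trans h1 h2).
Qed.

Hypothesis B0 : (0 < B)%N.

Lemma bundle_cover x : exists b, bundle sortf gsize X b x.
Proof.
pose P (b : 'I_B) := (b.+1 < B)%N ==> (sortf x <= order_stat (sortf \o X) (last_index b)).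
have lastB : (B.-1 < B)%N by lia.
have Pl : P (Ordinal lastB) by rewrite /P /= prednK// ltnn.
case: (arg_minnP val Pl) => b Pb bmin; exists b.
rewrite /bundle /= !sortf_last_sample; split => [b0|bB]; last by move/implyP: Pb; apply.
have b1B : (b.-1 < B)%N by have := ltn_ord b; lia.
rewrite ltNge; apply/negP => h.
have : P (Ordinal b1B) by rewrite /P /= h implybT.
by move=> /bmin /=; lia.
Qed.

Lemma vtilde_bundle Q (p : 'I_Q -> 'rV[R]_q -> R) alpha b x y : bundle sortf gsize X b x ->
  vtilde sortf gsize X p alpha x y = lincomb p (alpha b) y.
Proof.
move=> bx; rewrite /vtilde (bigD1 b)//= indicE mem_set// mul1r big1 ?addr0// => c cb.
rewrite indicE memNset ?mul0r// => cx; move/eqP: cb; apply.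
exact: bundle_uniq cx bx.
Qed.

End bundles_as_order_intervals.

(** * Lower integrals and the law of the cloud *)

(** [g] may fail to be measurable: its integral is then the supremum over the simple
    functions below it, and these include the simple functions below [f] once [f] is
    set to zero on a null set. *)
Lemma le_lower_integral (d : measure_display) (T : measurableType d) (R : realType)
    (m : {measure set T -> \bar R}) (f g : T -> \bar R) :
  measurable_fun setT f -> (forall x, 0 <= f x)%E -> (forall x, 0 <= g x)%E ->
  {ae m, forall x, (f x <= g x)%E} -> (\int[m]_x f x <= \int[m]_x g x)%E.
Proof.
move=> mf f0 g0 [N [mN N0 Nfg]].
have mfN : measurable_fun setT (f \_ (~` N)).
  by apply/(measurable_restrictT _ (measurableC mN)).1; exact: measurable_funTS.
have fN0 x : (0 <= (f \_ (~` N)) x)%E by apply: erestrict_ge0.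
rewrite (ge0_ae_eq_integral (g := f \_ (~` N)))//; last first.
  exists N; split => // x /= h; apply: contrapT => Nx; apply: h => _.
  by rewrite patchE mem_set.
rewrite !ge0_integralTE//; apply: le_ereal_sup => _ [h hf <-]; exists h => // x.
apply: le_trans (hf x) _; rewrite patchE; case: ifPn => // xN.
by apply: contrapT => h'; move: xN; rewrite inE => /(_ (Nfg x h')).
Qed.

Lemma ae_image (d1 d2 : measure_display) (X : measurableType d1) (Y : measurableType d2)
    (R : realType) (phi : X -> Y) (m : {measure set X -> \bar R}) (m' : {measure set Y -> \bar R})
    (Pr : set Y) :
  measurable_fun setT phi -> (forall A, measurable A -> m (phi @^-1` A) = m' A) ->
  {ae m', forall y, Pr y} -> {ae m, forall x, Pr (phi x)}.
Proof.
move=> mphi mm' [N [mN N0 NP]]; exists (phi @^-1` N); split.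
- by rewrite -[X in measurable X]setTI; exact: mphi.
- by rewrite mm'.
- by move=> x /= h; exact: NP.
Qed.

Section cloud_of_samples.
Context {dT d : measure_display} {T : measurableType dT} {R : realType} {M : nat}
  {Omega : measurableType d}.
Variables (P : probability Omega R) (Z : 'I_M -> {RV P >-> T}) (nu : probability T R).

Definition sample_cloud (w : Omega) : M.-tuple T := [tuple Z m w | m < M].

Lemma measurable_sample_cloud : measurable_fun setT sample_cloud.
Proof.
apply/measurable_fun_tnthP => i; rewrite (_ : _ \o _ = Z i)//.
by apply/funext => w; rewrite /= tnth_mktuple.
Qed.

HB.instance Definition _ := isMeasurableFun.Build _ _ _ _ sample_cloud measurable_sample_cloud.

Definition cloud_law : probability (M.-tuple T) R :=
  [the probability _ _ of distribution P [the {mfun Omega >-> M.-tuple T} of sample_cloud]].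

Lemma cloud_lawE A : cloud_law A = P (sample_cloud @^-1` A).
Proof. by []. Qed.

Lemma iid_cloud_law : (forall m A, measurable A -> P (Z m @^-1` A) = nu A) ->
  mutually_independent P (fun m => Z m : Omega -> T) -> iid_cloud nu cloud_law.
Proof.
move=> law indep A mA; rewrite cloud_lawE.
have := indep finset.setT A mA; rewrite (eq_bigr (fun i => nu (A i))); last by move=> i _; exact: law.
rewrite (eq_bigl xpredT); last by move=> i; rewrite inE.
move=> <-; congr (P _); apply/seteqP; split => w /=.
  by move=> h i _; have := h i; rewrite tnth_mktuple.
by move=> h i; rewrite tnth_mktuple; apply: h; rewrite /= inE.
Qed.

Lemma integral_cloud_law (F : M.-tuple T -> \bar R) :
  measurable_fun setT F -> (forall z, 0 <= F z)%E ->
  (\int[cloud_law]_z F z = \int[P]_w F (sample_cloud w))%E.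
Proof. by move=> mF F0; symmetry; apply: ge0_integral_image => //; exact: measurable_sample_cloud. Qed.

End cloud_of_samples.

(** * The empirical bias of a bundle *)

Section empirical_bias.
Context {R : realType} {q Q M : nat}.
Local Notation T := (borelRV R q * borelRV R q)%type.
Variables (nu : probability T R) (kappa : R.-pker (borelRV R q) ~> (borelRV R q)).
Variables (p : 'I_Q -> 'rV[R]_q -> R) (v : 'rV[R]_q -> R) (L : R).
Hypotheses (hp : forall k, continuous (p k))
  (hv : measurable_fun setT (v : borelRV R q -> R)) (L0 : 0 <= L).
Variable sortf : 'rV[R]_q -> R.
Hypothesis hsortf : measurable_fun setT (sortf : borelRV R q -> R).
Variables lo hi : option nat.
Hypotheses (lo_lt : if lo is Some i then (i < M)%N else true)
  (hi_lt : if hi is Some j then (j < M)%N else true) (M0 : (0 < M)%N).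

Definition score (x : T) : R := sortf x.1.
Definition target (x : T) : R := v x.2.
Definition basis (k : 'I_Q) (x : T) : R := p k x.2.

Lemma measurable_score : measurable_fun setT score.
Proof. by apply: (measurableT_comp hsortf); exact: measurable_fst. Qed.

Lemma measurable_target : measurable_fun setT target.
Proof. by apply: (measurableT_comp hv); exact: measurable_snd. Qed.

Lemma measurable_basis k : measurable_fun setT (basis k).
Proof.
by apply: (measurableT_comp (continuous_measurable_borelRV (@hp k))); exact: measurable_snd.
Qed.

Local Notation sqloss := (square_loss target basis).
Local Notation mass := (@region_mass _ _ _ M nu (in_region score lo hi)).

Definition in_bundle (z : M.-tuple T) (x : T) : bool :=
  above lo (scores score z) (score x) && below hi (scores score z) (score x).

Lemma measurable_in_bundle : measurable_fun setT (fun u : M.-tuple T * T => in_bundle u.1 u.2).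
Proof.
apply: measurable_and.
- exact: (measurable_above measurable_score lo_lt).
- exact: (measurable_below measurable_score hi_lt).
Qed.

Definition sample_in_bundle (m : 'I_M) (z : M.-tuple T) : R := (in_bundle z (tnth z m))%:R.

Lemma measurable_sample_in_bundle m : measurable_fun setT (sample_in_bundle m).
Proof.
apply: measurable_natr.
apply: (measurableT_comp measurable_in_bundle (g := fun z : M.-tuple T => (z, tnth z m))).
by apply/measurable_fun_pair => //=; exact: measurable_tnth.
Qed.

Lemma sample_in_bundle_ge0 m z : 0 <= sample_in_bundle m z.
Proof. exact: ler0n. Qed.

Definition sample_count (z : M.-tuple T) : R := \sum_(m < M) sample_in_bundle m z.

Lemma measurable_sample_count : measurable_fun setT sample_count.
Proof. by apply: measurable_sum => m; exact: measurable_sample_in_bundle. Qed.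

Lemma sample_count_ge0 z : 0 <= sample_count z.
Proof. by apply: sumr_ge0 => m _; exact: sample_in_bundle_ge0. Qed.

Lemma sum_closed_sample z (F : 'I_M -> R) :
  \sum_(m in closed_sample lo hi (scores score z)) F m = \sum_(m < M) sample_in_bundle m z * F m.
Proof.
rewrite big_mkcond/=; apply: eq_bigr => m _; rewrite inE /sample_in_bundle /in_bundle.
by case: ifP => _; rewrite ?mul1r ?mul0r.
Qed.

Lemma sample_countE z : sample_count z = #|closed_sample lo hi (scores score z)|%:R.
Proof.
rewrite -sum1_card natr_sum sum_closed_sample; apply: eq_bigr => m _.
by rewrite mulr1.
Qed.

Definition mean_square_loss (a : 'I_Q -> R) (z : M.-tuple T) : R :=
  (\sum_(m < M) sample_in_bundle m z * sqloss a (tnth z m)) / sample_count z.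

Lemma measurable_mean_square_loss a : measurable_fun setT (mean_square_loss a).
Proof.
apply: measurable_funM; last by apply: measurable_funV; exact: measurable_sample_count.
apply: measurable_sum => m; apply: measurable_funM; first exact: measurable_sample_in_bundle.
apply: (measurableT_comp (measurable_square_loss measurable_target measurable_basis a)).
exact: measurable_tnth.
Qed.

(** The infimum runs over rational coefficients, which makes it a measurable
    function of the cloud; by continuity it is a lower bound at real coefficients as
    well. *)
Definition empirical_bias (z : M.-tuple T) : \bar R :=
  mine (einfs (fun r => (mean_square_loss (rational_coef r) z)%:E) 0%N) L%:E.

Lemma measurable_empirical_bias : measurable_fun setT empirical_bias.
Proof.
apply: measurable_mine; last exact: measurable_cst.
by apply: measurable_fun_einfs => r; apply/measurable_EFinP; exact: measurable_mean_square_loss.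
Qed.

Lemma mean_square_loss_ge0 a z : 0 <= mean_square_loss a z.
Proof.
apply: divr_ge0; last exact: sample_count_ge0.
apply: sumr_ge0 => m _; apply: mulr_ge0; [exact: sample_in_bundle_ge0|exact: square_loss_ge0].
Qed.

Lemma le_empirical_bias z (b : \bar R) : (b <= L%:E)%E ->
  (forall r, b <= (mean_square_loss (rational_coef r) z)%:E)%E -> (b <= empirical_bias z)%E.
Proof.
move=> bL br; rewrite /empirical_bias le_min bL andbT.
by apply: le_ereal_inf_tmp => _ [r _ <-].
Qed.

Lemma empirical_bias_ge0 z : (0 <= empirical_bias z)%E.
Proof.
apply: le_empirical_bias; first by rewrite lee_fin.
by move=> r; rewrite lee_fin mean_square_loss_ge0.
Qed.

Lemma empirical_bias_le z a : (empirical_bias z <= (mean_square_loss a z)%:E)%E.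
Proof.
have [r ra] := rational_coef_dense a.
have ub n : (empirical_bias z <= (mean_square_loss (rational_coef (r n)) z)%:E)%E.
  by rewrite /empirical_bias ge_min ereal_inf_lbound//; exists (r n).
have cu : mean_square_loss (rational_coef (r n)) z @[n --> \oo] --> mean_square_loss a z.
  apply: cvgM; last exact: cvg_cst.
  apply: cvg_sum_ord => m; apply: cvgM; first exact: cvg_cst.
  exact: square_loss_cvg.
move: ub; case: (empirical_bias z) => [x| |] ub; last by rewrite leNye.
  rewrite lee_fin; apply: (cvgr_to_ge cu); apply: nearW => n.
  by have := ub n; rewrite lee_fin.
by have := ub 0%N; rewrite leye_eq.
Qed.

Definition weighted_bias (z : M.-tuple T) : \bar R := ((mass z)%:E * empirical_bias z)%E.

Lemma measurable_weighted_bias : measurable_fun setT weighted_bias.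
Proof.
apply: emeasurable_funM; last exact: measurable_empirical_bias.
apply/measurable_EFinP; apply: measurable_region_mass.
exact: (measurable_in_region measurable_score lo_lt hi_lt).
Qed.

Lemma weighted_bias_ge0 z : (0 <= weighted_bias z)%E.
Proof. by apply: mule_ge0; [rewrite lee_fin region_mass_ge0|exact: empirical_bias_ge0]. Qed.

Let same_scores (z z' : M.-tuple T) : (forall i, (tnth z i).1 = (tnth z' i).1) -> scores score z = scores score z'.
Proof. by move=> h; apply/funext => m; rewrite /scores /score h. Qed.

Let mass_same (z z' : M.-tuple T) : (forall i, (tnth z i).1 = (tnth z' i).1) -> mass z = mass z'.
Proof. by move=> h; rewrite /region_mass /in_region (same_scores h). Qed.

Let sample_in_bundle_same m (z z' : M.-tuple T) : (forall i, (tnth z i).1 = (tnth z' i).1) ->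
  sample_in_bundle m z = sample_in_bundle m z'.
Proof. by move=> h; rewrite /sample_in_bundle /in_bundle (same_scores h) /score h. Qed.

Let sample_count_same (z z' : M.-tuple T) : (forall i, (tnth z i).1 = (tnth z' i).1) ->
  sample_count z = sample_count z'.
Proof. by move=> h; apply: eq_bigr => m _; exact: sample_in_bundle_same. Qed.

Let mmass : measurable_fun setT mass.
Proof.
by apply: measurable_region_mass; exact: (measurable_in_region measurable_score lo_lt hi_lt).
Qed.

Let mass0 (z : M.-tuple T) : 0 <= mass z. Proof. exact: region_mass_ge0. Qed.

Lemma resampled_bias_le_L z :
  (resample_all kappa weighted_bias z <= (mass z * L)%:E)%E.
Proof.
(* The constant bound is a weighted sum with [h = 1] and all the weight on one sample. *)
pose m0 := Ordinal M0.
have := @resample_all_le _ _ _ _ _ _ kappa weighted_bias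
  (fun m z => if m == m0 then mass z * L else 0) (cst 1) z
  measurable_weighted_bias weighted_bias_ge0.
move=> /(_ _ _ _ _ _ _) H; apply: le_trans (H _ _ _ _ _ _) _ => //.
- move=> m; case: (m == m0); last exact: measurable_cst.
  by apply: measurable_funM => //; exact: measurable_cst.
- by move=> m z'; case: ifP => // _; apply: mulr_ge0.
- by move=> m z1 z2 h; case: ifP => // _; rewrite (mass_same h).
- move=> z'; rewrite (bigD1 m0)//= ?eqxx mulr1 big1 ?addr0; last by move=> m /negbTE ->; rewrite mul0r.
  rewrite /weighted_bias EFinM lee_wpmul2l ?lee_fin//.
  by rewrite /empirical_bias ge_min lexx orbT.
rewrite (bigD1 m0)//= ?eqxx big1 ?adde0; last by move=> m /negbTE ->; rewrite mul0e.
by rewrite integral_cst//= prob_kernel !mule1.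
Qed.

(** For fixed coefficients the empirical loss is a weighted sum in which each term
    involves one second component. Averaging turns each square into a conditional
    mean square error at a point of the bundle, and the weights add up to
    [mass z]. *)
Lemma resampled_bias_le_mse z a : sample_count z != 0 ->
  (resample_all kappa weighted_bias z <= (mass z)%:E *
    ereal_sup [set conditional_mse kappa v (lincomb p a) x | x in
      [set x | above lo (scores score z) (sortf x) && below hi (scores score z) (sortf x)]])%E.
Proof.
move=> N0; set D := [set x | _].
pose h (y : borelRV R q) : R := (v y - lincomb p a y) ^+ 2.
have mh : measurable_fun setT h.
  apply: measurable_funX; apply: measurable_funB => //; apply: measurable_sum => k.
  by apply: measurable_funM; [exact: measurable_cst|exact: continuous_measurable_borelRV].
pose w (m : 'I_M) (z : M.-tuple T) : R := mass z * (sample_in_bundle m z / sample_count z).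
have := @resample_all_le _ _ _ _ _ _ kappa weighted_bias w h z
  measurable_weighted_bias weighted_bias_ge0.
move=> /(_ _ _ _ _ _ _) H; apply: le_trans (H _ _ _ _ _ _) _ => //.
- move=> m; apply: measurable_funM => //; apply: measurable_funM.
    exact: measurable_sample_in_bundle.
  by apply: measurable_funV; exact: measurable_sample_count.
- by move=> m z'; rewrite /w !mulr_ge0 ?invr_ge0 ?sample_in_bundle_ge0 ?sample_count_ge0.
- by move=> m z1 z2 e; rewrite /w (mass_same e) (sample_in_bundle_same m e) (sample_count_same e).
- by move=> y; exact: sqr_ge0.
- move=> z'; rewrite /weighted_bias.
  apply: (@le_trans _ _ ((mass z')%:E * (mean_square_loss a z')%:E)%E).
    by rewrite lee_wpmul2l ?lee_fin// empirical_bias_le.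
  rewrite -EFinM lee_fin /mean_square_loss mulr_suml mulr_sumr le_eqVlt; apply/orP; left; apply/eqP.
  apply: eq_bigr => m _; have -> : h (tnth z' m).2 = sqloss a (tnth z' m) by [].
  by move: (sqloss a (tnth z' m)) => y; rewrite /w -!mulrA [y * _]mulrC.
set S := ereal_sup _.
have S_ub x : D x -> (\int[kappa x]_y (h y)%:E <= S)%E.
  move=> Dx; apply: ereal_sup_ubound; exists x => //.
  by apply: eq_integral => y _; rewrite real_normK// num_real.
have Sg m : ((w m z)%:E * \int[kappa (tnth z m).1]_y (h y)%:E <= (w m z)%:E * S)%E.
  rewrite /w /sample_in_bundle; case: (boolP (in_bundle z (tnth z m))) => Dm; last first.
    by rewrite mul0r mulr0 !mul0e.
  rewrite lee_wpmul2l ?S_ub// lee_fin.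
  by rewrite !mulr_ge0 ?invr_ge0 ?sample_count_ge0.
apply: (@le_trans _ _ (\sum_(m < M) (w m z)%:E * S)%E); first by apply: lee_sum => m _.
have S0 : (0 <= S)%E.
  have [x Dx] : exists x, D x.
    move/eqP: N0; rewrite /sample_count.
    have [/existsP[m Dm] _|none] := boolP [exists m, in_bundle z (tnth z m)].
      by exists (tnth z m).1.
    move=> H0; exfalso; apply: H0; apply: big1 => m _; rewrite /sample_in_bundle.
    by move: none; rewrite negb_exists => /forallP/(_ m)/negbTE ->.
  apply: le_trans (S_ub x Dx); apply: integral_ge0 => y _; rewrite lee_fin; exact: sqr_ge0.
rewrite -ge0_sume_distrl; last first.
  by move=> m _; rewrite lee_fin /w !mulr_ge0 ?invr_ge0 ?sample_in_bundle_ge0 ?sample_count_ge0.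
rewrite sumEFin /w -mulr_sumr -mulr_suml -/(sample_count z) divff// mulr1.
by [].
Qed.

(** The average of an infimum is at most the infimum of the averages. *)
Lemma resampled_bias_le_bundle_bias z : sample_count z != 0 ->
  (resample_all kappa weighted_bias z <= (mass z)%:E * bundle_bias kappa p v L
      [set x | above lo (scores score z) (sortf x) && below hi (scores score z) (sortf x)])%E.
Proof.
move=> N0; have hL := resampled_bias_le_L z; have hm a := resampled_bias_le_mse a N0.
have [m0|m0] := eqVneq (mass z) 0.
  by rewrite m0 mul0e; move: hL; rewrite m0 mul0r.
have mpos : 0 < mass z by rewrite lt_neqAle eq_sym m0 mass0.
have div b : (resample_all kappa weighted_bias z <= (mass z)%:E * b)%E ->
    ((mass z)^-1%:E * resample_all kappa weighted_bias z <= b)%E.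
  by move=> h; rewrite -(@lee_pmul2l _ (mass z)%:E)// muleA -EFinM divff// mul1e.
rewrite -[leLHS]mul1e -(divff m0) EFinM -muleA lee_wpmul2l ?lee_fin//.
rewrite /bundle_bias le_min; apply/andP; split; last by apply: div; rewrite -EFinM.
apply: le_ereal_inf_tmp => _ [phi [a _ <-] <-].
exact: div.
Qed.

End empirical_bias.

(** * The error of the bundled regression *)

Section assembly.
Context {R : realType} {q Q M B : nat}.
Local Notation T := (borelRV R q * borelRV R q)%type.
Hypothesis B0 : (0 < B)%N.
Variables (nu : probability T R) (kappa : R.-pker (borelRV R q) ~> (borelRV R q)).
Hypothesis hkappa : regular_conditional_law nu kappa.
Context {d : measure_display} {Omega : measurableType d}.
Variables (P : probability Omega R) (Z : 'I_M -> {RV P >-> T}).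
Hypothesis hZlaw : forall m A, measurable A -> P (Z m @^-1` A) = nu A.
Hypothesis hZindep : mutually_independent P (fun m => Z m : Omega -> _).
Variables (p : 'I_Q -> 'rV[R]_q -> R) (v : 'rV[R]_q -> R).
Hypotheses (hp : forall k, continuous (p k))
  (hv : measurable_fun setT (v : borelRV R q -> R)).
Variable A : set 'rV[R]_q.
Hypotheses (hA : compact A) (hvA : (Csup v A < +oo)%E).
Variable sortf : 'rV[R]_q -> R.
Hypothesis hsortf : measurable_fun setT (sortf : borelRV R q -> R).
Variable gsize : 'I_B -> nat.
Hypothesis hgsize : almost_equal_sizes (M := M) gsize.
Variable L : R.
Hypothesis hL : 0 <= L.
Variable alpha : 'I_B -> 'I_Q -> {RV P >-> R}.

Local Notation xs w := (fun m : 'I_M => (Z m w).1 : 'rV[R]_q).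
Local Notation ys w := (fun m : 'I_M => (Z m w).2 : 'rV[R]_q).
Local Notation bun w := (bundle sortf gsize (xs w)).
Local Notation cnt w := (bundle_count sortf gsize (xs w)).
Local Notation vt w := (vtilde sortf gsize (xs w) p (fun b k => alpha b k w)).
Local Notation S := (selection_event (fun b k => alpha b k : Omega -> R) L).
Local Notation L' := (Lprime p v A L).
Local Notation score := (score sortf).
Local Notation target := (target v).
Local Notation basis := (basis p).

Hypothesis hnice : {ae P, forall w, forall b, 2 <= cnt w b}.
Hypothesis halpha : forall w,
  least_squares sortf gsize (xs w) p v (ys w) (fun b k => alpha b k w).

Let mu := cloud_law Z.
Let cloud := sample_cloud Z.

Let iid : iid_cloud nu mu.
Proof. exact: iid_cloud_law. Qed.

Let L'0 : 0 <= L' := Lprime_ge0 A p v hL.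

Let mcloud : measurable_fun setT cloud := measurable_sample_cloud Z.

Lemma sample_size_gt0 : (0 < M)%N.
Proof.
rewrite lt0n; apply/eqP => M0.
have [E [mE PE sE]] := hnice.
have : (P setT <= P E)%E.
  apply: le_measure; rewrite ?inE// => w _; apply: sE => /= /(_ (Ordinal B0)).
  rewrite /bundle_count big1 ?ler10; first by rewrite lern0.
  by move=> m; have := ltn_ord m; rewrite {2}M0.
by rewrite PE probability_setT lee_fin ler10.
Qed.

Let M0 := sample_size_gt0.
Let lo b := lower_index gsize b.
Let hi b := upper_index gsize b.
Let lo_lt b : if lo b is Some i then (i < M)%N else true := lower_index_lt M0 hgsize b.
Let hi_lt b : if hi b is Some i then (i < M)%N else true := upper_index_lt M0 hgsize b.

Let scoresE w : scores score (cloud w) = sortf \o xs w.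
Proof. by apply/funext => m; rewrite /scores /cloud tnth_mktuple. Qed.

Let countE w b : cnt w b = #|closed_sample (lo b) (hi b) (scores score (cloud w))|%:R :> R.
Proof. by rewrite scoresE bundle_countE. Qed.

(** If the score had an atom, all samples would share that score with positive
    probability, and then no sample would lie above the last score of the first
    group: the second bundle would be empty, against [hnice]. *)
Lemma scores_atomless : (1 < B)%N -> forall t, nu [set x | score x = t] = 0%E.
Proof.
move=> B1 t; apply/eqP/negPn/negP => t0.
have mt : measurable [set x : T | score x = t].
  by rewrite -[X in measurable X]setTI; exact: (measurable_score hsortf measurableT (measurable_set1 t)).
pose E := sample_cloud Z @^-1` box (fun=> [set x : T | score x = t]).
have [F [mF PF sF]] := hnice.
have EF : E `<=` F.
  move=> w Ew; apply: sF => /(_ (Ordinal B1)).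
  have st m' : scores score (cloud w) m' = t by exact: (Ew m').
  rewrite countE (_ : #|_| = 0)%N; first by rewrite ler_nat.
  apply: eq_card0 => m; rewrite !inE /lo /lower_index /= /above.
  rewrite order_stat_lt; last exact: last_index_lt M0 hgsize _.
  rewrite /count_lt eq_card0 ?ltn0// => m'.
  by rewrite !inE !st ltxx.
have mE : measurable E.
  rewrite -[X in measurable X]setTI; apply: mcloud => //; exact: measurable_box.
have : P E = 0%E by apply: subset_measure0 EF PF.
rewrite -[P E]/(mu (box (fun=> [set x : T | score x = t]))) iid//.
have nuf : nu [set x | score x = t] \is a fin_num by exact: fin_num_measure.
rewrite (eq_bigr (fun=> (fine (nu [set x | score x = t]))%:E)); last by move=> i _; rewrite fineK.
rewrite prodEFin prodr_const => /eqP; rewrite eqe expf_eq0 => /andP[_ /eqP c0].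
by move/eqP: t0; apply; rewrite -(fineK nuf) c0.
Qed.

Let good w := forall b, (lo b || hi b -> injective (scores score (cloud w))) /\
  (2 <= #|closed_sample (lo b) (hi b) (scores score (cloud w))|)%N.

Lemma ae_good : {ae P, forall w, good w}.
Proof.
have inj : {ae P, forall w, (1 < B)%N -> injective (scores score (cloud w))}.
  have [B1|B1] := ltnP 1 B; last by apply: aeW => w.
  have injmu : {ae mu, forall z, injective (scores score z)}.
    exact: (ae_injective_scores (measurable_score hsortf) iid (scores_atomless B1)).
  have := ae_image (m := P) mcloud _ injmu => /(_ (fun _ _ => erefl)).
  by apply: filterS => w h _.
move: hnice inj; apply: filterS2 => w nice inj b; split.
  by move=> h; apply: inj; exact: (one_bundle h).
by have := nice b; rewrite countE ler_nat.
Qed.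

Let inA (x : T) : bool := `[< A x.2 >].

Let minA : measurable_fun setT inA.
Proof.
apply: (measurable_fun_bool true); rewrite setTI.
rewrite (_ : _ @^-1` _ = snd @^-1` (A : set (borelRV R q))).
  rewrite -[X in measurable X]setTI; apply: measurable_snd => //.
  exact: compact_measurable_borelRV.
by apply/seteqP; split => x /=; rewrite /inA => /asboolP.
Qed.

Let indicAE (x : T) : \1_A x.2 = (inA x)%:R :> R.
Proof. by rewrite indicE; congr (nat_of_bool _)%:R; apply/idP/asboolP; rewrite inE. Qed.

Let loss := clipped_loss target basis inA L'.
Let f r := loss (rational_coef r).

Let mloss a : measurable_fun setT (loss a).
Proof.
apply: measurable_clipped_loss => //; first exact: measurable_target.
by move=> k; exact: measurable_basis.
Qed.

Let loss_bounds a x : 0 <= loss a x <= L'. Proof. exact: clipped_loss_bounds. Qed.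
Let loss0 a x : 0 <= loss a x. Proof. by have /andP[] := loss_bounds a x. Qed.

Let patterns (K : {set 'I_M}) u := clipped_patterns target basis inA L' K u.

Let dev b (z : M.-tuple T) := bundle_deviation score nu mu (lo b) (hi b) f z.
Let wbias b (z : M.-tuple T) := weighted_bias nu p v L' sortf (lo b) (hi b) z.

Let mscore := measurable_score hsortf.

Let dev0 b z : (0 <= dev b z)%E. Proof. exact: bundle_deviation_ge0. Qed.
Let mdev b : measurable_fun setT (dev b).
Proof. by apply: measurable_bundle_deviation => // r; exact: mloss. Qed.

Let wbias0 b z : (0 <= wbias b z)%E. Proof. exact: weighted_bias_ge0. Qed.
Let mwbias b : measurable_fun setT (wbias b).
Proof. exact: measurable_weighted_bias. Qed.

Let inb b w (x : T) : bool := in_bundle sortf (lo b) (hi b) (cloud w) x.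

Let inbE b w x : bun w b x.1 <-> inb b w x.
Proof. by rewrite /inb /in_bundle scoresE; exact: bundleE. Qed.

Let mass b w : R := region_mass nu (in_region score (lo b) (hi b)) (cloud w).

Let measurable_square_error :
  measurable_fun [set: Omega * T] (fun u => `|v u.2.2 - vt u.1 u.2.1 u.2.2| ^+ 2).
Proof.
apply: measurable_funX; apply: measurableT_comp => //; apply: measurable_funB.
  by apply: (measurableT_comp hv); apply: (measurableT_comp measurable_snd); exact: measurable_snd.
rewrite (_ : (fun u => _) = (fun u : Omega * T => \sum_(b < B)
    (inb b u.1 u.2)%:R * \sum_(k < Q) alpha b k u.1 * basis k u.2)); last first.
  apply/funext => u; apply: eq_bigr => b _; congr (_ * _).
  by rewrite indicE; congr (nat_of_bool _)%:R; apply/idP/idP; rewrite inE => /inbE.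
apply: measurable_sum => b; apply: measurable_funM.
  apply: measurable_natr.
  apply: (measurableT_comp (measurable_in_bundle hsortf (lo_lt b) (hi_lt b))
    (g := fun u : Omega * T => (cloud u.1, u.2))).
  apply/measurable_fun_pair; last exact: measurable_snd.
  by apply: (measurableT_comp mcloud); exact: measurable_fst.
apply: measurable_sum => k; apply: measurable_funM.
  by apply: (measurableT_comp (measurable_funPT (alpha b k))); exact: measurable_fst.
by apply: (measurableT_comp (measurable_basis hp k)); exact: measurable_snd.
Qed.

Let mindicA : measurable_fun [set: T] (fun z => \1_A z.2 : R).
Proof.
rewrite (_ : (fun z => _) = (fun z => (inA z)%:R)); first exact: measurable_natr.
by apply/funext => z; exact: indicAE.
Qed.

Let clipped_average b w (a : 'I_Q -> R) : R :=
  (\sum_(m in closed_sample (lo b) (hi b) (scores score (cloud w))) loss a (tnth (cloud w) m)) /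
  #|closed_sample (lo b) (hi b) (scores score (cloud w))|%:R.

Let empirical_lossE w b a : empirical_loss sortf gsize (xs w) v (ys w) b (lincomb p a) =
  mean_square_loss p v sortf (lo b) (hi b) a (cloud w).
Proof.
rewrite /empirical_loss /mean_square_loss sample_countE countE; congr (_ / _).
apply: eq_bigr => m _; rewrite /sample_in_bundle /cloud tnth_mktuple real_normK ?num_real//.
congr (_ * _); rewrite indicE; congr (nat_of_bool _)%:R.
by apply/idP/idP; rewrite inE => /inbE.
Qed.

(** Clipping only decreases the loss, and the fitted coefficients minimize the
    empirical loss over the span, in particular against every rational coefficient
    vector. *)
Let clipped_average_le w b : good w ->
  ((clipped_average b w (fun k => alpha b k w))%:E <=
    empirical_bias p v L' sortf (lo b) (hi b) (cloud w))%E.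
Proof.
move=> gw; have [_ N2] := gw b.
have NR : 0 < #|closed_sample (lo b) (hi b) (scores score (cloud w))|%:R :> R.
  by rewrite ltr0n (leq_trans _ N2).
apply: le_empirical_bias.
  rewrite lee_fin /clipped_average ler_pdivrMr// mulrC mulr_natl -sumr_const.
  by apply: ler_sum => m _; have /andP[] := loss_bounds (fun k => alpha b k w) (tnth (cloud w) m).
move=> r; rewrite lee_fin.
have := halpha w b (phi := lincomb p (rational_coef r)) _.
move=> /(_ (ex_intro2 _ _ (rational_coef r) I erefl)).
rewrite !empirical_lossE; apply: le_trans.
rewrite /clipped_average /mean_square_loss sample_countE sum_closed_sample.
rewrite ler_wpM2r ?invr_ge0//; apply: ler_sum => m _.
rewrite ler_wpM2l ?sample_in_bundle_ge0// /loss /clipped_loss.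
case: (inA _); last by rewrite mulr0 square_loss_ge0.
by rewrite mulr1 ge_min lexx.
Qed.

(** On the selection event the squared error is at most [L'] over [A], so that
    clipping does not change it there. *)
Lemma inner_error_le w : good w -> S w ->
  (\int[nu]_z (`|v z.2 - vt w z.1 z.2| ^+ 2 * \1_A z.2)%:E <=
   \sum_(b < B) (dev b (cloud w) + 4%:E * wbias b (cloud w)))%E.
Proof.
move=> gw Sw.
pose C b := [set x : T | inb b w x].
have mC b : measurable (C b).
  have := measurable_fun_pair2 (cloud w) (measurable_in_bundle hsortf (lo_lt b) (hi_lt b)).
  by move=> /(_ measurableT [set true]); rewrite setTI => h; apply: h.
pose g b (x : T) : \bar R := (loss (fun k => alpha b k w) x)%:E.
have mg b : measurable_fun setT (g b) by apply/measurable_EFinP; exact: mloss.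
have g0 b x : (0 <= g b x)%E by rewrite lee_fin.
have mgC b : measurable_fun setT (g b \_ (C b)).
  by apply: ((measurable_restrictT (g b) (mC b)).1 _); exact: (measurable_funTS (mg b)).
have gC0 b x : (0 <= (g b \_ (C b)) x)%E by apply: erestrict_ge0.
apply: (@le_trans _ _ (\int[nu]_z \sum_(b < B) (g b \_ (C b)) z)%E).
  have m1 : measurable_fun setT (fun z : T => (`|v z.2 - vt w z.1 z.2| ^+ 2 * \1_A z.2)%:E).
    apply/measurable_EFinP; apply: measurable_funM => //.
    exact: (measurable_fun_pair2 w measurable_square_error).
  have m2 : measurable_fun setT (fun z : T => \sum_(b < B) (g b \_ (C b)) z)%E.
    exact: emeasurable_sum.
  have p1 (x : T) : (0 <= (`|v x.2 - vt w x.1 x.2| ^+ 2 * \1_A x.2)%:E)%E.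
    by rewrite lee_fin mulr_ge0// exprn_ge0.
  apply: ge0_le_integral; [exact: measurableT|by move=> x _; exact: p1|exact: m1|exact: m2|move=> x _].
  have [b bx] := bundle_cover sortf M0 hgsize (xs w) B0 x.1.
  rewrite (vtilde_bundle M0 hgsize p _ x.2 bx) (bigD1 b)//=.
  apply: (@le_trans _ _ ((g b \_ (C b)) x)); last by rewrite leeDl// sume_ge0.
  rewrite patchE mem_set; last exact/inbE.
  rewrite /g lee_fin indicAE /loss /clipped_loss real_normK ?num_real//.
  rewrite /inA; case: asboolP => Ax; last by rewrite !mulr0.
  rewrite !mulr1 le_min lexx/=.
  exact: (square_loss_le_Lprime hA hp hvA Ax (Sw b)).
rewrite ge0_integral_sum//; apply: lee_sum => b _.
rewrite -integral_mkcond.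
have [inj N2] := gw b.
rewrite (integral_region_closure mscore (lo_lt b) (hi_lt b) (cloud w) _ (mg b) (g0 b)); last first.
  move=> hib; have B1 : (1 < B)%N.
    by apply: (@one_bundle B gsize b); move: hib; rewrite /hi => ->; rewrite orbT.
  exact: scores_atomless.
apply: le_trans (le_bundle_deviation mscore iid (lo_lt b) (hi_lt b) (f := f) (fun r => mloss _) L'0
  inj N2 (mloss _) (loss0 _) _) _.
  by move=> K z'; exact: clipped_excess_le.
rewrite leeD2l// -/(clipped_average b w _) /wbias /weighted_bias.
rewrite -mulrA EFinM lee_wpmul2l// EFinM lee_wpmul2l ?lee_fin ?region_mass_ge0//.
exact: clipped_average_le.
Qed.

Let square_error w : \bar R := (\int[nu]_z (`|v z.2 - vt w z.1 z.2| ^+ 2)%:E)%E.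
Let outer_error w : \bar R :=
  (\int[nu]_z (`|v z.2 - vt w z.1 z.2| ^+ 2 * (1 - \1_A z.2))%:E)%E.

Let mS : measurable S.
Proof.
have mb : measurable_fun setT (fun w => [forall b in predT, \sum_(k < Q) alpha b k w ^+ 2 <= L]).
  apply: measurable_forall_in => b; apply: measurable_fun_ler; last exact: measurable_cst.
  by apply: measurable_sum => k; apply: measurable_funX; exact: (measurable_funPT (alpha b k)).
rewrite (_ : S = (fun w => [forall b in predT, \sum_(k < Q) alpha b k w ^+ 2 <= L]) @^-1` [set true]).
  by rewrite -[X in measurable X]setTI; exact: mb.
apply/seteqP; split => w /=; first by move=> h; apply/forall_inP => b _; exact: h.
by move=> /forall_inP h b; exact: h.
Qed.

Let IS w : \bar R := (\1_S w)%:E.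
Let IS0 w : (0 <= IS w)%E. Proof. by rewrite lee_fin. Qed.
Let mIS : measurable_fun setT IS.
Proof. by apply/measurable_EFinP; exact: measurable_indic. Qed.

Let msquare_error : measurable_fun setT square_error.
Proof.
apply: (measurable_fun_fubini_tonelli_F
  (fun u : Omega * T => (`|v u.2.2 - vt u.1 u.2.1 u.2.2| ^+ 2)%:E)).
  by apply/measurable_EFinP; exact: measurable_square_error.
by move=> u; rewrite lee_fin exprn_ge0.
Qed.

Let indicA_le1 (z : T) : 0 <= 1 - \1_A z.2 :> R.
Proof. by rewrite indicAE subr_ge0; case: (inA z). Qed.

Let mouter_error : measurable_fun setT outer_error.
Proof.
apply: (measurable_fun_fubini_tonelli_F
  (fun u : Omega * T => (`|v u.2.2 - vt u.1 u.2.1 u.2.2| ^+ 2 * (1 - \1_A u.2.2))%:E)).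
  apply/measurable_EFinP; apply: measurable_funM; first exact: measurable_square_error.
  apply: measurable_funB; first exact: measurable_cst.
  by apply: (measurableT_comp mindicA); exact: measurable_snd.
by move=> u; rewrite lee_fin mulr_ge0 ?exprn_ge0.
Qed.

Let square_error0 w : (0 <= square_error w)%E.
Proof. by apply: integral_ge0 => z _; rewrite lee_fin exprn_ge0. Qed.
Let outer_error0 w : (0 <= outer_error w)%E.
Proof. by apply: integral_ge0 => z _; rewrite lee_fin mulr_ge0 ?exprn_ge0. Qed.

Let square_error_split w : square_error w =
  (\int[nu]_z (`|v z.2 - vt w z.1 z.2| ^+ 2 * \1_A z.2)%:E + outer_error w)%E.
Proof.
have me : measurable_fun [set: T] (fun z => `|v z.2 - vt w z.1 z.2| ^+ 2).
  exact: (measurable_fun_pair2 w measurable_square_error).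
have m1 : measurable_fun [set: T] (fun z => (`|v z.2 - vt w z.1 z.2| ^+ 2 * \1_A z.2)%:E).
  by apply/measurable_EFinP; exact: measurable_funM.
have m2 : measurable_fun [set: T] (fun z => (`|v z.2 - vt w z.1 z.2| ^+ 2 * (1 - \1_A z.2))%:E).
  apply/measurable_EFinP; apply: measurable_funM => //.
  by apply: measurable_funB; [exact: measurable_cst|exact: mindicA].
have p1 (z : T) : (0 <= (`|v z.2 - vt w z.1 z.2| ^+ 2 * \1_A z.2)%:E)%E.
  by rewrite lee_fin mulr_ge0 ?exprn_ge0.
have p2 (z : T) : (0 <= (`|v z.2 - vt w z.1 z.2| ^+ 2 * (1 - \1_A z.2))%:E)%E.
  by rewrite lee_fin mulr_ge0 ?exprn_ge0.
rewrite /outer_error -ge0_integralD//.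
by apply: eq_integral => z _; rewrite -EFinD -mulrDr addrCA subrr addr0 mulr1.
Qed.

Let four0 b z : (0 <= 4%:E * wbias b z)%E.
Proof. by apply: mule_ge0 => //; rewrite lee_fin. Qed.

Let mcloud_comp (F : M.-tuple T -> \bar R) : measurable_fun setT F ->
  measurable_fun setT (F \o cloud).
Proof. by move=> mF; exact: (measurableT_comp mF mcloud). Qed.

Lemma integral_square_error_le :
  (\int[P]_w (square_error w * IS w) <=
   \sum_(b < B) \int[mu]_z dev b z + 4%:E * \sum_(b < B) \int[mu]_z wbias b z +
   \int[P]_w (outer_error w * IS w))%E.
Proof.
have mdw b : measurable_fun setT (fun w => dev b (cloud w) + 4%:E * wbias b (cloud w))%E.
  apply: emeasurable_funD; first exact: mcloud_comp.
  by apply: emeasurable_funM; [exact: measurable_cst|exact: mcloud_comp].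
have dw0 b w : (0 <= dev b (cloud w) + 4%:E * wbias b (cloud w))%E.
  exact: adde_ge0 (dev0 b _) (four0 b _).
have msum : measurable_fun setT
    (fun w => \sum_(b < B) (dev b (cloud w) + 4%:E * wbias b (cloud w)))%E.
  exact: emeasurable_sum.
have moi : measurable_fun setT (fun w => outer_error w * IS w)%E.
  exact: emeasurable_funM.
have oi0 w : (0 <= outer_error w * IS w)%E by exact: mule_ge0.
apply: (@le_trans _ _ (\int[P]_w (\sum_(b < B) (dev b (cloud w) + 4%:E * wbias b (cloud w)) +
    outer_error w * IS w))%E).
  apply: ae_ge0_le_integral => //.
  - by move=> w _; exact: mule_ge0.
  - exact: emeasurable_funM.
  - by move=> w _; apply: adde_ge0 => //; exact: sume_ge0.
  - exact: emeasurable_funD.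
  apply: filterS ae_good => w gw _; rewrite /IS indicE.
  case: (boolP (w \in S)) => [|_]; last by rewrite !mule0 adde0 sume_ge0.
  rewrite inE => Sw; rewrite !mule1 square_error_split leeD2r//.
  exact: inner_error_le.
rewrite ge0_integralD//; last by move=> w _; exact: sume_ge0.
rewrite leeD2r// ge0_integral_sum//.
rewrite ge0_sume_distrr; last by move=> b _; exact: integral_ge0.
rewrite -big_split/=; apply: lee_sum => b _.
have md : measurable_fun setT (fun w => dev b (cloud w)) by exact: mcloud_comp.
have mw : measurable_fun setT (fun w => wbias b (cloud w)) by exact: mcloud_comp.
have m4 : measurable_fun setT (fun w => 4%:E * wbias b (cloud w))%E.
  by apply: emeasurable_funM => //; exact: measurable_cst.
rewrite ge0_integralD//.
rewrite ge0_integralZl//.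
by rewrite -!integral_cloud_law.
Qed.

Let bundle_mass b w : R := region_mass nu (in_bundle sortf (lo b) (hi b)) (cloud w).

Let bundle_mass0 b w : 0 <= bundle_mass b w. Proof. exact: region_mass_ge0. Qed.

Let minb b := measurable_in_bundle hsortf (lo_lt b) (hi_lt b).

Let bundleTE w b : bun w b `*` setT = [set x : T | inb b w x].
Proof. by apply/seteqP; split => [x [/inbE]|x /inbE]. Qed.

Let mbundle w b : measurable [set x : T | inb b w x].
Proof. exact: (measurable_region (minb b)). Qed.

Let bundle_massE w b : nu [set x : T | inb b w x] = (bundle_mass b w)%:E.
Proof. exact: (region_massE nu (minb b)). Qed.

Let integral_bundle_cst w b (c : \bar R) :
  (\int[nu]_(x in [set x : T | inb b w x]) c = c * (bundle_mass b w)%:E)%E.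
Proof. by rewrite -bundle_massE; exact: (integral_cst nu (mbundle w b)). Qed.

Let mass_le w b : mass b w <= bundle_mass b w.
Proof.
rewrite -lee_fin -bundle_massE.
have := region_closure_le mscore (lo_lt b) (hi_lt b) nu (cloud w).
apply: le_trans; rewrite (region_massE nu (measurable_in_region mscore (lo_lt b) (hi_lt b)))//.
Qed.

Let rate b w : R := (ln (cnt w b - 1) + 1) * (Q%:R + 1) / (cnt w b - 1).

Let rate0 b w : good w -> 0 <= rate b w.
Proof.
move=> gw; rewrite /rate countE; have [_ N2] := gw b.
have N1 : (1 : R) <= #|closed_sample (lo b) (hi b) (scores score (cloud w))|%:R - 1.
  by rewrite lerBrDr -(natrD _ 1 1) ler_nat.
rewrite divr_ge0//; last exact: le_trans N1.
by rewrite mulr_ge0// addr_ge0// ln_ge0.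
Qed.

Let mrate b : measurable_fun setT (rate b).
Proof.
have mc : measurable_fun setT (fun w => cnt w b - 1).
  apply: measurable_funB; last exact: measurable_cst.
  rewrite (_ : (fun w => _) = sample_count sortf (lo b) (hi b) \o cloud).
    by apply: (measurableT_comp _ mcloud); exact: measurable_sample_count.
  by apply/funext => w; rewrite /= sample_countE countE.
apply: measurable_funM; last exact: measurable_funV.
apply: measurable_funM; last exact: measurable_cst.
by apply: measurable_funD; [exact: (measurableT_comp (@measurable_ln R) mc)|exact: measurable_cst].
Qed.

Let mbundle_mass b : measurable_fun setT (bundle_mass b).
Proof. by apply: (measurableT_comp _ mcloud); exact: (measurable_region_mass nu (minb b)). Qed.

(** Outside the almost sure event where all bundles have two samples the rate may be
    negative; the absolute value makes the integrand nonnegative everywhere. *)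
Let clamped_rate w : R := \sum_(b < B) `|rate b w| * bundle_mass b w.

Let clamped_rate0 w : 0 <= clamped_rate w.
Proof. by apply: sumr_ge0 => b _; exact: mulr_ge0. Qed.

Let mclamped_rate : measurable_fun setT (fun w => (clamped_rate w)%:E).
Proof.
apply/measurable_EFinP; apply: measurable_sum => b; apply: measurable_funM => //.
exact: measurableT_comp.
Qed.

Let integral_rateE : (\int[P]_w \sum_(b < B) \int[nu]_(z in bun w b `*` setT) (rate b w)%:E =
  \int[P]_w (clamped_rate w)%:E)%E.
Proof.
transitivity (\int[P]_w (\sum_(b < B) rate b w * bundle_mass b w)%:E)%E.
  apply: eq_integral => w _; rewrite -sumEFin; apply: eq_bigr => b _.
  by rewrite bundleTE integral_bundle_cst.
apply: ae_eq_integral => //.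
  by apply/measurable_EFinP; apply: measurable_sum => b; exact: measurable_funM.
apply: filterS ae_good => w gw _; congr (_%:E); apply: eq_bigr => b _.
by rewrite ger0_norm// rate0.
Qed.

Lemma integral_rate_ge0 : (0 <= \int[P]_w \sum_(b < B) \int[nu]_(z in bun w b `*` setT)
  ((ln (cnt w b - 1) + 1) * (Q%:R + 1) / (cnt w b - 1))%:E)%E.
Proof.
rewrite [leRHS](_ : _ = \int[P]_w (clamped_rate w)%:E)%E; last exact: integral_rateE.
by apply: integral_ge0 => w _; rewrite lee_fin.
Qed.

Lemma sum_deviation_le :
  (\sum_(b < B) \int[mu]_z dev b z <= (18 * L')%:E *
    \int[P]_w \sum_(b < B) \int[nu]_(z in bun w b `*` setT) (rate b w)%:E)%E.
Proof.
rewrite integral_rateE.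
pose ir (b : 'I_B) (z : M.-tuple T) : R := interior_rate score nu (lo b) (hi b) Q L' z.
have ir0 (b : 'I_B) (z : M.-tuple T) : 0 <= ir b z.
  apply: sumr_ge0 => K _; rewrite !mulr_ge0 ?invr_ge0 ?region_mass_ge0//.
  by rewrite ln_ge0// lerDl.
have mir (b : 'I_B) : measurable_fun setT (fun z : M.-tuple T => (ir b z)%:E).
  apply/measurable_EFinP; rewrite /ir /interior_rate.
  apply: measurable_sum_cond => K; apply: measurable_funM; first exact: measurable_cst.
  apply: measurable_funM.
    by apply: measurable_natr; exact: measurable_interior_is.
  by apply: measurable_region_mass; exact: measurable_in_region.
have mirc (b : 'I_B) : measurable_fun setT (fun w : Omega => (ir b (cloud w))%:E).
  exact: (mcloud_comp (mir b)).
have irc0 (b : 'I_B) (w : Omega) : (0 <= (ir b (cloud w))%:E)%E by rewrite lee_fin.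
apply: (@le_trans _ _ (\sum_(b < B) \int[mu]_z (ir b z)%:E)%E).
  apply: lee_sum => b _; apply: integral_bundle_deviation => //.
  - by move=> r; exact: mloss.
  - by move=> r x; exact: loss_bounds.
rewrite (eq_bigr (fun b => \int[P]_w (ir b (cloud w))%:E))%E; last first.
  by move=> b _; apply: (integral_cloud_law Z (mir b)) => z; rewrite lee_fin.
rewrite -ge0_integral_sum//.
rewrite -ge0_integralZl//; last 2 first.
- by move=> w _; rewrite lee_fin.
- by rewrite lee_fin mulr_ge0.
apply: ae_ge0_le_integral => //.
- by move=> w _; apply: sume_ge0 => b _; rewrite lee_fin.
- exact: emeasurable_sum.
- by move=> w _; rewrite mule_ge0 ?lee_fin ?mulr_ge0.
- by apply: emeasurable_funM => //; exact: measurable_cst.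
apply: filterS ae_good => w gw _; rewrite sumEFin -EFinM lee_fin mulr_sumr.
apply: ler_sum => b _; have [inj N2] := gw b.
apply: le_trans (interior_rate_le nu (lo_lt b) (hi_lt b) Q L'0 inj N2) _.
rewrite -countE -/(rate b w) -mulrA ler_wpM2l ?mulr_ge0//.
by apply: ler_pM; rewrite ?rate0// ?ger0_norm ?rate0// ?region_mass_ge0 ?mass_le.
Qed.

Let bias0 w b : bun w b !=set0 -> (0 <= bundle_bias kappa p v L' (bun w b))%E.
Proof.
move=> [x bx]; rewrite /bundle_bias le_min lee_fin L'0 andbT.
apply: le_ereal_inf_tmp => _ [phi _ <-].
apply: (@le_trans _ _ (conditional_mse kappa v phi x)).
  by apply: integral_ge0 => y _; rewrite lee_fin exprn_ge0.
by apply: ereal_sup_ubound; exists x.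
Qed.

Let sum_bias0 w : (0 <= \sum_(b < B) \int[nu]_(z in bun w b `*` setT)
  bundle_bias kappa p v L' (bun w b))%E.
Proof.
apply: sume_ge0 => b _; apply: integral_ge0 => x [bx _].
by apply: bias0; exists x.1.
Qed.

Lemma integral_bias_ge0 : (0 <= \int[P]_w \sum_(b < B) \int[nu]_(z in bun w b `*` setT)
  bundle_bias kappa p v L' (bun w b))%E.
Proof. by apply: integral_ge0 => w _; exact: sum_bias0. Qed.

Lemma sum_bias_le :
  (\sum_(b < B) \int[mu]_z wbias b z <=
    \int[P]_w \sum_(b < B) \int[nu]_(z in bun w b `*` setT)
      bundle_bias kappa p v L' (bun w b))%E.
Proof.
pose t b := resample_all kappa (wbias b).
have t0 b z : (0 <= t b z)%E by exact: resample_all_ge0.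
have mt b : measurable_fun setT (t b) by exact: measurable_resample_all.
rewrite (eq_bigr (fun b => \int[P]_w t b (cloud w)))%E; last first.
  move=> b _; rewrite -(integral_resample_all hkappa iid (mwbias b) (wbias0 b)).
  exact: (integral_cloud_law Z (mt b) (t0 b)).
have mtc (b : 'I_B) : measurable_fun setT (fun w : Omega => t b (cloud w)).
  exact: (mcloud_comp (mt b)).
rewrite -ge0_integral_sum//.
apply: le_lower_integral.
- exact: emeasurable_sum.
- by move=> w; exact: sume_ge0.
- exact: sum_bias0.
apply: filterS ae_good => w gw; apply: lee_sum => b _.
have [inj N2] := gw b.
rewrite bundleTE integral_bundle_cst muleC.
have N0 : sample_count sortf (lo b) (hi b) (cloud w) != 0.
  by rewrite sample_countE pnatr_eq0 -lt0n (leq_trans _ N2).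
apply: le_trans (resampled_bias_le_bundle_bias nu kappa hp hv L'0 hsortf (lo_lt b) (hi_lt b) M0 N0) _.
have bunE : [set x | above (lo b) (scores score (cloud w)) (sortf x) &&
    below (hi b) (scores score (cloud w)) (sortf x)] = bun w b.
  by rewrite scoresE; apply/seteqP; split => x /= h; apply/(bundleE sortf M0 hgsize (xs w)).
rewrite bunE lee_wpmul2r// ?lee_fin ?mass_le//.
apply: bias0.
have /card_gt0P[m] : (0 < #|closed_sample (lo b) (hi b) (scores score (cloud w))|)%N.
  exact: leq_trans N2.
rewrite inE => mb; exists (xs w m); rewrite -bunE /=.
by move: mb; rewrite {2 4}/scores /cloud !tnth_mktuple.
Qed.

Lemma integral_selected_error_le :
  (\int[P]_w ((\int[nu]_z (`|v z.2 - vt w z.1 z.2| ^+ 2)%:E) * (\1_S w)%:E) <=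
   (18 * L')%:E * (\int[P]_w \sum_(b < B) \int[nu]_(z in bun w b `*` setT)
      ((ln (cnt w b - 1) + 1) * (Q%:R + 1) / (cnt w b - 1))%:E) +
   4%:E * (\int[P]_w \sum_(b < B) \int[nu]_(z in bun w b `*` setT)
      bundle_bias kappa p v L' (bun w b)) +
   \int[P]_w ((\int[nu]_z (`|v z.2 - vt w z.1 z.2| ^+ 2 * (1 - \1_A z.2))%:E) *
      (\1_S w)%:E))%E.
Proof.
apply: (le_trans integral_square_error_le).
apply: leeD2r; apply: leeD; first exact: sum_deviation_le.
by rewrite lee_wpmul2l// sum_bias_le.
Qed.

End assembly.

Unset Implicit Arguments.
Set Strict Implicit.
Set Printing Implicit Defensive.

Theorem theorem3p5 (R : realType) :
  exists theta : R -> R,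
  forall (q Q M B : nat) (hQ : (0 < Q)%N) (hB : (0 < B)%N)
    (nu : probability (borelRV R q * borelRV R q)%type R)
    (kappa : R.-pker (borelRV R q) ~> (borelRV R q))
    (hkappa : regular_conditional_law nu kappa)
    (d : measure_display) (Omega : measurableType d)
    (P : probability Omega R)
    (Z : 'I_M -> {RV P >-> (borelRV R q * borelRV R q)%type})
    (hZlaw : forall m A, measurable A -> P (Z m @^-1` A) = nu A)
    (hZindep : mutually_independent P (fun m => Z m : Omega -> _))
    (p : 'I_Q -> 'rV[R]_q -> R) (hp : forall k, continuous (p k))
    (v : 'rV[R]_q -> R) (hv : measurable_fun setT (v : borelRV R q -> R))
    (hv2 : (\int[nu]_z (v z.2 ^+ 2)%:E < +oo)%E)
    (A : set 'rV[R]_q) (hA : compact A) (hvA : (Csup v A < +oo)%E)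
    (sortf : 'rV[R]_q -> R)
    (hsortf : measurable_fun setT (sortf : borelRV R q -> R))
    (gsize : 'I_B -> nat) (hgsize : almost_equal_sizes (M := M) gsize)
    (L : R) (hL : 0 <= L)
    (alpha : 'I_B -> 'I_Q -> {RV P >-> R}),
  let X w m : 'rV[R]_q := (Z m w).1 in
  let Y w m : 'rV[R]_q := (Z m w).2 in
  let bun w := bundle sortf gsize (X w) in
  let N w := bundle_count sortf gsize (X w) in
  let vt w := vtilde sortf gsize (X w) p (fun b k => alpha b k w) in
  let S := selection_event (fun b k => alpha b k : Omega -> R) L in
  let L' := Lprime p v A L in
  forall
    (hdistinct : {ae P, forall w, injective (X w)})
    (hnice : {ae P, forall w, forall b, 2 <= N w b})
    (halpha : forall w,
      least_squares sortf gsize (X w) p v (Y w) (fun b k => alpha b k w)),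
  (expectation_on P S (fun w =>
     \int[nu]_z (`|v z.2 - vt w z.1 z.2| ^+ 2)%:E)
   <=
   (theta L')%:E / 'E_P[\1_S] *
     (\int[P]_w \sum_(b < B) \int[nu]_(z in bun w b `*` setT)
        ((ln (N w b - 1) + 1) * (Q%:R + 1) / (N w b - 1))%:E)
   + expectation_on P S (fun w =>
       \sum_(b < B | (b.+1 < B)%N) \int[nu]_(z in bun w b `*` setT)
         (24 * L' / N w b)%:E)
   + 12%:E / 'E_P[\1_S] *
     (\int[P]_w \sum_(b < B) \int[nu]_(z in bun w b `*` setT)
        bundle_bias kappa p v L' (bun w b))
   + expectation_on P S (fun w =>
       \int[nu]_z (`|v z.2 - vt w z.1 z.2| ^+ 2 * (1 - \1_A z.2))%:E))%E.
Proof.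
(* 18 is the constant of [deviation_rate]. *)
exists (fun l => 18 * l) => q Q M B hQ hB nu kappa hkappa d Omega P Z hZlaw hZindep p hp v hv hv2
  A hA hvA sortf hsortf gsize hgsize L hL alpha X Y bun N vt S L' hdistinct hnice halpha.
have L'0 : 0 <= L' := Lprime_ge0 A p v hL.
have S0 : (0 <= ('E_P[\1_S])^-1)%E by rewrite inve_ge0; exact: expectation_ge0.
rewrite /expectation_on.
set D := (\int[P]_w \sum_(b < B) \int[nu]_(z in bun w b `*` setT)
  ((ln (N w b - 1) + 1) * (Q%:R + 1) / (N w b - 1))%:E)%E.
set F := (\int[P]_w \sum_(b < B) \int[nu]_(z in bun w b `*` setT)
  bundle_bias kappa p v L' (bun w b))%E.
set G := (\int[P]_w ((\sum_(b < B | _) _) * _))%E.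
set O := (\int[P]_w ((\int[nu]_z (_ * (1 - _))%:E) * _))%E.
have D0 : (0 <= D)%E by exact: integral_rate_ge0.
have F0 : (0 <= F)%E by exact: integral_bias_ge0.
have G0 : (0 <= G)%E.
  apply: integral_ge0 => w _; rewrite mule_ge0 ?lee_fin// sume_ge0// => b _.
  apply: integral_ge0 => z _; rewrite lee_fin divr_ge0 ?mulr_ge0//.
  by apply: sumr_ge0.
have O0 : (0 <= O)%E.
  apply: integral_ge0 => w _; rewrite mule_ge0 ?lee_fin//.
  apply: integral_ge0 => z _; rewrite lee_fin mulr_ge0// ?exprn_ge0//.
have main := integral_selected_error_le hB hkappa hZlaw hZindep hp hv hA hvA hsortf hgsize hL hnice halpha.
apply: (@le_trans _ _ (((18 * L')%:E * D + 4%:E * F + O) * ('E_P[\1_S])^-1)%E).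
  exact: lee_wpmul2r.
have c0 : (0 <= (18 * L')%:E)%E by rewrite lee_fin mulr_ge0.
have D1 : (0 <= (18 * L')%:E * D)%E by exact: mule_ge0.
have F1 : (0 <= 4%:E * F)%E by exact: mule_ge0.
rewrite (ge0_muleDl _ (adde_ge0 D1 F1) O0) (ge0_muleDl _ D1 F1).
rewrite leeD2r// -addeA; apply: leeD; first by rewrite muleAC.
rewrite -[leLHS]add0e; apply: leeD; first exact: mule_ge0.
rewrite [leRHS]muleAC lee_wpmul2r// lee_wpmul2r// lee_fin.
by rewrite ler_nat.
Qed.
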